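(* Assume the setting in the context. Let $f\in L^2(0,T;H)$, let $U^0=(u^0,w^0)\in V\times\mathcal M$ satisfy $u^0-w^0(r)\in K_r$ for $\mu$-a.e. $r\in\mathcal R$, and let $U=(u,w)$ with $u\in H^1(0,T;H)\cap L^2(0,T;V)$ and $w\in H^1(0,T;\mathcal M)$. Then the following are equivalent. (i) $u(0)=u^0$, $w(0)=w^0$, and for a.e. $t\in(0,T)$: $$\kappa(\partial_tu,\varphi)_H+\int_{\mathcal R}c(r)(\partial_tw(r),\varphi)_H\,d\mu(r)+(\nabla u,\nabla\varphi)_H=(f,\varphi)_H\quad\forall\varphi\in V,$$ $$q(r):=u-w(r)\in K_r,\qquad\partial_tw(r)\in N_{K_r}(q(r))\quad\text{for }\mu\text{-a.e. }r\in\mathcal R.$$ (ii) $U_t+\partial\Psi(U)\ni F$ in $\mathcal H$ for a.e. $t\in(0,T)$ and $U(0)=U^0$, where $F(t):=(f(t)/\kappa,0)\in\mathcal H$.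
   Context: $\Omega\subset\mathbb R^d$ is a bounded Lipschitz domain, $T>0$, $H=L^2(\Omega)$ (real) with inner product $(\cdot,\cdot)_H$ and norm $\|\cdot\|$ (also used for vector fields), $V=H_0^1(\Omega)$ with $\|v\|_V=\|\nabla v\|$. Constitutive data: $(\mathcal R,\mathcal A,\mu)$ is a complete finite measure space with $\mu\ge 0$; $a\ge0$ and $\kappa:=1+a$; $c:\mathcal R\to(0,\infty)$ is measurable with $S_c:=\int_{\mathcal R}c\,d\mu<\infty$; for each $r\in\mathcal R$, $K_r\subset H$ is closed and convex with $0\in K_r$; and $\{(r,z)\in\mathcal R\times H: z\in K_r\}\in\mathcal A\otimes\mathcal B(H)$, where $\mathcal B(H)$ is the Borel $\sigma$-algebra. For closed convex $C\subset H$ and $x\in C$, $N_C(x)=\{\xi\in H:(\xi,y-x)_H\le0\ \forall y\in C\}$. $\mathcal M:=L^2(\mathcal R,c\,d\mu;H)$ (Bochner space) with inner product $\langle z_1,z_2\rangle_{\mathcal M}=\int_{\mathcal R}c(r)(z_1(r),z_2(r))_H\,d\mu(r)$. $\mathcal H:=H\times\mathcal M$ with inner product $\langle(u,w),(v,z)\rangle_{\mathcal H}=\kappa(u,v)_H+\langle w,z\rangle_{\mathcal M}$. $\Psi:\mathcal H\to(-\infty,+\infty]$ is given by $\Psi(u,w)=\frac12\|\nabla u\|^2$ if $u\in V$ and $u-w(r)\in K_r$ for $\mu$-a.e. $r$, and $\Psi(u,w)=+\infty$ otherwise. $\partial\Psi$ is the convex subdifferential in $\mathcal H$ with respect to $\langle\cdot,\cdot\rangle_{\mathcal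 H}$. *)

(* Defs.v *)
From HB Require Import structures.
From mathcomp Require Import all_boot all_order all_algebra generic_quotient ring_quotient.
From mathcomp Require Import all_classical all_reals all_analysis.
From mathcomp Require Import measurable_realfun ring lra.

Set Implicit Arguments.
Unset Strict Implicit.
Unset Printing Implicit Defensive.

Import Order.TTheory GRing.Theory Num.Theory.
Import numFieldNormedType.Exports.

Local Open Scope classical_set_scope.
Local Open Scope ring_scope.

HB.mixin Record NormedModule_hasInner (R : realType) V
    of NormedModule R V := {
  inner : V -> V -> R;
  innerC : forall x y, inner x y = inner y x;
  innerDl : forall x y z, inner (x + y) z = inner x z + inner y z;
  innerZl : forall (k : R) x y, inner (k *: x) y = k * inner x y;
  inner_norm : forall x, inner x x = `|x| ^+ 2
}.

#[short(type="innerSpaceType")]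
HB.structure Definition InnerSpace (R : realType) :=
  {V of NormedModule R V & NormedModule_hasInner R V}.

HB.factory Record Lmodule_hasInner (R : realType) V of GRing.Lmodule R V := {
  inner : V -> V -> R;
  innerC : forall x y, inner x y = inner y x;
  innerDl : forall x y z, inner (x + y) z = inner x z + inner y z;
  innerZl : forall (k : R) x y, inner (k *: x) y = k * inner x y;
  inner_ge0 : forall x, 0 <= inner x x;
  inner_eq0 : forall x, inner x x = 0 -> x = 0
}.

HB.builders Context (R : realType) V of Lmodule_hasInner R V.

Let nrm (x : V) : R := Num.sqrt (inner x x).

Let innerDr x y z : inner z (x + y) = inner z x + inner z y.
Proof. by rewrite innerC innerDl !(innerC z). Qed.

Let innerZr k x y : inner y (k *: x) = k * inner y x.
Proof. by rewrite innerC innerZl (innerC y). Qed.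

Let nrm_sq x : nrm x ^+ 2 = inner x x.
Proof. by rewrite sqr_sqrtr// inner_ge0. Qed.

Let nrm_ge0 x : 0 <= nrm x. Proof. exact: sqrtr_ge0. Qed.

Let inner0l y : inner 0 y = 0.
Proof. by rewrite -(scale0r (0 : V)) innerZl mul0r. Qed.

Let nrm_eq0 x : nrm x = 0 -> x = 0.
Proof. by move=> x0; apply: inner_eq0; rewrite -nrm_sq x0 expr0n. Qed.

Let cauchy_schwarz x y : inner x y <= nrm x * nrm y.
Proof.
have [/nrm_eq0 ->|x0] := eqVneq (nrm x) 0.
  by rewrite inner0l mulr_ge0.
have [/nrm_eq0 ->|y0] := eqVneq (nrm y) 0.
  by rewrite innerC inner0l mulr_ge0.
have xy0 : 0 < nrm x * nrm y by rewrite mulr_gt0 // lt_def ?x0 ?y0 nrm_ge0.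
have := inner_ge0 (nrm y *: x - nrm x *: y).
rewrite -scaleNr innerDl !innerDr !innerZl !innerZr (innerC y x) -!nrm_sq.
set p := nrm x in xy0 *; set q := nrm y in xy0 *; set t := inner x y => h.
rewrite -subr_ge0 -(pmulr_rge0 _ xy0).
by move: h; rewrite (_ : _ + _ = 2 * (p * q * (p * q - t))); [lra|ring].
Qed.

Let nrmD x y : nrm (x + y) <= nrm x + nrm y.
Proof.
rewrite -ler_sqr ?nnegrE ?addr_ge0// nrm_sq innerDl !innerDr (innerC y x).
rewrite -!nrm_sq; have := cauchy_schwarz x y; lra.
Qed.

Let nrmZ (k : R) x : nrm (k *: x) = `|k| * nrm x.
Proof.
rewrite /nrm innerZl innerZr mulrA -expr2 sqrtrM ?sqr_ge0//.
by rewrite sqrtr_sqr.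
Qed.

HB.instance Definition _ := Lmodule_isNormed.Build R V nrmD nrmZ nrm_eq0.

HB.instance Definition _ := NormedModule_hasInner.Build R V
  innerC innerDl innerZl (fun x => esym (nrm_sq x)).

HB.end.

Section inner_theory.
Context {R : realType} {V : innerSpaceType R}.
Implicit Types x y z : V.

Lemma innerDr z x y : inner z (x + y) = inner z x + inner z y.
Proof. by rewrite innerC innerDl !(innerC z). Qed.

Lemma innerZr (k : R) y x : inner y (k *: x) = k * inner y x.
Proof. by rewrite innerC innerZl (innerC y). Qed.

Lemma inner_polar x y :
  inner x y = 2^-1 * (`|x + y| ^+ 2 - `|x| ^+ 2 - `|y| ^+ 2).
Proof.
rewrite -!inner_norm innerDl !innerDr (innerC y x); lra.
Qed.

Lemma norm_inner_le x y : `|inner x y| <= `|x| ^+ 2 + `|y| ^+ 2.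
Proof.
have h1 : 0 <= `|x + y| ^+ 2 by rewrite sqr_ge0.
have h2 : 0 <= `|x - y| ^+ 2 by rewrite sqr_ge0.
move: h1 h2; rewrite -scaleN1r -!inner_norm !(innerDl, innerDr, innerZl, innerZr).
rewrite (innerC y x) !inner_norm => h1 h2.
have h3 : 0 <= `|x| ^+ 2 by rewrite sqr_ge0.
have h4 : 0 <= `|y| ^+ 2 by rewrite sqr_ge0.
by rewrite ler_norml; apply/andP; split; lra.
Qed.

End inner_theory.

Section real_inner.
Context {R : realType}.

Let mulC (x y : R^o) : x * y = y * x. Proof. exact: mulrC. Qed.
Let mulDl (x y z : R^o) : (x + y) * z = x * z + y * z.
Proof. exact: mulrDl. Qed.
Let mulZl (k : R) (x y : R^o) : (k *: x) * y = k * (x * y).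
Proof. by rewrite mulrA. Qed.
Let mul_norm (x : R^o) : x * x = `|x| ^+ 2.
Proof. by rewrite -expr2 real_normK ?num_real. Qed.

HB.instance Definition _ :=
  NormedModule_hasInner.Build R R^o mulC mulDl mulZl mul_norm.

End real_inner.

(* The product X * Y with the inner product k (u, v)_X + (w, z)_Y. *)
Definition wprod (R : realType) (k : R) (k0 : 0 < k) (X Y : Type) : Type :=
  (X * Y)%type.

Section wprod_inner.
Context {R : realType} (k : R) (k0 : 0 < k) (X Y : innerSpaceType R).

HB.instance Definition _ := GRing.Lmodule.on (wprod k0 X Y).

Let winner (U V : wprod k0 X Y) : R := k * inner U.1 V.1 + inner U.2 V.2.

Let winnerC U V : winner U V = winner V U.
Proof. by rewrite /winner (innerC U.1) (innerC U.2). Qed.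

Let winnerDl U V W : winner (U + V) W = winner U W + winner V W.
Proof. by rewrite /winner !innerDl; ring. Qed.

Let winnerZl (a : R) U V : winner (a *: U) V = a * winner U V.
Proof. by rewrite /winner !innerZl; ring. Qed.

Let winner_ge0 U : 0 <= winner U U.
Proof.
by rewrite /winner !inner_norm addr_ge0 ?sqr_ge0// mulr_ge0 ?sqr_ge0// ltW.
Qed.

Let winner_eq0 U : winner U U = 0 -> U = 0.
Proof.
rewrite /winner !inner_norm => /eqP; rewrite paddr_eq0 ?sqr_ge0//; last first.
  by rewrite mulr_ge0 ?sqr_ge0// ltW.
rewrite mulf_eq0 gt_eqF//= !sqrf_eq0 !normr_eq0 => /andP[/eqP U1 /eqP U2].
by rewrite [U]surjective_pairing U1 U2.
Qed.

HB.instance Definition _ := Lmodule_hasInner.Build R (wprod k0 X Y)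
  winnerC winnerDl winnerZl winner_ge0 winner_eq0.

End wprod_inner.

Section strongly_measurable.
Context d (S : measurableType d) (R : realType) (X : innerSpaceType R).
Implicit Types f g s : S -> X.

Definition simple s := finite_set (range s) /\
  forall x, measurable (s @^-1` [set x]).

Definition strongly_measurable f := exists s_ : nat -> S -> X,
  (forall n, simple (s_ n)) /\ forall x, s_ n x @[n --> \oo] --> f x.

Lemma simple_preimage s (A : set X) : simple s -> measurable (s @^-1` A).
Proof.
move=> [fs ms].
rewrite (_ : s @^-1` A = \bigcup_(y in range s `&` A) (s @^-1` [set y])).
  by apply: fin_bigcup_measurable => //; exact: finite_setIl.
apply/seteqP; split => [x Asx|x [y [_ Ay] /= ->//]].
by exists (s x) => //; split => //; exists x.
Qed.

Lemma simple_cst (x : X) : simple (fun=> x).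
Proof.
split; first by apply: (sub_finite_set _ (finite_set1 x)) => _ [y _ <-].
move=> y; have [->|/eqP yx] := eqVneq x y.
  by rewrite preimage_cst mem_set.
by rewrite preimage_cst memNset.
Qed.

Lemma simpleDZ (a : R) s t : simple s -> simple t ->
  simple (fun x => a *: s x + t x).
Proof.
move=> ss st; have [[fs ms] [ft mt]] := (ss, st); split.
  apply: (sub_finite_set _ (finite_image2 (fun u v => a *: u + v) fs ft)).
  by move=> _ [x _ <-]; exists (s x); [exists x|exists (t x); [exists x|]].
move=> y; rewrite (_ : _ @^-1` _ = \bigcup_(u in range s)
    (s @^-1` [set u] `&` t @^-1` [set y - a *: u])).
  by apply: fin_bigcup_measurable => // u _; exact: measurableI.
apply/seteqP; split => [x /= <-|x [u _ /= [-> ->]]].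
  by exists (s x); [exists x|split => //=; rewrite addrAC subrr add0r].
by rewrite addrC subrK.
Qed.

Lemma strongly_measurableDZ (a : R) f g :
  strongly_measurable f -> strongly_measurable g ->
  strongly_measurable (fun x => a *: f x + g x).
Proof.
move=> [s [ss sf]] [t [st tg]].
exists (fun n x => a *: s n x + t n x); split => [n|x]; first exact: simpleDZ.
by apply: cvgD => //; apply: cvgZ => //; exact: cvg_cst.
Qed.

Lemma simple_measurable_norm s : simple s -> measurable_fun setT (fun x => `|s x|).
Proof.
move=> ss _ A _; rewrite setTI.
exact: (simple_preimage ([set y | A `|y|]) ss).
Qed.

Lemma strongly_measurable_norm f : strongly_measurable f ->
  measurable_fun setT (fun x => `|f x|).
Proof.
move=> [s [ss sf]].
apply: (measurable_fun_cvg (h := fun n x => `|s n x|)) => [n|x _].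
  exact: simple_measurable_norm.
by apply: cvg_norm; exact: sf.
Qed.

End strongly_measurable.

(* L^2(S, mu; X) in the sense of Bochner. The representatives are everywhere
   limits of simple functions: every mu-a.e. limit of simple functions is
   mu-a.e. equal to one of them, so this gives the usual space of classes. *)
Section square_integrable.
Context d (S : measurableType d) (R : realType).
Context (mu : {measure set S -> \bar R}) (X : innerSpaceType R).
Implicit Types f g : S -> X.

Definition square_integrable f := strongly_measurable f /\
  (\int[mu]_x (`|f x| ^+ 2)%:E < +oo)%E.

Lemma measurable_normsq f : strongly_measurable f ->
  measurable_fun setT (fun x => (`|f x| ^+ 2)%:E).
Proof.
move=> mf; apply/measurable_EFinP.
by apply: measurable_funX; exact: strongly_measurable_norm.
Qed.

Lemma square_integrable0 : square_integrable (fun=> 0).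
Proof.
split; first by exists (fun _ _ => 0); split => [n|x];
  [exact: simple_cst|exact: cvg_cst].
by rewrite integral0_eq// => x _; rewrite normr0 expr0n.
Qed.

Lemma square_integrableDZ (a : R) f g : square_integrable f ->
  square_integrable g -> square_integrable (fun x => a *: f x + g x).
Proof.
move=> [mf If] [mg Ig]; split; first exact: strongly_measurableDZ.
have le x : ((`|a *: f x + g x| ^+ 2)%:E <=
    (2 * a ^+ 2)%:E * (`|f x| ^+ 2)%:E + 2%:E * (`|g x| ^+ 2)%:E)%E.
  rewrite -!EFinM -EFinD lee_fin -mulrA -[a ^+ 2]real_normK ?num_real//.
  rewrite -exprMn -normrZ.
  set u := a *: f x; set v := g x.
  have h := ler_normD u v; have h0 := normr_ge0 (u + v).
  apply: (@le_trans _ _ ((`|u| + `|v|) ^+ 2)); first by rewrite ler_sqr ?nnegrE ?addr_ge0.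
  have := sqr_ge0 (`|u| - `|v|); rewrite sqrrB sqrrD; lra.
have mDZ := measurable_normsq (strongly_measurableDZ a mf mg).
have m1 := measurable_normsq mf; have m2 := measurable_normsq mg.
have a0 : 0 <= 2 * a ^+ 2 by rewrite mulr_ge0 ?sqr_ge0.
apply: (@le_lt_trans _ _ (\int[mu]_x ((2 * a ^+ 2)%:E * (`|f x| ^+ 2)%:E +
    2%:E * (`|g x| ^+ 2)%:E))%E).
  apply: (ge0_le_integral mu measurableT) => [x _||| x _].
  - by rewrite lee_fin sqr_ge0.
  - exact: mDZ.
  - by apply: emeasurable_funD; exact: measurable_funeM.
  - exact: le.
rewrite ge0_integralD//; last first.
- exact: measurable_funeM.
- exact: measurable_funeM.
- by move=> x _; rewrite mule_ge0// lee_fin ?sqr_ge0.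
rewrite ge0_integralZl_EFin//.
rewrite ge0_integralZl_EFin//.
by rewrite lte_add_pinfty// lte_mul_pinfty// lee_fin.
Qed.

End square_integrable.

Section L2.
Context d (S : measurableType d) (R : realType).
Context (mu : {measure set S -> \bar R}) (X : innerSpaceType R).

Definition sqint : {pred S -> X} := mem [set f | square_integrable mu f].

Let sqint_submod : submod_closed sqint.
Proof.
split; first by rewrite inE; exact: square_integrable0.
by move=> a f g; rewrite !inE; exact: square_integrableDZ.
Qed.

HB.instance Definition _ := GRing.isSubmodClosed.Build _ _ sqint sqint_submod.

Record L2fun := MkL2fun { L2fun_val :> S -> X; _ : L2fun_val \in sqint }.

HB.instance Definition _ := [isSub for L2fun_val].
HB.instance Definition _ := [Choice of L2fun by <:].
HB.instance Definition _ := [SubChoice_isSubLmodule of L2fun by <:].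

Lemma L2fun_strongly_measurable (f : L2fun) : strongly_measurable f.
Proof. by case: f => f /=; rewrite inE => -[]. Qed.

Lemma L2fun_sqint (f : L2fun) : (\int[mu]_x (`|f x| ^+ 2)%:E < +oo)%E.
Proof. by case: f => f /=; rewrite inE => -[]. Qed.

Definition L2null : {pred L2fun} :=
  mem [set f : L2fun | {ae mu, forall x, f x = 0}].

Let L2null_zmod : zmod_closed L2null.
Proof.
split; first by rewrite inE /=; exact: aeW.
move=> f g; rewrite !inE /= => f0 g0.
by apply: filterS2 f0 g0 => x fx gx; change (f x - g x = 0); rewrite fx gx subr0.
Qed.

HB.instance Definition _ := GRing.isZmodClosed.Build _ L2null L2null_zmod.

Definition L2 : Type := Quotient.quot L2null.

HB.instance Definition _ := GRing.Zmodule.on L2.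
HB.instance Definition _ := EqQuotient.on L2.

Definition L2_fun (f : L2) : S -> X := L2fun_val (repr f).
Coercion L2_fun : L2 >-> Funclass.

Local Open Scope quotient_scope.

Lemma L2_piP (f g : L2fun) :
  \pi_L2 f = \pi_L2 g <-> {ae mu, forall x, f x = g x}.
Proof.
split=> [/eqP|fg].
  rewrite -Quotient.idealrBE inE /=; apply: filterS => x h.
  by apply/eqP; rewrite -subr_eq0; apply/eqP; exact: h.
apply/eqP; rewrite -Quotient.idealrBE inE /=; apply: filterS fg => x h.
by change (f x - g x = 0); rewrite h subrr.
Qed.

Lemma L2_repr (f : L2fun) : {ae mu, forall x, (\pi_L2 f : L2) x = f x}.
Proof. by apply/L2_piP; rewrite reprK. Qed.

Lemma L2P (f g : L2) : f = g <-> {ae mu, forall x, f x = g x}.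
Proof. by rewrite -[in f = _](reprK f) -[in _ = g](reprK g); exact: L2_piP. Qed.

Lemma L2_addE (f g : L2) : {ae mu, forall x, (f + g : L2) x = f x + g x}.
Proof.
rewrite -[X in (X + _ : L2)]reprK -[X in (_ + X : L2)]reprK -pi_addr.
exact: L2_repr.
Qed.

Let scale (a : R) (f : L2) : L2 := \pi_L2 (a *: repr f).

Let scaleE a (f : L2) : {ae mu, forall x, (scale a f) x = a *: f x}.
Proof. exact: L2_repr. Qed.

Let scaleA a b f : scale a (scale b f) = scale (a * b) f.
Proof.
apply/L2P; apply: filterS3 (scaleE a (scale b f)) (scaleE b f) (scaleE (a * b) f).
by move=> x -> -> ->; rewrite scalerA.
Qed.

Let scale1 : left_id 1 scale.
Proof. by move=> f; apply/L2P; apply: filterS (scaleE 1 f) => x ->; rewrite scale1r. Qed.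

Let scaleDr : right_distributive scale +%R.
Proof.
move=> a f g; apply/L2P.
have h1 : \forall x \ae mu, (scale a (f + g)) x = a *: (f x + g x).
  by apply: filterS2 (scaleE a (f + g)) (L2_addE f g) => x -> ->.
have h2 : \forall x \ae mu, scale a f x + scale a g x = a *: f x + a *: g x.
  by apply: filterS2 (scaleE a f) (scaleE a g) => x -> ->.
apply: filterS3 h1 (L2_addE (scale a f) (scale a g)) h2.
by move=> x -> -> ->; rewrite scalerDr.
Qed.

Let scaleDl f : {morph scale^~ f : a b / a + b}.
Proof.
move=> a b; apply/L2P.
have h : \forall x \ae mu, scale a f x + scale b f x = a *: f x + b *: f x.
  by apply: filterS2 (scaleE a f) (scaleE b f) => x -> ->.
apply: filterS3 (scaleE (a + b) f) (L2_addE (scale a f) (scale b f)) h.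
by move=> x -> -> ->; rewrite scalerDl.
Qed.

HB.instance Definition _ := GRing.Zmodule_isLmodule.Build R L2
  scaleA scale1 scaleDr scaleDl.

Lemma L2_scaleE (a : R) (f : L2) : {ae mu, forall x, (a *: f : L2) x = a *: f x}.
Proof. exact: scaleE. Qed.

Let integrable_inner (f g : L2) : mu.-integrable setT (fun x => (inner (f x) (g x))%:E).
Proof.
have mf := L2fun_strongly_measurable (repr f).
have mg := L2fun_strongly_measurable (repr g).
have mfg := strongly_measurableDZ 1 mf mg.
have iN (h : L2fun) : mu.-integrable setT (fun x => (`|h x| ^+ 2)%:E).
  apply/integrableP; split; first exact/measurable_normsq/L2fun_strongly_measurable.
  under eq_integral do rewrite gee0_abs ?lee_fin ?sqr_ge0//.
  exact: L2fun_sqint.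
apply: (le_integrable measurableT _ _ (integrableD measurableT (iN (repr f)) (iN (repr g)))).
  under eq_fun do rewrite inner_polar.
  apply/measurable_EFinP; apply: measurable_funM; first exact: measurable_cst.
  apply: measurable_funB; first apply: measurable_funB.
  - have /measurable_EFinP := measurable_normsq mfg.
    by under eq_fun do rewrite scale1r.
  - by have /measurable_EFinP := measurable_normsq mf.
  - by have /measurable_EFinP := measurable_normsq mg.
move=> x _; rewrite -EFinD /= lee_fin.
by rewrite (le_trans (norm_inner_le _ _))// ler_norm.
Qed.

Let L2inner (f g : L2) : R := (\int[mu]_x inner (f x) (g x))%R.

Let L2innerC f g : L2inner f g = L2inner g f.
Proof. by apply: eq_Rintegral => x _; rewrite innerC. Qed.

Let Rint_ae (h k : S -> R) : mu.-integrable setT (EFin \o h) ->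
  mu.-integrable setT (EFin \o k) -> {ae mu, forall x, h x = k x} ->
  (\int[mu]_x h x)%R = (\int[mu]_x k x)%R.
Proof.
move=> ih ik hk; rewrite /Rintegral; congr fine.
apply: ae_eq_integral => //; [exact: measurable_int ih|exact: measurable_int ik|].
by apply: filterS hk => x + _ => ->.
Qed.

Let L2innerDl f g h : L2inner (f + g) h = L2inner f h + L2inner g h.
Proof.
rewrite /L2inner -RintegralD//; try exact: integrable_inner.
apply: Rint_ae; first exact: integrable_inner.
  exact: (integrableD measurableT (integrable_inner f h) (integrable_inner g h)).
by apply: filterS (L2_addE f g) => x ->; rewrite innerDl.
Qed.

Let L2innerZl (a : R) f g : L2inner (a *: f) g = a * L2inner f g.
Proof.
rewrite /L2inner -RintegralZl//; try exact: integrable_inner.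
apply: Rint_ae; first exact: integrable_inner.
  exact: (integrableZl measurableT a (integrable_inner f g)).
by apply: filterS (L2_scaleE a f) => x ->; rewrite innerZl.
Qed.

Let L2inner_ge0 f : 0 <= L2inner f f.
Proof.
by apply: Rintegral_ge0 => x _; rewrite inner_norm sqr_ge0.
Qed.

Let L2inner_eq0 f : L2inner f f = 0 -> f = 0.
Proof.
move=> f0; apply/L2P.
have mf := L2fun_strongly_measurable (repr f).
have : (\int[mu]_x `|(`|f x| ^+ 2)%:E| = 0)%E.
  under eq_integral => x _ do
    rewrite gee0_abs ?lee_fin ?sqr_ge0// -inner_norm.
  have := integrable_fin_num measurableT (integrable_inner f f).
  move=> /fineK <-.
  by move: f0; rewrite /L2inner /Rintegral => ->.
move/(ae_eq_integral_abs mu measurableT (measurable_normsq mf)).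
have z0 := L2_repr 0.
rewrite pi_zeror in z0.
apply: filterS2 z0 => x -> /(_ I) /= [] /eqP.
by rewrite sqrf_eq0 normr_eq0 => /eqP.
Qed.

HB.instance Definition _ := Lmodule_hasInner.Build R L2
  L2innerC L2innerDl L2innerZl L2inner_ge0 L2inner_eq0.

Lemma L2_innerE (f g : L2) : inner f g = (\int[mu]_x inner (f x) (g x))%R.
Proof. by []. Qed.

End L2.

Notation borel T := (g_sigma_algebraType (@open T)).

Section lebesgue_rV.
Context (R : realType).

Local Notation tupR n := (n.-tuple (measurableTypeR R)).

Let cons n (p : measurableTypeR R * tupR n) : tupR n.+1 :=
  [tuple of p.1 :: p.2].

Let uncons n (t : tupR n.+1) : measurableTypeR R * tupR n :=
  (thead t, [tuple of behead t]).

Let mcons n : measurable_fun setT (@cons n).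
Proof. exact: measurable_cons. Qed.

Let muncons n : measurable_fun setT (@uncons n).
Proof.
by apply: measurable_fun_pair; [exact: measurable_tnth|exact: measurable_behead].
Qed.

Let consK n : cancel (@cons n) (@uncons n).
Proof. by move=> [x t]; congr pair; apply/val_inj. Qed.

Definition lebesgue_cons n (m : {sigma_finite_measure set (tupR n) -> \bar R}) :
    set (tupR n.+1) -> \bar R :=
  pushforward (@lebesgue_measure R \x m)%E (@cons n).

Section lebesgue_cons.
Context n (m : {sigma_finite_measure set (tupR n) -> \bar R}).

Let nu : {measure set (tupR n.+1) -> \bar R} :=
  measure_function_pushforward__canonical__measure_function_Measure
    (@lebesgue_measure R \x m)%E (@mcons n).

HB.instance Definition _ := isMeasure.Build _ _ _ (lebesgue_cons m)
  (measure0 nu) (measure_ge0 nu) (@measure_semi_sigma_additive _ _ _ nu).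

Let sfinite : sigma_finite setT (lebesgue_cons m).
Proof.
have /sigma_finiteP[F [FT ndF Foo]] := sigma_finiteT (@lebesgue_measure R).
have /sigma_finiteP[G [GT ndG Goo]] := sigma_finiteT m.
exists (fun k => @uncons n @^-1` (F k `*` G k)).
  apply/seteqP; split=> // t _; rewrite -preimage_bigcup /=.
  have [i _ Fi] : (\bigcup_i F i) (uncons t).1 by rewrite -FT.
  have [j _ Gj] : (\bigcup_i G i) (uncons t).2 by rewrite -GT.
  exists (maxn i j) => //; split.
    by move: Fi; exact/subsetPset/ndF/leq_maxl.
  by move: Gj; exact/subsetPset/ndG/leq_maxr.
move=> k; have [mF Fk] := Foo k; have [mG Gk] := Goo k.
split; first by rewrite -[X in measurable X]setTI; apply: muncons => //; exact: measurableX.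
rewrite /lebesgue_cons /pushforward (_ : _ @^-1` _ = F k `*` G k).
  rewrite product_measure1E// lte_mul_pinfty// ge0_fin_numE//.
rewrite -comp_preimage (_ : _ \o _ = id) ?preimage_id//.
exact/funext/consK.
Qed.

HB.instance Definition _ := Measure_isSigmaFinite.Build _ _ _
  (lebesgue_cons m) sfinite.

End lebesgue_cons.

Fixpoint lebesgue_tuple n : {sigma_finite_measure set (tupR n) -> \bar R} :=
  if n is n'.+1 then lebesgue_cons (lebesgue_tuple n') else \d_[tuple].

Let to_rV n (t : tupR n) : borel 'rV[R]_n := \row_i tnth t i.

Let box n (q : n.-tuple rat * nat) : set (tupR n) :=
  \bigcap_i [set t : tupR n | `|ratr (tnth q.1 i) - tnth t i| < q.2.+1%:R^-1].

Let measurable_box n q : measurable (@box n q).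
Proof.
apply: fin_bigcap_measurable => // i _.
have /(_ measurableT (ball (ratr (tnth q.1 i) : R) q.2.+1%:R^-1)) :=
  @measurable_tnth _ (measurableTypeR R) n i.
rewrite setTI; apply; exact: measurable_ball.
Qed.

Let measurable_to_rV n : measurable_fun setT (@to_rV n).
Proof.
apply: (@measurability _ _ _ (borel 'rV[R]_n) setT (@to_rV n) (@open 'rV[R]_n)) => // _ [U oU <-]; rewrite setTI.
rewrite (_ : _ @^-1` _ = \bigcup_(q : n.-tuple rat * nat)
    (if `[< box q `<=` @to_rV n @^-1` U >] then box q else set0)).
  apply: countable_bigcupT_measurable => // q.
  by case: ifPn => _; [exact: measurable_box|exact: measurable0].
apply/seteqP; split=> [t Ut|t [q _]]; last by case: asboolP => // h /h.
have : nbhs (to_rV t : 'rV[R]_n) U by exact: open_nbhs_nbhs.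
rewrite -nbhs_ballE => -[e /= e0 eU].
have e20 : 0 < e / 2 by rewrite divr_gt0.
pose k := Num.trunc (e / 2)^-1.
have ke : k.+1%:R^-1 < e / 2.
  rewrite -[ltRHS]invrK ltf_pV2 ?posrE ?invr_gt0//.
  exact: truncnS_gt.
have hq i : exists q : rat, `|ratr q - tnth t i| < k.+1%:R^-1.
  have lt0 : tnth t i < tnth t i + k.+1%:R^-1 by rewrite ltrDl invr_gt0.
  have [q] := rat_in_itvoo lt0.
  by rewrite in_itv /= => /andP[q1 q2]; exists q; rewrite gtr0_norm ?subr_gt0// ltrBlDl.
pose q := [tuple projT1 (cid (hq i)) | i < n].
have qt : box (q, k) t by move=> i _ /=; rewrite tnth_mktuple; case: cid.
exists (q, k) => //; case: asboolP => // -[] s qs.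
apply: eU; split => // i j; rewrite !mxE /ball /=.
have := qt j I; have := qs j I; rewrite /= => h1 h2.
rewrite -(subrK (ratr (tnth q j)) (tnth t j)) -addrA.
rewrite (le_lt_trans (ler_normD _ _))// [ltRHS]splitr.
by rewrite ltrD// (lt_trans _ ke)// distrC.
Qed.

Definition lebesgue_rV n : set (borel 'rV[R]_n) -> \bar R :=
  pushforward (lebesgue_tuple n) (@to_rV n).

HB.instance Definition _ n := Measure.copy (@lebesgue_rV n)
  (measure_function_pushforward__canonical__measure_function_Measure (lebesgue_tuple n) (@measurable_to_rV n)).

End lebesgue_rV.
Arguments lebesgue_rV : clear implicits.

(* The measure c dmu. *)
Definition weighted_measure d (S : measurableType d) (R : realType)
    (mu : {measure set S -> \bar R}) (c : S -> R)
    (mc : measurable_fun setT c) (c0 : forall x, 0 < c x) : set S -> \bar R :=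
  fun A => (\int[mu]_(x in A) (c x)%:E)%E.

Section weighted_measure.
Context d (S : measurableType d) (R : realType).
Context (mu : {measure set S -> \bar R}) (c : S -> R).
Context (mc : measurable_fun setT c) (c0 : forall x, 0 < c x).

Local Notation cmu := (weighted_measure mu mc c0).

Let cmu0 : cmu set0 = 0%E.
Proof. exact: integral_set0. Qed.

Let cmu_ge0 A : (0 <= cmu A)%E.
Proof. by apply: integral_ge0 => x _; rewrite lee_fin ltW. Qed.

Let cmu_sigma_additive : semi_sigma_additive cmu.
Proof.
move=> F mF tF mUF.
rewrite /weighted_measure ge0_integral_bigcup//.
- apply/cvg_closeP; split; last by rewrite closeE.
  by apply: is_cvg_nneseries => k _ _; exact: cmu_ge0.
- by apply/measurable_EFinP; exact: measurable_funTS.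
- by move=> x _; rewrite lee_fin ltW.
Qed.

HB.instance Definition _ := isMeasure.Build _ _ _ cmu
  cmu0 cmu_ge0 cmu_sigma_additive.

End weighted_measure.

Section test_functions.
Context (R : realType) (V : normedModType R).

Fixpoint Ck k (f : V -> R) : Prop :=
  if k is k'.+1 then
    (forall x, differentiable f x) /\ forall v, Ck k' ('D_v f)
  else continuous f.

Definition smooth (f : V -> R) := forall k, Ck k f.

Definition test_fun (D : set V) (f : V -> R) := smooth f /\
  exists2 C : set V, compact C & C `<=` D /\ forall x, ~ C x -> f x = 0.

End test_functions.

Section domain.
Context (R : realType) (n : nat).

(* Near each of its boundary points the domain is, in suitable orthonormal
   coordinates, the strict epigraph of a Lipschitz function. *)
Definition lipschitz_boundary (Omega : set 'rV[R]_n.+1) :=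
  forall x, closure Omega x -> ~ Omega x ->
  exists (A : 'M[R]_n.+1) (gamma : 'rV[R]_n -> R) (e : R),
    [/\ A *m A^T = 1%:M, exists L : R, L.-lipschitz gamma, 0 < e &
      forall y, ball x e y -> Omega y <->
        gamma (\row_(i < n) (y *m A) ord0 (lift ord_max i))
          < (y *m A) ord0 ord_max].

Definition bounded_lipschitz_domain (Omega : set 'rV[R]_n.+1) :=
  [/\ open Omega, connected Omega, Omega !=set0, bounded_set Omega
    & lipschitz_boundary Omega].

Lemma domain_measurable Omega : bounded_lipschitz_domain Omega ->
  measurable (Omega : set (borel 'rV[R]_n.+1)).
Proof. by move=> [oO _ _ _ _]; exact: sub_sigma_algebra. Qed.

Context (Omega : set 'rV[R]_n.+1) (hO : bounded_lipschitz_domain Omega).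

Definition lebesgue_on : {measure set (borel 'rV[R]_n.+1) -> \bar R} :=
  mrestr (lebesgue_rV R n.+1) (domain_measurable hO).

Local Notation H := (L2 lebesgue_on R^o).

Definition partial (i : 'I_n.+1) (phi : 'rV[R]_n.+1 -> R) : 'rV[R]_n.+1 -> R :=
  'D_(delta_mx ord0 i) phi.

Definition weak_gradient (u : H) (g : 'I_n.+1 -> H) :=
  forall phi, test_fun Omega phi -> forall i,
    (\int[lebesgue_on]_x (u x * partial i phi x) =
     - \int[lebesgue_on]_x (g i x * phi x))%R.

(* The closure of the test functions in H^1(Omega). *)
Definition H10 : set H := [set u | exists2 g, weak_gradient u g &
  exists2 phi : nat -> 'rV[R]_n.+1 -> R, (forall k, test_fun Omega (phi k)) &
    (\int[lebesgue_on]_x ((u x - phi k x) ^+ 2)%:E @[k --> \oo] --> 0)%E /\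
    forall i, (\int[lebesgue_on]_x ((g i x - partial i (phi k) x) ^+ 2)%:E
      @[k --> \oo] --> 0)%E].

Definition grad (u : H) : 'I_n.+1 -> H := xget (fun=> 0) (weak_gradient u).

Definition grad_inner (u v : H) : R := \sum_i inner (grad u i) (grad v i).

End domain.

Notation L2domain R hO := (L2 (lebesgue_on hO) R^o).

Section bochner_integral.
Context d (S : measurableType d) (R : realType).
Context (mu : {measure set S -> \bar R}) (X : innerSpaceType R).

Definition simple_integral (s : S -> X) : X :=
  \sum_(x \in [set: X]) fine (mu (s @^-1` [set x])) *: x.

Definition is_bochner_integral (f : S -> X) (I : X) :=
  strongly_measurable f /\
  exists2 s_ : nat -> S -> X,
    (forall k, simple (s_ k) /\ (\int[mu]_x `|s_ k x|%:E < +oo)%E) &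
    (\int[mu]_x `|f x - s_ k x|%:E @[k --> \oo] --> 0)%E /\
    simple_integral (s_ k) @[k --> \oo] --> I.

End bochner_integral.

Section time.
Context (R : realType) (T : R).

Definition lebesgue_time : {measure set (measurableTypeR R) -> \bar R} :=
  mrestr (@lebesgue_measure R) (measurable_itv `]0, T[).

Section weak_derivative.
Context (X : innerSpaceType R).
Local Notation L2T := (L2 lebesgue_time X).

Definition is_weak_derivative (v g : L2T) :=
  forall phi : R -> R, test_fun `]0, T[%classic phi -> exists I : X,
    is_bochner_integral lebesgue_time (fun t => derive1 phi t *: v t) (- I) /\
    is_bochner_integral lebesgue_time (fun t => phi t *: g t) I.

Definition is_time_derivative (u : R -> X) (g : L2T) := exists2 v : L2T,
  {ae lebesgue_time, forall t, u t = v t} & is_weak_derivative v g.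

(* Elements of H^1(0, T; X) are given by their continuous representative on
   [0, T], so that u 0 is meaningful. *)
Definition H1time (u : R -> X) :=
  {within `[0, T], continuous u} /\ exists g, is_time_derivative u g.

Definition time_derivative (u : R -> X) : L2T :=
  xget 0 (is_time_derivative u).

End weak_derivative.

(* L^2(0, T; V) for V = H^1_0(Omega) with the norm |grad u|. *)
Section L2V.
Context n (Omega : set 'rV[R]_n.+1) (hO : bounded_lipschitz_domain Omega).
Local Notation H := (L2domain R hO).

Definition L2V (u : R -> H) := exists2 v : R -> H,
  {ae lebesgue_time, forall t, u t = v t} &
  [/\ forall t, H10 (v t),
      exists2 s_ : nat -> measurableTypeR R -> H,
        (forall k, simple (s_ k) /\ forall t, H10 (s_ k t)) &
        forall t, grad_inner (s_ k t - v t) (s_ k t - v t) @[k --> \oo] --> (0 : R)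
    & (\int[lebesgue_time]_t (grad_inner (v t) (v t))%:E < +oo)%E].

End L2V.

End time.

Section convex_analysis.
Context (R : realType) (X : innerSpaceType R).

Definition normal_cone (C : set X) (x : X) : set X :=
  [set xi | forall y, C y -> inner xi (y - x) <= 0].

Definition subdifferential (Psi : X -> \bar R) (x : X) : set X :=
  [set xi | forall y, (Psi x + (inner xi (y - x))%:E <= Psi y)%E].

End convex_analysis.

Section energy.
Context (R : realType) n (Omega : set 'rV[R]_n.+1).
Context (hO : bounded_lipschitz_domain Omega).
Context d (S : measurableType d) (mu : {measure set S -> \bar R}) (c : S -> R).
Context (mc : measurable_fun setT c) (c0 : forall r, 0 < c r).
Context (kappa : R) (kappa0 : 0 < kappa).
Context (K : S -> set (L2domain R hO)).

Local Notation H := (L2domain R hO).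
Local Notation M := (L2 (weighted_measure mu mc c0) H).

Definition Psi (U : wprod kappa0 H M) : \bar R :=
  if `[< H10 U.1 /\ {ae mu, forall r, K r (U.1 - U.2 r)} >]
  then (2^-1 * grad_inner U.1 U.1)%:E else +oo%E.

End energy.

Lemma kappa_gt0 (R : realType) (a : R) : 0 <= a -> 0 < 1 + a.
Proof. by move=> a0; rewrite ltr_pwDl. Qed.

(* Main.v *)
(* Subtracting U_t, (ii) says that (f / kappa - u_t, - w_t) is a subgradient of
   Psi at (u, w) for a.e. t, because the time derivative of the pair (u, w) is
   the pair of the time derivatives; this rests on the uniqueness of weak
   derivatives, i.e. on the fundamental lemma of the calculus of variations.

   (i) => (ii): for a competitor (v, z) of finite energy, the equation tested
   with v - u leaves the convexity inequality of |grad|^2 / 2 and the integral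
   over r of the normal cone inequalities.

   (ii) => (i): the competitors (u + h phi, w + h phi), with h of both signs,
   leave u - w unchanged and yield the equation. If the normal cone condition
   failed on a non-negligible set of r, there would be m such that the
   measurable set of the pairs (r, y) with y in K_r, |y| <= m and
   (w_t(r), y - q(r)) > 0, where q = u - w, has a non-negligible projection.
   It then has a measurable selection y(r) over a set B of positive measure,
   and the competitor (u, w - 1_B (y - q)) contradicts (ii).

   The selection: a measurable subset of S x H is the set of branches of a
   Suslin scheme of rectangles. Bounding the coordinates of the branches one
   after the other loses arbitrarily little outer measure; the bounded branches
   form a finitely branching tree, and its leftmost branch over r is measurable
   in r and shrinks to a point of the complete separable space H. *)

Require Import Defs.
From HB Require Import structures.
From mathcomp Require Import all_boot all_order all_algebra.
From mathcomp Require Import all_classical all_reals all_analysis.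
From mathcomp Require Import measurable_realfun ring lra.
Set Implicit Arguments.
Unset Strict Implicit.
Unset Printing Implicit Defensive.
Import Order.TTheory GRing.Theory Num.Theory.
Import numFieldNormedType.Exports.
Local Open Scope classical_set_scope.
Local Open Scope ring_scope.

(** * Smooth functions *)

(** Derivatives and gradients enter the statement through [xget], as some choice among the weak
    derivatives that exist. Nothing relates the choices made for [u], [w] and their pair, or for [u]
    and [u + h phi], until uniqueness is known; hence the explicit test functions, built from
    [exp(-1/x)], that approximate indicators of intervals and boxes.

    A selection theorem is called for because only the graph of [K] is measurable: the set of [r]
    where the cone condition fails is a projection, handled through its outer measure, while
    competitors must be strongly measurable in [r]. The cut-off [|y| <= m] makes the selected
    competitor square integrable, as [c dmu] is finite; for the same reason constants in [r] lie in
    [M], which allows [w + h phi]. Positivity of [c] gives [mu] and [c dmu] the same null sets, so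
    that constraints stated for [mu] match the classes of [M]. The factor [1/kappa] in [F] cancels
    the weight [kappa] of the product. *)

Section Ck_theory.
Context (R : realType) (V : normedModType R).
Implicit Types f g : V -> R.

Lemma Ck_continuous k f : Ck k f -> continuous f.
Proof. by case: k => [//|k] [df _] x; exact: differentiable_continuous. Qed.

Lemma CkS k f : Ck k.+1 f -> Ck k f.
Proof.
elim: k f => [|k IH] f; first exact: Ck_continuous.
by move=> [df kf]; split => // v; apply: IH; exact: kf.
Qed.

Lemma Ck_cst k (a : R) : Ck k (fun _ : V => a : R).
Proof.
elim: k a => [a x|k IH a]; first exact: cvg_cst.
split=> [x|v]; first exact: differentiable_cst.
have -> : 'D_v (fun _ : V => a) = (fun=> 0) :> (V -> R).
  by apply/funext => x; rewrite derive_cst.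
exact: IH.
Qed.

Lemma CkD k f g : Ck k f -> Ck k g -> Ck k (f \+ g).
Proof.
elim: k f g => [f g cf cg x|k IH f g [df kf] [dg kg]].
  by apply: cvgD; [exact: cf|exact: cg].
split=> [x|v]; first exact: differentiableD.
have -> : 'D_v (f \+ g) = 'D_v f \+ 'D_v g.
  by apply/funext => x; rewrite deriveD//; exact: diff_derivable.
by apply: IH; [exact: kf|exact: kg].
Qed.

Lemma CkM k f g : Ck k f -> Ck k g -> Ck k (f \* g).
Proof.
elim: k f g => [f g cf cg x|k IH f g Cf Cg].
  by apply: cvgM; [exact: cf|exact: cg].
have [[df kf] [dg kg]] := (Cf, Cg).
split=> [x|v]; first exact: differentiableM.
have -> : 'D_v (f \* g) = (f \* 'D_v g) \+ (g \* 'D_v f).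
  by apply/funext => x; rewrite deriveM//; exact: diff_derivable.
by apply: CkD; apply: IH => //; do ?exact: CkS; [exact: kg|exact: kf].
Qed.

(** Since ['D_v l] is a constant, ['D_v (f \o l)] is a constant times ['D_1 f \o l], again a
    function of the same form, and the induction closes without a chain rule of higher order. *)
Lemma Ck_comp_affine k (f : R -> R) (l : V -> R) (c : V -> R) :
  (forall x, differentiable l x) -> (forall v x, 'D_v l x = c v) ->
  Ck k f -> Ck k (f \o l).
Proof.
move=> dl cl; elim: k f => [f cf x|k IH f [df kf]].
  apply: continuous_comp; last exact: cf.
  exact: differentiable_continuous.
split=> [x|v]; first exact: differentiable_comp.
have -> : 'D_v (f \o l) = (fun=> c v) \* ('D_1 f \o l).
  apply/funext => x.
  rewrite (deriveE _ (differentiable_comp (dl x) (df (l x)))).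
  rewrite (diff_comp (dl x) (df (l x))).
  change ('d f (l x) ('d l x v) = c v * 'D_1 f (l x)).
  rewrite -(deriveE v (dl x)) cl (deriveE _ (df (l x))).
  have {1}-> : c v = c v *: (1 : R) by exact: esym (mulr1 _).
  exact: linearZ.
apply: CkM; first exact: Ck_cst.
by apply: IH; exact: kf.
Qed.

Lemma smooth_cst (a : R) : smooth (fun _ : V => a : R).
Proof. by move=> k; exact: Ck_cst. Qed.

Lemma smoothD f g : smooth f -> smooth g -> smooth (f \+ g).
Proof. by move=> sf sg k; exact: CkD. Qed.

Lemma smoothM f g : smooth f -> smooth g -> smooth (f \* g).
Proof. by move=> sf sg k; exact: CkM. Qed.

Lemma smooth_prod (I : Type) (r : seq I) (F : I -> V -> R) :
  (forall i, smooth (F i)) -> smooth (fun x => \prod_(i <- r) F i x).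
Proof.
move=> sF; elim: r => [|i r IH].
  by under eq_fun do rewrite big_nil; exact: smooth_cst.
under eq_fun do rewrite big_cons.
exact: smoothM.
Qed.

Lemma smooth_comp_affine (f : R -> R) (l : V -> R) (c : V -> R) :
  (forall x, differentiable l x) -> (forall v x, 'D_v l x = c v) ->
  smooth f -> smooth (f \o l).
Proof. by move=> dl cl sf k; exact: Ck_comp_affine (sf k). Qed.

Lemma smooth_derive v f : smooth f -> smooth ('D_v f).
Proof. by move=> sf k; have [_] := sf k.+1; exact. Qed.

Lemma smooth_differentiable f x : smooth f -> differentiable f x.
Proof. by move=> sf; have [] := sf 1%N. Qed.

Lemma smooth_continuous f : smooth f -> continuous f.
Proof. by move=> /(_ 0%N). Qed.

End Ck_theory.

Section flat.
Context (R : realType).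
Implicit Types (p : {poly R}) (x : R).

(* This class of functions is stable under differentiation. *)
Definition flat p x : R := if 0 < x then p.[x^-1] * expR (- x^-1) else 0.

(** The bound [e^y >= y^(i+1) / (i+1)!] gives [y^i e^(-y) <= (i+1)! / y] for each monomial. The
    power spent beyond the degree yields the factor [1/y], which is [x] in [flat_le]. *)
Lemma horner_expR_le p y : 0 < y ->
  `|p.[y] * expR (- y)| <= (\sum_(i < size p) `|p`_i| * (i.+1)`!%:R) * y^-1.
Proof.
move=> y0; rewrite horner_coef mulr_suml mulr_suml.
apply: (le_trans (ler_norm_sum _ _ _)); apply: ler_sum => i _.
rewrite !normrM -!mulrA ler_wpM2l// (ger0_norm (expR_ge0 _)) ger0_norm; last first.
  by rewrite exprn_ge0// ltW.
have y00 := ltW y0.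
rewrite expRN ler_pdivrMr ?expR_gt0//.
apply: (@le_trans _ _ ((i.+1)`!%:R * y^-1 * (y ^+ i.+1 / (i.+1)`!%:R))); last first.
  rewrite ler_wpM2l ?mulr_ge0 ?invr_ge0// (le_trans _ (expR_ge1Dxn i y00))//.
  by rewrite lerDr.
have : (i.+1)`!%:R != 0 :> R by rewrite pnatr_eq0 -lt0n fact_gt0.
set M := _%:R => M0; rewrite le_eqVlt exprS; apply/orP; left; apply/eqP; field.
by rewrite ?M0 gt_eqF.
Qed.

Lemma flat_le p : exists2 C, 0 <= C & forall x, `|flat p x| <= C * `|x|.
Proof.
exists (\sum_(i < size p) `|p`_i| * (i.+1)`!%:R).
  by apply: sumr_ge0 => i _; rewrite mulr_ge0.
move=> x; rewrite /flat; case: ifPn => x0.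
  have xV0 : 0 < x^-1 by rewrite invr_gt0.
  by rewrite (gtr0_norm x0); have := horner_expR_le p xV0; rewrite invrK.
by rewrite normr0 mulr_ge0//; apply: sumr_ge0 => i _; rewrite mulr_ge0.
Qed.

Lemma is_derive_flat p x :
  is_derive x 1 (flat p) (flat ('X^2 * (p - p^`())) x).
Proof.
have [x0|x0|x0] := ltgtP 0 x.
- have nx : \forall y \near x, 0 < y by exact: lt_nbhsr.
  have ex : {near x, (fun y => p.[y^-1] * expR (- y^-1)) =1 flat p}.
    by apply: filterS nx => y y0; rewrite /flat y0.
  apply: (@near_eq_is_derive R R^o R^o (fun y => p.[y^-1] * expR (- y^-1))) => //.
  have xN0 : x != 0 by rewrite gt_eqF.
  have dV : is_derive x 1 (fun y : R => y^-1) (- x ^- 2).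
    have := is_deriveV (f := id : R -> R) xN0 (is_derive_id x 1).
    by rewrite /GRing.scale /= mulr1.
  have dp : is_derive x 1 (fun y : R => p.[y^-1]) (- x ^- 2 * p^`().[x^-1]).
    by rewrite mulrC; apply: (is_derive1_comp (f := horner p) (g := fun y => y^-1)).
  have dE : is_derive x 1 (fun y : R => expR (- y^-1)) (x ^- 2 * expR (- x^-1)).
    have dN : is_derive x 1 (fun y : R => - y^-1) (x ^- 2).
      have := is_deriveN dV; rewrite opprK; exact.
    by rewrite mulrC; apply: (is_derive1_comp (f := expR) (g := fun y => - y^-1)).
  rewrite /flat x0; apply: (is_derive_eq (is_deriveM dp dE)).
  rewrite !hornerE /GRing.scale /=; field.
  exact: xN0.
- have nx : \forall y \near x, y < 0 by exact: lt_nbhsl.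
  have -> : flat ('X^2 * (p - p^`())) x = 0 by rewrite /flat ltNge (ltW x0).
  apply: (@near_eq_is_derive R R^o R^o (fun=> 0)) => //.
  by apply: filterS nx => y y0; rewrite /flat ltNge (ltW y0).
- have -> : flat ('X^2 * (p - p^`())) x = 0 by rewrite /flat -x0 ltxx.
  rewrite -x0.
  (* The difference quotient of [flat p] at 0 is [flat ('X * p) h], of size at most [C |h|].
     Dividing by [C + 1] covers the case [C = 0]. *)
  have [C C0 hC] := flat_le ('X * p).
  have lim0 : h^-1 *: ((flat p \o shift 0) (h *: (1 : R)) - flat p 0)
      @[h --> 0^'] --> (0 : R).
    apply/cvgr0Pnorm_le => e e0.
    near=> h.
    have h0 : h != 0 by near: h; exact: nbhs_dnbhs_neq.
    have he : `|h| <= e / (C + 1).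
      near: h; apply: dnbhs0_le.
      by rewrite divr_gt0// ltr_wpDl.
    rewrite [X in `|X|](_ : _ = flat ('X * p) h); last first.
      rewrite /= /flat addr0 ltxx subr0 /GRing.scale /= mulr1.
      by case: ifPn => _; rewrite ?hornerM ?hornerX ?mulrA ?mulr0.
    rewrite (le_trans (hC h))// (@le_trans _ _ (C * (e / (C + 1))))//.
      by rewrite ler_wpM2l.
    rewrite mulrA ler_pdivrMr ?ltr_wpDl// [C * e]mulrC ler_wpM2l ?lerDl//.
    exact: ltW.
  by apply: DeriveDef; [exact: (cvgP _ lim0)|exact: cvg_lim].
Unshelve. all: by end_near. Qed.

Lemma smooth_flat p : smooth (flat p : R^o -> R).
Proof.
move=> k; elim: k p => [p x|k IH p].
  have [d _] := is_derive_flat p x.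
  by apply: differentiable_continuous; exact/derivable1_diffP.
have df x : differentiable (flat p : R^o -> R) x.
  by have [d _] := is_derive_flat p x; exact/derivable1_diffP.
split=> // v.
have -> : 'D_v (flat p) = (fun=> v) \* flat ('X^2 * (p - p^`())).
  apply/funext => x; have [_ d1] := is_derive_flat p x.
  rewrite /= -d1 (deriveE v (df x)) (deriveE _ (df x)).
  have {1}-> : v = v *: (1 : R) by exact: esym (mulr1 _).
  exact: linearZ.
by apply: CkM; [exact: Ck_cst|exact: IH].
Qed.

Lemma flat1_ge0 x : 0 <= flat 1 x.
Proof. by rewrite /flat; case: ifPn => // _; rewrite hornerE mul1r expR_ge0. Qed.

Lemma flat1_le1 x : flat 1 x <= 1.
Proof.
rewrite /flat; case: ifPn => // x0; rewrite hornerE mul1r expR_le1.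
by rewrite oppr_le0 invr_ge0 ltW.
Qed.

Lemma flat1_eq0 x : x <= 0 -> flat 1 x = 0.
Proof. by rewrite /flat leNgt; case: ifPn. Qed.

(** A smooth approximation of the Heaviside function with value 0 at 0; products of such limits are
    indicators of open intervals. *)
Lemma flat1_cvg x : flat 1 (n%:R * x) @[n --> \oo] --> ((0 < x)%R%:R : R).
Proof.
have [x0|x0] := ltP 0 x; last first.
  apply: cvg_near_cst; apply: nearW => n /=.
  by rewrite flat1_eq0// mulr_ge0_le0.
rewrite -(cvg_shiftS (fun n => flat 1 (n%:R * x))).
rewrite (_ : (fun n => _) = (fun n : nat => expR (- (x^-1 * n.+1%:R^-1)))).
  suff: expR (- (x^-1 * harmonic n)) @[n --> \oo] --> (expR (- (x^-1 * 0)) : R).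
    by rewrite mulr0 oppr0 expR0.
  apply: continuous_cvg; first exact: continuous_expR.
  by apply: cvgN; apply: cvgMr; exact: cvg_harmonic.
apply/funext => n; rewrite /flat mulr_gt0// hornerE mul1r.
by rewrite invfM mulrC.
Qed.
End flat.

(** * The fundamental lemma of the calculus of variations *)

Section ae_eq0.
Context d (X : measurableType d) (R : realType).
Variable m : {measure set X -> \bar R}.
Hypothesis m_fin : (m setT < +oo)%E.
Variables (G : set (set X)) (g : (set X)^nat).
Hypotheses (mG : measurable = <<s G >>) (GI : setI_closed G).
Hypotheses (Gg : forall i, G (g i)) (g_cover : \bigcup_k g k = setT).

Lemma integrable_cst (a : R) : m.-integrable setT (EFin \o (fun=> a)).
Proof.
apply/integrableP; split; first by apply/measurable_EFinP; exact: measurable_cst.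
by rewrite integral_cst//= lte_mul_pinfty// lee_fin.
Qed.

(** Uniqueness of measures does not apply to the signed density [h], so [|h| + 1] is added: the
    measures with the positive densities [h + |h| + 1] and [|h| + 1] are finite and agree on the
    pi-system, hence everywhere. Subtracting, [h] has zero integral over every measurable set. *)
Lemma ae_eq0_pi_system (h : X -> R) : m.-integrable setT (EFin \o h) ->
  (forall A, G A -> (\int[m]_(x in A) (h x)%:E = 0)%E) ->
  {ae m, forall x, h x = 0}.
Proof.
move=> ih h0.
have mh : measurable_fun setT h by apply/measurable_EFinP; exact: measurable_int ih.
have GM A : G A -> measurable A by rewrite mG; exact: sub_sigma_algebra.
pose c2 x := `|h x| + 1; pose c1 x := h x + c2 x.
have mc2 : measurable_fun setT c2 by apply: measurable_funD => //; exact: measurableT_comp.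
have mc1 : measurable_fun setT c1 by exact: measurable_funD.
have c2_gt0 x : 0 < c2 x by rewrite ltr_wpDl.
have c1_gt0 x : 0 < c1 x.
  by rewrite /c1 /c2 addrA ltr_wpDl// -lerBlDr sub0r lerNl -normrN ler_norm.
have ic2 : m.-integrable setT (EFin \o c2).
  rewrite (_ : _ \o _ = (fun x => `|(h x)%:E| + 1%:E)%E)//.
  by apply: integrableD => //; [exact: integrable_abse|exact: integrable_cst].
have ints A : measurable A -> (weighted_measure m mc1 c1_gt0 A =
    \int[m]_(x in A) (h x)%:E + weighted_measure m mc2 c2_gt0 A)%E.
  move=> mA; rewrite /weighted_measure -integralD//.
  - exact: (integrableS measurableT).
  - exact: (integrableS measurableT _ _ ic2).
have fin2 A : measurable A -> weighted_measure m mc2 c2_gt0 A \is a fin_num.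
  move=> mA; apply: integrable_fin_num => //.
  exact: (integrableS measurableT _ _ ic2).
have mu12 A : measurable A ->
    weighted_measure m mc1 c1_gt0 A = weighted_measure m mc2 c2_gt0 A.
  apply: (measure_unique G g) => //.
  - by move=> B GB; rewrite [LHS]ints ?h0 ?add0e//; exact: GM.
  - move=> k; have mgk := GM _ (Gg k).
    by rewrite [ltLHS]ints// h0// add0e ltey_eq fin2.
have : ae_eq m setT (EFin \o h) (cst 0%E).
  apply: integral_ae_eq => // A _ mA.
  rewrite integral0; have := ints _ mA; rewrite mu12//.
  have /fineK <- := fin2 _ mA.
  have : (\int[m]_(x in A) (h x)%:E)%E \is a fin_num.
    by apply: integrable_fin_num => //; exact: (integrableS measurableT).
  move=> /fineK <- /=; rewrite -EFinD => -[] /eqP.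
  by rewrite -subr_eq subrr => /eqP <-.
by apply: filterS => x /(_ I) /= [].
Qed.

(* Bounded test functions converging to the indicator of the trace of [A] on
   [Q] transfer orthogonality from test functions to the pi-system. *)
Lemma ae_eq0_tests (h : X -> R) (Q : set X) : m.-integrable setT (EFin \o h) ->
  measurable Q ->
  (forall A, G A -> exists2 phi : nat -> X -> R,
     (forall n, [/\ measurable_fun setT (phi n), forall x, `|phi n x| <= 1 &
       (\int[m]_x (h x * phi n x))%R = 0]) &
     {ae m, forall x, phi n x @[n --> \oo] --> (\1_(A `&` Q) x : R)}) ->
  {ae m, forall x, Q x -> h x = 0}.
Proof.
move=> ih mQ tests.
have mh : measurable_fun setT h by apply/measurable_EFinP; exact: measurable_int ih.
have GM A : G A -> measurable A by rewrite mG; exact: sub_sigma_algebra.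
have hQ : m.-integrable setT (EFin \o (fun x => h x * \1_Q x)).
  apply: (le_integrable measurableT _ _ ih) => //.
    apply/measurable_EFinP; apply: measurable_funM => //.
  move=> x _ /=; rewrite lee_fin normrM ler_piMr// indicE.
  by case: (_ \in _); rewrite ?normr1 ?normr0.
suff : {ae m, forall x, h x * \1_Q x = 0}.
  by apply: filterS => x + Qx; rewrite indicE mem_set// mulr1.
apply: ae_eq0_pi_system => // A GA; have [phi phiP phi_cvg] := tests A GA.
have mA := GM _ GA.
have mphi n : measurable_fun setT (phi n) by have [] := phiP n.
have -> : (\int[m]_(x in A) (h x * \1_Q x)%:E =
    \int[m]_x (h x * \1_(A `&` Q) x)%:E)%E.
  rewrite integral_mkcond; apply: eq_integral => x _.
  rewrite patchE; case: ifPn => xA; rewrite !indicE in_setI.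
    by rewrite xA.
  by rewrite (negbTE xA) mulr0.
have m1 n : measurable_fun setT (fun x => (h x * phi n x)%:E).
  by apply/measurable_EFinP; exact: measurable_funM.
have m2 : measurable_fun setT (fun x => (h x * \1_(A `&` Q) x)%:E).
  apply/measurable_EFinP; apply: measurable_funM => //.
  by apply: measurable_indic; exact: measurableI.
have bd : {ae m, forall x n, setT x -> (`|(h x * phi n x)%:E| <= `|(h x)%:E|)%E}.
  apply: aeW => x n _ /=; rewrite lee_fin normrM ler_piMr//.
  by have [_ ->] := phiP n.
have cv : {ae m, forall x, setT x ->
    (h x * phi n x)%:E @[n --> \oo] --> (h x * \1_(A `&` Q) x)%:E}.
  apply: filterS phi_cvg => x hx _; apply: cvg_EFin; first exact: nearW.
  by apply: cvgM => //; exact: cvg_cst.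
have [_ _ lim] := dominated_convergence measurableT m1 m2 cv (integrable_abse ih) bd.
apply: (cvg_unique _ lim) => //.
apply: cvg_near_cst; apply: nearW => n /=.
have [_ le1 int0] := phiP n.
rewrite -(fineK (integrable_fin_num measurableT _)); first by congr EFin.
apply: (le_integrable measurableT _ _ ih) => //.
by move=> x _ /=; rewrite lee_fin normrM ler_piMr.
Qed.

End ae_eq0.

Section plateau.
Context (R : realType).

(** The function vanishes outside the closed interval for every [k] and converges to the indicator
    of the open one: an approximation from inside, with supports in a fixed compact set. *)
Definition plateau (a b : R) (k : nat) (x : R) : R :=
  flat 1 (k%:R * (x - a)) * flat 1 (k%:R * (b - x)).

Lemma plateau_ge0 a b k x : 0 <= plateau a b k x.
Proof. by rewrite mulr_ge0 ?flat1_ge0. Qed.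

Lemma plateau_le1 a b k x : plateau a b k x <= 1.
Proof. by rewrite mulr_ile1 ?flat1_ge0 ?flat1_le1. Qed.

Lemma plateau_eq0 a b k x : ~~ (a <= x <= b) -> plateau a b k x = 0.
Proof.
rewrite negb_and -!ltNge => /orP[xa|bx]; rewrite /plateau.
  by rewrite flat1_eq0 ?mul0r// mulr_ge0_le0// subr_le0 ltW.
by rewrite [X in _ * X]flat1_eq0 ?mulr0// mulr_ge0_le0// subr_le0 ltW.
Qed.

Lemma plateau_cvg a b x : plateau a b k x @[k --> \oo] --> ((a < x < b)%R%:R : R).
Proof.
rewrite -mulnb natrM -[in (a < x)%R]subr_gt0 -[in (x < b)%R]subr_gt0.
by apply: cvgM; exact: flat1_cvg.
Qed.

(** The inner map [l] is the identity for the time variable and a coordinate for the domain. *)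
Lemma smooth_plateau_comp (V : normedModType R) (l : V -> R) (c : V -> R) a b k :
  (forall x, differentiable l x) -> (forall v x, 'D_v l x = c v) ->
  smooth (fun x => plateau a b k (l x)).
Proof.
move=> dl cl; apply: smoothM.
- apply: (smooth_comp_affine (l := fun x => k%:R * (l x - a))
    (c := fun v => k%:R * c v)); last exact: smooth_flat.
  + move=> x; apply: (@differentiableZ _ _ _ (fun x => l x - a)).
    by apply: differentiableB => //; exact: differentiable_cst.
  + move=> v x; rewrite (@deriveZ _ _ _ (fun x => l x - a)).
      rewrite deriveB//; last exact: diff_derivable.
      by rewrite cl derive_cst subr0.
    by apply: derivableB => //; exact: diff_derivable.
- apply: (smooth_comp_affine (l := fun x => k%:R * (b - l x))
    (c := fun v => - (k%:R * c v))); last exact: smooth_flat.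
  + move=> x; apply: (@differentiableZ _ _ _ (fun x => b - l x)).
    by apply: differentiableB => //; exact: differentiable_cst.
  + move=> v x; rewrite (@deriveZ _ _ _ (fun x => b - l x)).
      rewrite deriveB//; last exact: diff_derivable.
      by rewrite cl derive_cst sub0r /GRing.scale /= mulrN.
    by apply: derivableB => //; exact: diff_derivable.
Qed.

End plateau.

Lemma ae_mono d (X : measurableType d) (R : realType)
    (m : {measure set X -> \bar R}) (P Q : X -> Prop) :
  (forall x, P x -> Q x) -> {ae m, forall x, P x} -> {ae m, forall x, Q x}.
Proof. by move=> PQ; apply: filterS. Qed.

Lemma ae_mono2 d (X : measurableType d) (R : realType)
    (m : {measure set X -> \bar R}) (P P' Q : X -> Prop) :
  (forall x, P x -> P' x -> Q x) -> {ae m, forall x, P x} ->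
  {ae m, forall x, P' x} -> {ae m, forall x, Q x}.
Proof. by move=> PQ; apply: filterS2. Qed.

(** * The time interval *)

Section time_tests.
Context (R : realType) (T : R).

Lemma lebesgue_time_finite : (lebesgue_time T setT < +oo)%E.
Proof.
rewrite /= /mrestr setTI lebesgue_measure_itv /=.
by case: ifPn => _; rewrite ?ltry// -EFinB ltry.
Qed.

Lemma ae_lebesgue_time : {ae lebesgue_time T, forall t, `]0, T[%classic t}.
Proof.
exists (~` `]0, T[%classic); split => //.
- by apply: measurableC; exact: measurable_itv.
- by rewrite /= /mrestr setICl measure0.
Qed.

Lemma ae_time_neq (b : R) : {ae lebesgue_time T, forall t, t != b}.
Proof.
exists [set b]; split.
- exact: (measurable_set1 b).
- apply/eqP; rewrite -measure_le0 /= /mrestr -[leRHS](lebesgue_measure_set1 b).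
  by apply: measureIl; [exact: (measurable_set1 b)|exact: measurable_itv].
- by move=> t /= /negP; rewrite negbK => /eqP.
Qed.

Lemma test_fun_plateau (a b q1 q2 : R) k : 0 < q1 -> q2 < T ->
  test_fun `]0, T[%classic (plateau (Num.max a q1) (Num.min b q2) k : R -> R).
Proof.
move=> q10 q2T; split.
  apply: (@smooth_plateau_comp R R^o id id) => // v x; exact: derive_id.
exists `[Num.max a q1, Num.min b q2]%classic; first exact: segment_compact.
split=> [x /=|x /negP]; last by rewrite in_itv /=; exact: plateau_eq0.
rewrite !in_itv /= ge_max le_min => /andP[/andP[_ qx] /andP[_ xq]].
by rewrite (lt_le_trans q10)//= (le_lt_trans xq).
Qed.

Lemma ae_eq0_time (h : R -> R) :
  (lebesgue_time T).-integrable setT (EFin \o h) ->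
  (forall phi, test_fun `]0, T[%classic phi ->
    (\int[lebesgue_time T]_x (h x * phi x))%R = 0) ->
  {ae lebesgue_time T, forall x, h x = 0}.
Proof.
move=> ih h0.
have aeQ q1 q2 : 0 < q1 -> q2 < T ->
    {ae lebesgue_time T, forall x, `]q1, q2]%classic x -> h x = 0}.
  move=> q10 q2T.
  apply: (@ae_eq0_tests _ (measurableTypeR R) _ (lebesgue_time T)
    lebesgue_time_finite (@ocitv R) (fun k => `](- k%:R), k%:R]%classic)) => //.
  - exact: ocitvI.
  - by move=> k; exists (- k%:R, k%:R).
  - apply/seteqP; split => // x _.
    exists (Num.trunc `|x|).+1 => //=; rewrite in_itv /=.
    have := truncnS_gt `|x|; rewrite ltr_norml => /andP[-> /ltW ->].
    by [].
  move=> _ [[a b] _ <-]; rewrite [(a, b).1]/= [(a, b).2]/=.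
  exists (plateau (Num.max a q1) (Num.min b q2)).
    move=> k; have tf := @test_fun_plateau a b q1 q2 k q10 q2T; split.
    - by apply: continuous_measurable_fun; apply: smooth_continuous; case: tf.
    - by move=> x; rewrite ger0_norm ?plateau_ge0 ?plateau_le1.
    - exact: h0.
  (* The plateaus converge to the indicator of the open interval, whereas the generating intervals
     are half-open: the two differ at the right endpoint only. *)
  apply: ae_mono (ae_time_neq (Num.min b q2)) => x xb.
  have := @plateau_cvg R (Num.max a q1) (Num.min b q2) x.
  congr (_ --> _); rewrite indicE; congr (_%:R : R); congr nat_of_bool.
  rewrite in_setI !mem_setE !in_itv /= gt_max.
  rewrite [x < Num.min b q2]lt_neqAle xb /= le_min; case: (a < x); case: (q1 < x); case: (x <= b);
    by case: (x <= q2).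
have : {ae lebesgue_time T, forall x, forall k : nat,
    `]k.+1%:R^-1, T - k.+1%:R^-1]%classic x -> h x = 0}.
  by apply: ae_foralln => k; apply: aeQ; rewrite ?invr_gt0// gtrBl invr_gt0.
apply: ae_mono2 ae_lebesgue_time => x /=; rewrite in_itv /= => /andP[x0 xT] hx.
pose e := Num.min x (T - x).
have e0 : 0 < e by rewrite lt_min x0 subr_gt0.
(* [Num.trunc e^-1] is an index [k] with [1/(k+1) < e]; the same choice recurs below. *)
apply: (hx (Num.trunc e^-1)); rewrite /= in_itv /=.
have : (Num.trunc e^-1).+1%:R^-1 < e.
  by rewrite -[ltRHS]invrK ltf_pV2 ?posrE ?invr_gt0//; exact: truncnS_gt.
by rewrite lt_min => /andP[-> /ltW h1] /=; rewrite lerBrDr addrC -lerBrDr.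
Qed.
End time_tests.

(** * Boxes, and the fundamental lemma on the domain *)

Section boxes.
Context (R : realType) (n : nat).
Implicit Types a b : 'rV[R]_n.

Definition obox a b : set 'rV[R]_n :=
  [set x | forall i, a ord0 i < x ord0 i < b ord0 i].

Definition cbox a b : set 'rV[R]_n :=
  [set x | forall i, a ord0 i <= x ord0 i <= b ord0 i].

Lemma oboxI a b a' b' : obox a b `&` obox a' b' =
  obox (\row_i Num.max (a ord0 i) (a' ord0 i)) (\row_i Num.min (b ord0 i) (b' ord0 i)).
Proof.
apply/seteqP; split=> [x [h h'] i|x h].
  rewrite !mxE gt_max lt_min.
  by have /andP[-> ->] := h i; have /andP[-> ->] := h' i.
split=> i; have := h i; rewrite !mxE gt_max lt_min.
  by move=> /andP[/andP[-> _] /andP[-> _]].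
by move=> /andP[/andP[_ ->] /andP[_ ->]].
Qed.

Lemma obox_sub_cbox a b : obox a b `<=` cbox a b.
Proof. by move=> x h i; have /andP[/ltW -> /ltW ->] := h i. Qed.

Lemma compact_cbox a b : compact (cbox a b).
Proof.
have := @rV_compact R n (fun i => `[a ord0 i, b ord0 i]%classic)
  (fun i => @segment_compact R _ _).
congr compact; by apply/seteqP; split=> x h i; exact: h.
Qed.

Lemma open_obox a b : open (obox a b).
Proof.
rewrite openE => x hx; apply: (@filter_forall _ _
  (fun i (y : 'rV[R]_n) => is_true (a ord0 i < y ord0 i < b ord0 i)) (nbhs x)) => i.
have : nbhs (x ord0 i) `]a ord0 i, b ord0 i[%classic.
  by apply: open_nbhs_nbhs; split; [exact: interval_open|exact: hx].
exact: coord_continuous.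
Qed.

Definition rat_box (q : n.-tuple rat * nat) : 'rV[R]_n * 'rV[R]_n :=
  (\row_i (ratr (tnth q.1 i) - q.2.+1%:R^-1),
   \row_i (ratr (tnth q.1 i) + q.2.+1%:R^-1)).

(** The open box has to contain [x], in order to cover [U], while the closed one has to lie in [U],
    because it carries the supports of the test functions. *)
Lemma rat_box_nbhs (U : set 'rV[R]_n) x : open U -> U x ->
  exists q, obox (rat_box q).1 (rat_box q).2 x /\
    cbox (rat_box q).1 (rat_box q).2 `<=` U.
Proof.
move=> oU Ux.
have : nbhs x U by exact: open_nbhs_nbhs.
rewrite -nbhs_ballE => -[e /= e0 eU].
have e20 : 0 < e / 2 by rewrite divr_gt0.
pose k := Num.trunc (e / 2)^-1.
have k0 : 0 < k.+1%:R^-1 :> R by rewrite invr_gt0.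
have ke : k.+1%:R^-1 < e / 2.
  rewrite -[ltRHS]invrK ltf_pV2 ?posrE ?invr_gt0//.
  exact: truncnS_gt.
have hq i : exists q : rat, `|ratr q - x ord0 i| < k.+1%:R^-1.
  have lt0 : x ord0 i < x ord0 i + k.+1%:R^-1 by rewrite ltrDl.
  have [q] := rat_in_itvoo lt0.
  rewrite in_itv /= => /andP[q1 q2]; exists q.
  by rewrite gtr0_norm ?subr_gt0// ltrBlDl.
pose q := [tuple projT1 (cid (hq i)) | i < n].
exists (q, k); split=> [i|y hy].
  rewrite !mxE tnth_mktuple; case: cid => /= r; rewrite ltr_distlC.
  by [].
apply: eU; split => // i j.
have -> : i = ord0 by exact: ord1.
have := hy j; rewrite !mxE tnth_mktuple; case: cid => /= r.
rewrite /ball /= !ltr_norml => /andP[h1 h2] /andP[h3 h4].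
move: ke h1 h2 h3 h4; move: (k.+1%:R^-1) (ratr r) (x ord0 j) (y ord0 j).
by move=> D Q X Y *; apply/andP; split; lra.
Qed.

Lemma open_bigcup_rat_box (U : set 'rV[R]_n) : open U ->
  U = \bigcup_q (if `[< cbox (rat_box q).1 (rat_box q).2 `<=` U >]
                 then obox (rat_box q).1 (rat_box q).2 else set0).
Proof.
move=> oU; apply/seteqP; split=> [x Ux|x [q _]].
  have [q [xq qU]] := rat_box_nbhs oU Ux.
  by exists q => //; case: asboolP.
by case: asboolP => // qU /obox_sub_cbox/qU.
Qed.

Definition oboxes : set (set (borel 'rV[R]_n)) :=
  [set A | exists a b, A = obox a b].

Lemma oboxes_setI : setI_closed oboxes.
Proof. by move=> _ _ [a [b ->]] [a' [b' ->]]; rewrite oboxI; do 2 eexists. Qed.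

End boxes.
Arguments rat_box {R n}.

Section borel_boxes.
Context (R : realType) (n : nat).

(** Open sets are countable unions of rational boxes. [G] is left free because two pi-systems are
    used: all open boxes, suited to the plateaus, and the finite intersections of rational boxes,
    which are countably many. *)
Lemma borel_rat_box (G : set (set (borel 'rV[R]_n))) :
  G `<=` measurable -> (forall q, G (obox (@rat_box R n q).1 (@rat_box R n q).2)) ->
  @measurable _ (borel 'rV[R]_n) = <<s G >>.
Proof.
move=> Gm Gq; apply/seteqP; split; last first.
  by apply: smallest_sub => //; exact: smallest_sigma_algebra.
apply: smallest_sub; first exact: smallest_sigma_algebra.
move=> U oU; rewrite (open_bigcup_rat_box oU).
have [s0 _ sU] : sigma_algebra setT <<s G >> := smallest_sigma_algebra _ _.
pose F k := if unpickle k is Some q then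
   (if `[< cbox (@rat_box R n q).1 (@rat_box R n q).2 `<=` U >]
               then obox (@rat_box R n q).1 (rat_box q).2 else set0) else set0.
rewrite (_ : \bigcup_q _ = \bigcup_k F k); last first.
  apply/seteqP; split=> x [].
    by move=> q _ xq; exists (pickle q) => //; rewrite /F pickleK.
  by move=> k _; rewrite /F; case: unpickle => // q xq; exists q.
apply: sU => k; rewrite /F; case: unpickle => [q|]; last exact: s0.
case: asboolP => _; last exact: s0.
by apply: sub_gen_smallest; exact: Gq.
Qed.

Lemma measurable_oboxes : @measurable _ (borel 'rV[R]_n) = <<s @oboxes R n >>.
Proof.
apply: borel_rat_box => [_ [a [b ->]]|q]; last by do 2 eexists.
by apply: sub_gen_smallest; exact: open_obox.
Qed.

Lemma oboxes_cover : \bigcup_k (obox (const_mx (- k%:R)) (const_mx k%:R)) = [set: 'rV[R]_n].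
Proof.
apply/seteqP; split=> // x _; exists (Num.trunc `|x|).+1 => // i.
rewrite !mxE -ltr_norml (le_lt_trans _ (truncnS_gt _))//.
rewrite [leRHS]/Num.Def.normr /= mx_normrE.
exact: (le_bigmax _ (fun ij : 'I_1 * 'I_n => `|x ij.1 ij.2|) (ord0, i)).
Qed.

End borel_boxes.

Lemma continuous_borel_measurable (R : realType) (X : normedModType R) (f : X -> R) :
  continuous f -> measurable_fun setT (f : borel X -> R).
Proof.
move=> /continuousP cf.
apply: (measurability _ (RGenOpens.measurableE R)) => _ [_ [a [b ->] <-]].
by rewrite setTI; apply: sub_sigma_algebra; apply: cf; exact: interval_open.
Qed.

(** The iterated product comes with sigma-finiteness only. Finiteness on cubes, by induction on the
    dimension, makes the measure of a bounded domain finite. *)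
Lemma lebesgue_tuple_cube (R : realType) n (M : R) :
  measurable [set t : n.-tuple (measurableTypeR R) | forall i, `|tnth t i| <= M] /\
  (lebesgue_tuple R n [set t | forall i, (`|tnth t i| <= M)%R] < +oo)%E.
Proof.
have mC k : measurable [set t : k.-tuple (measurableTypeR R) | forall i, `|tnth t i| <= M].
  rewrite (_ : [set t | _] = \bigcap_(i in [set: 'I_k])
     ((fun t : k.-tuple (measurableTypeR R) => tnth t i) @^-1` `[- M, M]%classic)).
    apply: fin_bigcap_measurable => // i _; rewrite -[X in measurable X]setTI.
    by apply: measurable_tnth => //; exact: measurable_itv.
  apply/seteqP; split=> t h i => [_|]; first by rewrite /= in_itv /= -ler_norml; exact: h.
  by have := h i I; rewrite /= in_itv /= -ler_norml.
split=> //; elim: n => [|k IH].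
  rewrite /= diracE; case: (_ \in _); by rewrite ltry.
rewrite /= /lebesgue_cons /pushforward.
rewrite (_ : _ @^-1` _ = `[- M, M]%classic `*`
    [set t : k.-tuple (measurableTypeR R) | forall i, `|tnth t i| <= M]); last first.
  apply/seteqP; split=> [[x t] h|[x t] [/= xM h] i].
    split=> [|i] /=.
      by have := h ord0; rewrite tnth0 /= in_itv /= ler_norml.
    by have := h (lift ord0 i); rewrite tnthS.
  case: (unliftP ord0 i) => [j ->|->]; first by rewrite tnthS.
  by rewrite tnth0 ler_norml; rewrite in_itv in xM.
have mI : measurable (`[- M, M]%classic : set (measurableTypeR R)) by exact: measurable_itv.
rewrite (product_measure1E _ _ mI (mC k)).
have lI : (@lebesgue_measure R `[(- M)%R, M]%classic < +oo)%E.
  rewrite lebesgue_measure_itv /=; case: ifPn => // _.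
  by rewrite -EFinB ltry.
by apply: lte_mul_pinfty => //; rewrite ge0_fin_numE ?lI.
Qed.

Lemma measurable_cbox (R : realType) n (a b : 'rV[R]_n) :
  measurable (cbox a b : set (borel 'rV[R]_n)).
Proof.
rewrite -[cbox a b]setCK; apply: measurableC; apply: sub_sigma_algebra.
by apply: closed_openC; apply: compact_closed; [exact: norm_hausdorff|exact: compact_cbox].
Qed.

Lemma lebesgue_on_finite (R : realType) n (Omega : set 'rV[R]_n.+1)
  (hO : bounded_lipschitz_domain Omega) : (lebesgue_on hO setT < +oo)%E.
Proof.
have [_ _ _ [M [_ bM]] _] := hO.
pose C : set (borel 'rV[R]_n.+1) := cbox (const_mx (- (`|M| + 1))) (const_mx (`|M| + 1)).
have [mC Coo] := @lebesgue_tuple_cube R n.+1 (`|M| + 1).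
apply: (@le_lt_trans _ _ (lebesgue_rV R n.+1 C)).
  rewrite /= /mrestr setTI; apply: le_measure; rewrite ?inE.
  - exact: domain_measurable.
  - exact: measurable_cbox.
  move=> x Ox i; rewrite !mxE -ler_norml.
  have := bM (`|M| + 1); rewrite ltr_pwDr// => [|]; last exact: ler_norm.
  move=> /(_ isT x Ox); apply: le_trans.
  rewrite [leRHS]/Num.Def.normr /= mx_normrE.
  exact: (le_bigmax _ (fun ij : 'I_1 * 'I_n.+1 => `|x ij.1 ij.2|) (ord0, i)).
apply: le_lt_trans Coo; rewrite /lebesgue_rV /pushforward.
rewrite le_eqVlt; apply/orP; left; apply/eqP; congr (lebesgue_tuple _ _ _).
by apply/seteqP; split=> t h i; have := h i; rewrite !mxE -ler_norml.
Qed.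

Section domain_tests.
Context (R : realType) (n : nat) (Omega : set 'rV[R]_n.+1).
Context (hO : bounded_lipschitz_domain Omega).

Definition box_plateau (a b : 'rV[R]_n.+1) k (x : 'rV[R]_n.+1) : R :=
  \prod_i plateau (a ord0 i) (b ord0 i) k (x ord0 i).

Lemma box_plateau_ge0 a b k x : 0 <= box_plateau a b k x.
Proof. by apply: prodr_ge0 => i _; exact: plateau_ge0. Qed.

Lemma box_plateau_le1 a b k x : box_plateau a b k x <= 1.
Proof. by apply: prodr_ile1 => i _; rewrite plateau_ge0 plateau_le1. Qed.

Lemma box_plateau_cvg a b x :
  box_plateau a b k x @[k --> \oo] --> (\1_(obox a b) x : R).
Proof.
have -> : \1_(obox a b) x = \prod_(i < n.+1) ((a ord0 i < x ord0 i < b ord0 i)%R%:R : R).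
  rewrite indicE; case: (boolP (x \in obox a b)) => xab.
    rewrite big1// => i _; rewrite inE in xab; by rewrite xab.
  have [i hi] : exists i, ~~ (a ord0 i < x ord0 i < b ord0 i).
    apply: contrapT => /forallNP h; move: xab; rewrite notin_setE; apply => i.
    by apply: contrapT => /negP; exact: h.
  by rewrite (bigD1 i)//= (negbTE hi) mul0r.
rewrite /box_plateau; elim: (index_enum _) => [|i r IH].
  by rewrite big_nil; under eq_cvg do rewrite big_nil; exact: cvg_cst.
rewrite big_cons; under eq_cvg do rewrite big_cons.
by apply: cvgM => //; exact: plateau_cvg.
Qed.

Lemma smooth_box_plateau a b k : smooth (box_plateau a b k).
Proof.
apply: smooth_prod => i.
apply: (@smooth_plateau_comp R _ (fun x : 'rV[R]_n.+1 => x ord0 i) (fun v => v ord0 i)).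
  by move=> x; exact: differentiable_coord.
move=> v x; rewrite /derive; apply: cvg_lim => //; apply: cvg_near_cst.
near=> h; rewrite /= !mxE addrK /GRing.scale /= mulKf//.
by near: h; exact: nbhs_dnbhs_neq.
Unshelve. all: by end_near. Qed.

Lemma test_fun_box_plateau (a b a' b' : 'rV[R]_n.+1) k : cbox a' b' `<=` Omega ->
  test_fun Omega (box_plateau (\row_i Num.max (a ord0 i) (a' ord0 i))
    (\row_i Num.min (b ord0 i) (b' ord0 i)) k).
Proof.
move=> sub; split; first exact: smooth_box_plateau.
exists (cbox (\row_i Num.max (a ord0 i) (a' ord0 i)) (\row_i Num.min (b ord0 i) (b' ord0 i))).
  exact: compact_cbox.
split=> [x h|x /existsNP[i hi]].
  apply: sub => i; have := h i; rewrite !mxE ge_max le_min.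
  by move=> /andP[/andP[_ ->] /andP[_ ->]].
by rewrite /box_plateau (bigD1 i)//= plateau_eq0 ?mul0r//; exact/negP.
Qed.

Lemma ae_lebesgue_on : {ae lebesgue_on hO, forall x, Omega x}.
Proof.
exists (~` Omega); split => //; first by apply: measurableC; exact: domain_measurable.
by rewrite /= /mrestr setICl measure0.
Qed.

(** Countably many rational boxes, with closed versions inside [Omega], cover it, so their
    exceptional sets may be united. Indicators of open boxes are exactly the limits of the plateaus;
    no boundary has to be discarded. *)
Lemma ae_eq0_domain (h : 'rV[R]_n.+1 -> R) :
  (lebesgue_on hO).-integrable setT (EFin \o h) ->
  (forall phi, test_fun Omega phi ->
    (\int[lebesgue_on hO]_x (h x * phi x))%R = 0) ->
  {ae lebesgue_on hO, forall x, h x = 0}.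
Proof.
move=> ih h0; have [oO _ _ _ _] := hO.
have GX k : @oboxes R n.+1 (obox (const_mx (- k%:R)) (const_mx k%:R)) by do 2 eexists.
have aeQ (q : n.+1.-tuple rat * nat) : {ae lebesgue_on hO, forall x,
    cbox (rat_box q).1 (rat_box q).2 `<=` Omega ->
    obox (rat_box q).1 (rat_box q).2 x -> h x = 0}.
  have [sub|nsub] := pselect (cbox (@rat_box R _ q).1 (@rat_box R _ q).2 `<=` Omega);
    last by apply: aeW.
  suff : {ae lebesgue_on hO, forall x, obox (rat_box q).1 (rat_box q).2 x -> h x = 0}.
    by apply: ae_mono.
  apply: (@ae_eq0_tests _ (borel 'rV[R]_n.+1) _ (lebesgue_on hO)
    (lebesgue_on_finite hO) _ _ (@measurable_oboxes R n.+1) (@oboxes_setI R n.+1)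
    GX (@oboxes_cover R n.+1)) => //.
    by apply: sub_sigma_algebra; exact: open_obox.
  move=> _ [a [b ->]].
  exists (box_plateau (\row_i Num.max (a ord0 i) ((rat_box q).1 ord0 i))
    (\row_i Num.min (b ord0 i) ((rat_box q).2 ord0 i))).
    move=> k; have tf := @test_fun_box_plateau a b _ _ k sub; split.
    - by apply: continuous_borel_measurable; apply: smooth_continuous; case: tf.
    - by move=> x; rewrite ger0_norm ?box_plateau_ge0 ?box_plateau_le1.
    - exact: h0.
  by apply: aeW => x; rewrite oboxI; exact: box_plateau_cvg.
have : {ae lebesgue_on hO, forall x, forall k : nat,
    if unpickle k is Some q then
      cbox (@rat_box R n.+1 q).1 (@rat_box R n.+1 q).2 `<=` Omega ->
      obox (@rat_box R n.+1 q).1 (@rat_box R n.+1 q).2 x -> h x = 0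
    else True}.
  by apply: ae_foralln => k; case: unpickle => [q|]; [exact: aeQ|exact: aeW].
apply: ae_mono2 ae_lebesgue_on => x Ox hx.
have [q [xq qO]] := rat_box_nbhs oO Ox.
by have := hx (pickle q); rewrite pickleK; apply.
Qed.

End domain_tests.

(** * Measurable selection *)

Section analytic_sets.
Context d (S : measurableType d) (R : realType) (X : normedModType R).
Implicit Types (E : set (S * X)) (s : nat -> nat).

Definition prefix_determined (T : Type) (P : nat -> (nat -> nat) -> T) :=
  forall n s s', (forall j, (j < n)%N -> s j = s' j) -> P n s = P n s'.

(* A Suslin scheme of rectangles, whose level n only depends on the first n
   coordinates of the branch. *)
Record scheme := Scheme {
  sch_base : nat -> (nat -> nat) -> set S;
  sch_fibre : nat -> (nat -> nat) -> set X;
  sch_baseP : prefix_determined sch_base;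
  sch_fibreP : prefix_determined sch_fibre;
  sch_measurable : forall n s, measurable (sch_base n s);
  sch_closed : forall n s, closed (sch_fibre n s) }.

(** The result of the Suslin operation; the two components of [p] are coupled only through the
    common branch. *)
Definition scheme_set (Q : scheme) : set (S * X) :=
  [set p | exists s, forall n, sch_base Q n s p.1 /\ sch_fibre Q n s p.2].

Definition analytic E := exists Q, E = scheme_set Q.

Lemma analytic_rectangle (A : set S) (C : set X) :
  measurable A -> closed C -> analytic (A `*` C).
Proof.
move=> mA cC.
exists (@Scheme (fun _ _ => A) (fun _ _ => C) (fun _ _ _ _ => erefl)
  (fun _ _ _ _ => erefl) (fun _ _ => mA) (fun _ _ => cC)).
by apply/seteqP; split=> [p [pA pC]|p [s /(_ 0%N)]] //; exists (fun=> 0%N).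
Qed.

Definition shift_seq s : nat -> nat := fun n => s n.+1.
Definition cons_seq i s : nat -> nat := fun n => if n is n'.+1 then s n' else i.

(** Coordinate 0 of a branch selects the index [i], and the shifted branch runs through the scheme
    of [E_ i]. Level 0 imposes nothing, as no coordinate is known there yet. *)
Lemma analytic_bigcup (E_ : nat -> set (S * X)) :
  (forall i, analytic (E_ i)) -> analytic (\bigcup_i E_ i).
Proof.
move=> /choice[Q EQ].
have dA : prefix_determined (fun n s => if n is n'.+1 then sch_base (Q (s 0%N)) n' (shift_seq s) else setT).
  move=> [//|n] s s' ss'; rewrite (ss' 0%N)//; apply: sch_baseP => j jn.
  exact: ss'.
have dC : prefix_determined (fun n s => if n is n'.+1 then sch_fibre (Q (s 0%N)) n' (shift_seq s) else setT).
  move=> [//|n] s s' ss'; rewrite (ss' 0%N)//; apply: sch_fibreP => j jn.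
  exact: ss'.
unshelve eexists (Scheme dA dC _ _).
- by move=> [|n] s //; exact: sch_measurable.
- by move=> [|n] s /=; [exact: closedT|exact: sch_closed].
apply/seteqP; split=> [p [i _]|p [s h]].
  rewrite EQ => -[s h]; exists (cons_seq i s) => -[|n]//=.
exists (s 0%N) => //; rewrite EQ; exists (shift_seq s) => n.
exact: (h n.+1).
Qed.

Definition row_seq s (i : nat) : nat -> nat := fun j => s (pickle (i, j)).

Let before (i n N : nat) := forall j, (j < n)%N -> (pickle (i, j) < N)%N.

Let before_ex i n : exists N, before i n N.
Proof.
exists (\max_(j < n) (pickle (i, nat_of_ord j))).+1 => j jn; rewrite ltnS.
exact: (leq_bigmax (Ordinal jn)).
Qed.

(** One sequence codes a branch for every [i] through [pickle (i, j)]. Level [N] imposes the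
    conditions whose coordinates all occur among the first [N] of the code, which keeps the scheme
    prefix-determined. *)
Lemma analytic_bigcap (E_ : nat -> set (S * X)) :
  (forall i, analytic (E_ i)) -> analytic (\bigcap_i E_ i).
Proof.
move=> /choice[Q EQ].
have dA : prefix_determined (fun N s => \bigcap_i \bigcap_n
    if `[< before i n N >] then sch_base (Q i) n (row_seq s i) else setT).
  move=> N s s' ss'; apply: eq_bigcapr => i _; apply: eq_bigcapr => n _.
  by case: asboolP => // b; apply: sch_baseP => j jn; apply: ss'; exact: b.
have dC : prefix_determined (fun N s => \bigcap_i \bigcap_n
    if `[< before i n N >] then sch_fibre (Q i) n (row_seq s i) else setT).
  move=> N s s' ss'; apply: eq_bigcapr => i _; apply: eq_bigcapr => n _.
  by case: asboolP => // b; apply: sch_fibreP => j jn; apply: ss'; exact: b.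
unshelve eexists (Scheme dA dC _ _).
- move=> N s; apply: bigcapT_measurable => i; apply: bigcapT_measurable => n.
  by case: asboolP => // _; exact: sch_measurable.
- move=> N s; apply: closed_bigI => i _; apply: closed_bigI => n _.
  by case: asboolP => // _; exact: sch_closed.
apply/seteqP; split=> [p h|p [s h] i _].
  have /choice[s hs] : forall i, exists s, forall n,
      sch_base (Q i) n s p.1 /\ sch_fibre (Q i) n s p.2.
    by move=> i; have := h i I; rewrite EQ.
  pose t k := if unpickle k is Some (i, j) then s i j else 0%N.
  have tE i : row_seq t i = s i by apply/funext => j; rewrite /row_seq /t pickleK.
  exists t => N; split=> i _ n _; rewrite /= tE; case: asboolP => // _.
    by have [] := hs i n.
  by have [] := hs i n.
rewrite EQ; exists (row_seq s i) => n; have [N bN] := before_ex i n.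
have [hA hC] := h N; split.
  by have := hA i I n I; rewrite /=; case: asboolP.
by have := hC i I n I; rewrite /=; case: asboolP.
Qed.

Lemma open_bigcup_closed (U : set X) : open U ->
  exists2 F : nat -> set X, forall n, closed (F n) & U = \bigcup_n F n.
Proof.
move=> oU; exists (fun n => ~` \bigcup_(y in ~` U) ball y n.+1%:R^-1).
  by move=> n; apply: open_closedC; apply: bigcup_open => y _; exact: ball_open.
apply/seteqP; split=> x; last first.
  move=> [n _] nx; apply: contrapT => Ux; apply: nx; exists x => //.
  by apply: ballxx; rewrite invr_gt0.
move=> Ux; have : nbhs x U by exact: open_nbhs_nbhs.
rewrite -nbhs_ballE => -[e /= e0 eU].
exists (Num.trunc e^-1) => // -[y nUy yx]; apply: nUy; apply: eU.
apply: ball_sym; apply: le_ball yx.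
rewrite ltW// -[ltRHS]invrK ltf_pV2 ?posrE ?invr_gt0//; exact: truncnS_gt.
Qed.

Lemma measurable_analytic (E : set (S * borel X)%type) :
  measurable E -> analytic (E : set (S * X)).
Proof.
(* Analytic sets are not stable under complement; those with an analytic complement form a
   sigma-algebra that contains the generating cylinders. *)
pose B := [set E : set (S * borel X)%type |
  analytic (E : set (S * X)) /\ analytic (~` E : set (S * X))].
have rectT (A : set S) : measurable A -> analytic (A `*` setT).
  by move=> mA; exact: analytic_rectangle mA closedT.
suff : measurable `<=` B by move=> h /h [].
have B0 : B set0.
  split; first by rewrite -(set0X setT); exact: rectT.
  by rewrite setC0 -setXTT; exact: rectT.
have BC F : B F -> B (~` F) by move=> [h1 h2]; split => //; rewrite setCK.
have BU (F : nat -> set (S * borel X)%type) : (forall n, B (F n)) -> B (\bigcup_n F n).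
  move=> BF; split; first by apply: analytic_bigcup => i; have [] := BF i.
  by rewrite setC_bigcup; apply: analytic_bigcap => i; have [] := BF i.
have sB : sigma_algebra setT B.
  by split => // F BF; rewrite setTD; exact: BC.
apply: smallest_sub => // _ [[A mA <-]|[C mC <-]]; rewrite setTI.
  rewrite (_ : fst @^-1` A = A `*` setT); last first.
    by apply/seteqP; split=> [p //|p []].
  split; first exact: rectT.
  rewrite (_ : ~` (A `*` setT) = (~` A) `*` setT); first exact/rectT/measurableC.
  by apply/seteqP; split=> [p /= nA|p [/= nA _] []//]; split => // pA; exact: nA.
suff : measurable `<=` [set C : set (borel X) | B (snd @^-1` C)] by apply.
apply: smallest_sub.
  split=> [|F /= BF|F /= BF].
  - by rewrite /= preimage_set0.
  - by rewrite setTD preimage_setC; exact: BC.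
  - by rewrite preimage_bigcup; exact: BU.
have sndT (F : set X) : closed F -> analytic (snd @^-1` F : set (S * X)).
  move=> cF; rewrite (_ : _ @^-1` _ = setT `*` F); first exact: analytic_rectangle.
  by apply/seteqP; split=> [p //|p []].
move=> U oU; split.
  have [F cF ->] := open_bigcup_closed oU.
  by rewrite preimage_bigcup; apply: analytic_bigcup => i; exact: sndT.
by rewrite preimage_setC; apply: sndT; exact: open_closedC.
Qed.

End analytic_sets.

(** * Outer measure *)

Section small.
Context d (S : measurableType d) (R : realType).
Context (mu : {finite_measure set S -> \bar R}).

Definition outer_le (al : R) (B : set S) :=
  exists M, [/\ measurable M, B `<=` M & (mu M <= al%:E)%E].

(** The covers [M k] need not increase. Their tail intersections [C k] do, and still cover [B k],
    because [B k] is contained in every later [B j]. *)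
Lemma outer_le_bigcup al (B : nat -> set S) :
  (forall i j, (i <= j)%N -> B i `<=` B j) ->
  (forall k, outer_le al (B k)) -> outer_le al (\bigcup_k B k).
Proof.
move=> ndB /choice[M MP].
have mM k : measurable (M k) by have [] := MP k.
pose C k := \bigcap_(j in [set j | (k <= j)%N]) M j.
have mC k : measurable (C k) by apply: bigcap_measurable => [|j _]; [exists k => /=|exact: mM].
exists (\bigcup_k C k); split.
- exact: bigcup_measurable.
- by move=> x [k _ Bx]; exists k => // j /= kj; have [_ + _] := MP j; apply; exact: ndB Bx.
have ndC : {homo C : n m / (n <= m)%N >-> (n <= m)%O}.
  move=> n m nm; apply/subsetPset => x Cx j /= mj; apply: Cx => /=.
  exact: leq_trans mj.
have cvC := nondecreasing_cvg_mu (mu := mu) mC (bigcup_measurable (fun k _ => mC k)) ndC.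
rewrite -(cvg_lim _ cvC)//; apply: lime_le; first by apply/cvg_ex; eexists; exact: cvC.
apply: nearW => k /=; have [_ _] := MP k; apply: le_trans.
by apply: le_measure; rewrite ?inE//; apply: bigcap_inf => /=.
Qed.

Lemma negligible_outer_le (B : set S) :
  (forall al, 0 < al -> outer_le al B) -> mu.-negligible B.
Proof.
move=> h.
have /choice[M MP] : forall k : nat, exists M,
    [/\ measurable M, B `<=` M & (mu M <= k.+1%:R^-1%:E)%E].
  by move=> k; apply: h; rewrite invr_gt0.
have mM k : measurable (M k) by have [] := MP k.
exists (\bigcap_k M k); split.
- exact: bigcapT_measurable.
- apply/eqP; rewrite -measure_le0; apply/lee_addgt0Pr => e e0; rewrite add0e.
  have [_ _ le1] := MP (Num.trunc e^-1).
  apply: (@le_trans _ _ (mu (M (Num.trunc e^-1)))).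
    apply: le_measure; rewrite ?inE//; first exact: bigcapT_measurable.
    exact: bigcap_inf.
  apply: (le_trans le1); rewrite lee_fin ltW// -[ltRHS]invrK.
  by rewrite ltf_pV2 ?posrE ?invr_gt0//; exact: truncnS_gt.
- by move=> x Bx k _; have [_ + _] := MP k; apply.
Qed.

End small.

(** * The tree of bounded branches and its leftmost branch *)

Section selection.
Context d (S : measurableType d) (R : realType) (X : innerSpaceType R).
Context (mu : {finite_measure set S -> \bar R}).
Variables (Q : scheme S X) (c : nat -> nat -> X).
Hypothesis fibre_near : forall n s j y, (j < n)%N -> sch_fibre Q n s y ->
  `|y - c j (s j)| <= j.+1%:R^-1.
Hypothesis X_complete : forall x_ : nat -> X,
  (forall e : R, 0 < e -> exists N, forall n m, (N <= n)%N -> (N <= m)%N ->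
     `|x_ n - x_ m| <= e) -> exists l : X, x_ n @[n --> \oo] --> l.

Let A := sch_base Q.
Let C := sch_fibre Q.

Definition bounded_by (b : seq nat) (s : nat -> nat) :=
  forall j, (j < size b)%N -> (s j <= nth 0 b j)%N.

Definition bounded_proj (b : seq nat) : set S :=
  [set r | exists s y, bounded_by b s /\ forall n, A n s r /\ C n s y].

Lemma bounded_by_rcons b v s :
  bounded_by (rcons b v) s <-> bounded_by b s /\ (s (size b) <= v)%N.
Proof.
rewrite /bounded_by size_rcons; split=> [h|[h hv] j].
  split=> [j jb|]; last by have := h (size b) (ltnSn _); rewrite nth_rcons ltnn eqxx.
  by have := h j (ltnW jb); rewrite nth_rcons jb.
rewrite ltnS leq_eqVlt => /orP[/eqP ->|jb]; rewrite nth_rcons ?ltnn ?eqxx//.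
by rewrite jb; exact: h.
Qed.

Lemma bounded_proj_bigcup b :
  bounded_proj b = \bigcup_v bounded_proj (rcons b v).
Proof.
apply/seteqP; split=> [r [s [y [bs h]]]|r [v _ [s [y [/bounded_by_rcons[bs _] h]]]]].
  by exists (s (size b)) => //; exists s, y; split=> //; exact/bounded_by_rcons.
by exists s, y.
Qed.

(** An outer measure larger than [al] passes from an increasing union to one of its members. The
    same [al] therefore serves for all coordinates, with no errors to be summed. *)
Lemma bounded_proj_step al b : ~ outer_le mu al (bounded_proj b) ->
  exists v, ~ outer_le mu al (bounded_proj (rcons b v)).
Proof.
move=> nb; apply/existsNP => h; apply: nb; rewrite bounded_proj_bigcup.
apply: outer_le_bigcup => // i j ij r [s [y [/bounded_by_rcons[bs si] hs]]].
exists s, y; split=> //; apply/bounded_by_rcons; split=> //.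
exact: leq_trans ij.
Qed.

Lemma bounding_sequence al : ~ outer_le mu al (fst @` scheme_set Q) ->
  exists b : nat -> nat, forall k, ~ outer_le mu al (bounded_proj (mkseq b k)).
Proof.
move=> n0.
have /choice[nxt nxtP] : forall b : seq nat, exists v : nat,
    ~ outer_le mu al (bounded_proj b) -> ~ outer_le mu al (bounded_proj (rcons b v)).
  move=> b; have [h|h] := pselect (outer_le mu al (bounded_proj b)).
    by exists 0%N.
  by have [v hv] := bounded_proj_step h; exists v.
pose st k := iter k (fun b => rcons b (nxt b)) [::].
exists (fun k => nxt (st k)) => k.
have -> : mkseq (fun k => nxt (st k)) k = st k.
  by elim: k => // k IH; rewrite mkseqS IH.
elim: k => [|k IH]; last exact: nxtP.
apply: contra_not n0; rewrite (_ : bounded_proj _ = fst @` scheme_set Q)//.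
apply/seteqP; split=> [r [s [y [_ h]]]|_ [[r y] [s h] <-]].
  by exists (r, y) => //; exists s.
by exists s, y.
Qed.

Definition level n (s : nat -> nat) : set S := [set r |
  (forall k, (k <= n)%N -> A k s r) /\ exists y, forall k, (k <= n)%N -> C k s y].

Lemma level_prefix n s s' : (forall j, (j < n)%N -> s j = s' j) ->
  level n s = level n s'.
Proof.
move=> ss'; rewrite /level.
have EA k : (k <= n)%N -> A k s = A k s'.
  by move=> kn; apply: sch_baseP => j jk; apply: ss'; exact: leq_trans kn.
have EC k : (k <= n)%N -> C k s = C k s'.
  by move=> kn; apply: sch_fibreP => j jk; apply: ss'; exact: leq_trans kn.
apply/seteqP; split=> r [hA [y hy]]; split.
- by move=> k kn; rewrite -EA//; exact: hA.
- by exists y => k kn; rewrite -EC//; exact: hy.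
- by move=> k kn; rewrite EA//; exact: hA.
- by exists y => k kn; rewrite EC//; exact: hy.
Qed.

Lemma level_mkseq n m s : (n <= m)%N -> level n s = level n (nth 0%N (mkseq s m)).
Proof.
by move=> nm; apply: level_prefix => j jn; rewrite nth_mkseq//; exact: leq_trans nm.
Qed.

Lemma level_le n m s : (n <= m)%N -> level m s `<=` level n s.
Proof.
move=> nm r [hA [y hy]]; split=> [k kn|]; first exact/hA/(leq_trans kn).
by exists y => k kn; exact/hy/(leq_trans kn).
Qed.

(** With rectangles, the existence of a common fibre point does not involve [r]: the level is empty
    or an intersection of base sets. *)
Lemma measurable_level n s : measurable (level n s).
Proof.
have [hy|hy] := pselect (exists y, forall k, (k <= n)%N -> C k s y).
  rewrite (_ : level n s = \bigcap_(k in [set k | (k <= n)%N]) A k s).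
    by apply: bigcap_measurable => [|k _]; [exists 0%N|exact: sch_measurable].
  by apply/seteqP; split=> r => [[h _] k kn|h]; [exact: h|split=> // k kn; exact: h].
by rewrite (_ : level n s = set0)//; apply/seteqP; split=> // r [].
Qed.

Variable b : nat -> nat.

Definition reach n (t : seq nat) : set S := [set r | exists s,
  [/\ forall j, (s j <= b j)%N, forall j, (j < size t)%N -> s j = nth 0%N t j & level n s r]].

(** The union over uncountably many [s] becomes a countable one over finite sequences, since
    [level n] sees only a prefix. *)
Lemma measurable_reach n t : measurable (reach n t).
Proof.
(* Beyond its end a sequence is read as 0, which respects every bound [b j]. *)
pose ok (t' : seq nat) := (forall j, (nth 0 t' j <= b j)%N) /\
  forall j, (j < size t)%N -> nth 0%N t' j = nth 0%N t j.
rewrite (_ : reach n t = \bigcup_(t' in [set: seq nat])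
    (if `[< ok t' >] then level n (nth 0%N t') else set0)).
  apply: countable_bigcupT_measurable => // t'.
  by case: asboolP => // _; exact: measurable_level.
apply/seteqP; split=> [r [s [sb st sr]]|r [t' _]].
  exists (mkseq s (maxn n (size t))) => //; case: asboolP => [_|[]].
    by rewrite -level_mkseq// leq_maxl.
  split=> j; last first.
    by move=> jt; rewrite nth_mkseq ?st//; apply: (leq_trans jt); exact: leq_maxr.
  have [jm|jm] := ltnP j (maxn n (size t)); first by rewrite nth_mkseq.
  by rewrite nth_default// size_mkseq.
case: asboolP => // -[tb tt'] tr.
by exists (nth 0%N t').
Qed.

(** Extension through each finite level, instead of along one infinite branch: a countable
    intersection of measurable sets. Finite branching recovers the infinite branch. *)
Definition extendable (t : seq nat) : set S := [set r | forall n, reach n t r].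

Lemma extendableE t : extendable t = \bigcap_n reach n t.
Proof. by apply/seteqP; split=> r h n => [_|]; exact: h. Qed.

Lemma measurable_extendable t : measurable (extendable t).
Proof. by rewrite extendableE; apply: bigcapT_measurable => n; exact: measurable_reach. Qed.

(** Koenig's argument: the next coordinate has at most [b (size t) + 1] values. If each value [v]
    failed at some level [N v], the largest of these levels could not be reached from [t]. *)
Lemma extendable_rcons t r : extendable t r ->
  exists v, extendable (rcons t v) r.
Proof.
move=> h; apply: contrapT => /forallNP nv.
have /choice[N hN] : forall v, exists n, forall s, (forall j, (s j <= b j)%N) ->
    (forall j, (j < size (rcons t v))%N -> s j = nth 0%N (rcons t v) j) -> ~ level n s r.
  move=> v; have /existsNP[n /forallNP hn] := nv v.
  by exists n => s sb st sr; apply: (hn s).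
have [s [sb st sr]] := h (\max_(v < (b (size t)).+1) N v)%N.
have vb : (s (size t) < (b (size t)).+1)%N by rewrite ltnS.
apply: (hN (s (size t)) s sb) => [j|].
  rewrite size_rcons ltnS leq_eqVlt nth_rcons => /orP[/eqP ->|jt].
    by rewrite ltnn eqxx.
  by rewrite jt st.
by apply: level_le sr; exact: (leq_bigmax (Ordinal vb)).
Qed.

Definition least_ext (t : seq nat) (v : nat) : set S :=
  extendable (rcons t v) `&` \bigcap_(v' in [set v' | (v' < v)%N]) ~` extendable (rcons t v').

Lemma measurable_least_ext t v : measurable (least_ext t v).
Proof.
apply: measurableI; first exact: measurable_extendable.
have [->|v0] := posnP v; first by rewrite (_ : \bigcap_(_ in _) _ = setT)//; apply/seteqP; split.
apply: bigcap_measurable => [|v' _]; first by exists 0%N.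
by apply: measurableC; exact: measurable_extendable.
Qed.

Lemma least_ext_inj t v v' r : least_ext t v r -> least_ext t v' r -> v = v'.
Proof.
move=> [e m] [e' m']; apply/eqP; rewrite eqn_leq; apply/andP; split.
  by rewrite leqNgt; apply/negP => h; exact: (m v').
by rewrite leqNgt; apply/negP => h; exact: (m' v).
Qed.

Lemma ex_least_ext t r : extendable t r -> exists v, least_ext t v r.
Proof.
move=> /extendable_rcons ex.
have exb : exists v, `[< extendable (rcons t v) r >] by have [v hv] := ex; exists v; exact/asboolP.
have [v /asboolP hv vmin] := ex_minnP exb; exists v; split => // v' /= v'v e'.
by have := vmin v'; rewrite leqNgt v'v => /(_ (asboolT e')).
Qed.

Definition leftmost (t : seq nat) : set S :=
  extendable [::] `&` \bigcap_(k in [set k | (k < size t)%N]) least_ext (take k t) (nth 0%N t k).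

Lemma measurable_leftmost t : measurable (leftmost t).
Proof.
apply: measurableI; first exact: measurable_extendable.
have [->|t0] := posnP (size t).
  by rewrite (_ : \bigcap_(_ in _) _ = setT)//; apply/seteqP; split.
by apply: bigcap_measurable => [|v' _]; [exists 0%N|exact: measurable_least_ext].
Qed.

Lemma leftmost_extendable t r : leftmost t r -> extendable t r.
Proof.
case/lastP: t => [[] //|t v [_]] /(_ (size t)).
rewrite /= size_rcons ltnSn nth_rcons ltnn eqxx -cats1 take_size_cat// cats1.
by move=> /(_ isT) [].
Qed.

Lemma leftmost_rcons t v r : leftmost t r -> least_ext t v r -> leftmost (rcons t v) r.
Proof.
move=> [e h] l; split=> // k /=; rewrite size_rcons ltnS leq_eqVlt => /orP[/eqP ->|kt].
  by rewrite nth_rcons ltnn eqxx -cats1 take_size_cat.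
by rewrite nth_rcons kt -cats1 takel_cat ?(ltnW kt)//; exact: h.
Qed.

Lemma leftmost_branch r : extendable [::] r ->
  exists s, forall n, leftmost (mkseq s n) r.
Proof.
move=> er.
have /choice[nxt nxtP] : forall t : seq nat, exists v : nat,
    leftmost t r -> leftmost (rcons t v) r.
  move=> t; have [lt|] := pselect (leftmost t r); last by exists 0%N.
  have [v hv] := ex_least_ext (leftmost_extendable lt).
  by exists v => _; exact: leftmost_rcons.
pose st k := iter k (fun t => rcons t (nxt t)) [::].
exists (fun k => nxt (st k)) => n.
have -> : mkseq (fun k => nxt (st k)) n = st n.
  by elim: n => // k IH; rewrite mkseqS IH.
elim: n => [|k IH]; last exact: nxtP.
by split=> // k.
Qed.

Lemma leftmost_inj t t' r : size t = size t' -> leftmost t r -> leftmost t' r -> t = t'.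
Proof.
move=> szt [_ h] [_ h'].
suff H k : (k <= size t)%N -> take k t = take k t'.
  by have := H _ (leqnn _); rewrite take_size szt take_size.
elim: k => [|k IH] kt; first by rewrite !take0.
rewrite (take_nth 0%N)// (take_nth 0%N) -?szt//.
have Ek := IH (ltnW kt); rewrite Ek; congr rcons.
have h'k := h' k; rewrite /= -szt in h'k.
by apply: least_ext_inj (h'k kt); rewrite -Ek; exact: h.
Qed.

Lemma leftmost_le t k r : leftmost t r -> (k < size t)%N -> (nth 0 t k <= b k)%N.
Proof.
move=> /leftmost_extendable /(_ 0%N) [s [sb st _]] kt.
by rewrite -st.
Qed.

(** A level only provides a point [y n] common to the first fibres. These points are close to the
    centres [c j (s j)], hence form a Cauchy sequence, and closedness puts the limit into every
    fibre. The centres converge to it too and will be its simple approximations. *)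
Lemma extendable_branch r s : (forall n, leftmost (mkseq s n) r) ->
  exists y, (forall n, A n s r /\ C n s y) /\ c n (s n) @[n --> \oo] --> y.
Proof.
move=> hs.
have lev n : level n s r.
  have [s' [_ ss' ls']] := leftmost_extendable (hs n) n.
  rewrite (level_prefix (s' := s'))// => j jn.
  by rewrite ss' ?size_mkseq// nth_mkseq.
have /choice[y hy] : forall n, exists y, forall k, (k <= n)%N -> C k s y.
  by move=> n; have [_] := lev n.
have yc j n : (j < n)%N -> `|y n - c j (s j)| <= j.+1%:R^-1.
  by move=> jn; apply: (fibre_near jn); exact: hy (leqnn n).
have cV (e : R) : 0 < e -> exists N, forall j, (N <= j)%N -> j.+1%:R^-1 <= e.
  move=> e0; exists (Num.trunc e^-1) => j Nj.
  rewrite -[leRHS]invrK lef_pV2 ?posrE ?invr_gt0//.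
  apply: (@le_trans _ _ (Num.trunc e^-1).+1%:R); first exact/ltW/truncnS_gt.
  by rewrite ler_nat ltnS.
have [l yl] : exists l : X, y n @[n --> \oo] --> l.
  apply: X_complete => e e0.
  have [N hN] := cV _ (divr_gt0 e0 (ltr0n _ 2)).
  exists N.+1 => n m Nn Nm; rewrite [e]splitr.
  rewrite -(subrKA (c N (s N))) (le_trans (ler_normD _ _))// lerD//.
    exact: le_trans (yc _ _ Nn) (hN _ (leqnn N)).
  by rewrite distrC; exact: le_trans (yc _ _ Nm) (hN _ (leqnn N)).
exists l; split=> [n|].
  split; first by have [+ _] := lev n; apply.
  have Cy : \forall k \near \oo, C n s (y k) by exists n => // k /= nk; exact: hy.
  have cC : closed (C n s) by exact: sch_closed.
  exact: (closed_cvg (C n s) cC Cy l yl).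
apply/cvgrPdist_le => e e0.
have [N hN] := cV e e0; exists N => // j /= Nj.
have : `|l - c j (s j)| <= j.+1%:R^-1.
  have cv : `|y n - c j (s j)| @[n --> \oo] --> `|l - c j (s j)|.
    by apply: cvg_norm; apply: cvgB => //; exact: cvg_cst.
  rewrite -(cvg_lim _ cv)//; apply: limr_le; first by apply/cvg_ex; eexists; exact: cv.
  by exists j.+1 => // n /= jn; exact: yc.
by move/le_trans; apply; exact: hN.
Qed.

(** Each [reach n [::]] is a measurable cover of [bounded_proj (mkseq b n)], so its measure exceeds
    [al]; since [mu] is finite, the bound passes to the decreasing intersection. *)
Lemma extendable_ge al : (forall k, ~ outer_le mu al (bounded_proj (mkseq b k))) ->
  (al%:E <= mu (extendable [::]))%E.
Proof.
move=> nb; rewrite extendableE.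
have mr n := measurable_reach n [::].
have ndr : {homo (fun n => reach n [::]) : n m / (n <= m)%N >-> (m <= n)%O}.
  move=> n m nm; apply/subsetPset => r [s [sb st sr]].
  by exists s; split=> //; exact: level_le sr.
have m0 : (mu (reach 0%N [::]) < +oo)%E by rewrite ltey_eq fin_num_measure.
have cv := nonincreasing_cvg_mu m0 mr (bigcapT_measurable mr) ndr.
rewrite -(cvg_lim _ cv)//; apply: lime_ge; first by apply/cvg_ex; eexists; exact: cv.
apply: nearW => n /=; rewrite leNgt; apply/negP => lt.
apply: (nb n); exists (reach n [::]); split=> //; last exact: ltW.
move=> r [s [y [bs h]]].
(* Only the first [n] coordinates of [s] are known to be bounded. Replacing the others by 0 bounds
   them all and leaves [level n] unchanged. *)
exists (nth 0%N (mkseq s n)); split=> //.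
  move=> j; have [jn|jn] := ltnP j n; last by rewrite nth_default// size_mkseq.
  by have := bs j; rewrite size_mkseq jn !nth_mkseq//; apply.
rewrite -level_mkseq//; split=> [k _|]; first by have [] := h k.
by exists y => k _; have [] := h k.
Qed.

Lemma extendable_selection : exists y : S -> X, strongly_measurable y /\
  forall r, extendable [::] r -> scheme_set Q (r, y r).
Proof.
have /choice[s hs] : forall r, exists s, extendable [::] r -> forall n, leftmost (mkseq s n) r.
  move=> r; have [er|] := pselect (extendable [::] r); last by exists (fun=> 0%N).
  by have [s h] := leftmost_branch er; exists s.
have /choice[y hy] : forall r, exists y,
    (extendable [::] r -> (forall n, A n (s r) r /\ C n (s r) y) /\
       c n (s r n) @[n --> \oo] --> y) /\ (~ extendable [::] r -> y = 0).
  move=> r; have [er|ner] := pselect (extendable [::] r); last by exists 0.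
  by have [y h] := extendable_branch (hs r er); exists y.
exists y; split; last first.
  by move=> r er; exists (s r) => n; have [/(_ er)[+ _] _] := hy r; apply.
exists (fun n r => if r \in extendable [::] then c n (s r n) else 0); split=> [n|r]; last first.
  have [er|ner] := pselect (extendable [::] r).
    by rewrite mem_set//; have [/(_ er)[]] := hy r.
  by rewrite memNset//; have [_ ->] := hy r => //; exact: cvg_cst.
have sE r t : size t = n.+1 -> leftmost t r -> s r n = nth 0%N t n.
  move=> tn lt; have er : extendable [::] r by case: lt.
  have -> : t = mkseq (s r) n.+1.
    by apply: leftmost_inj lt (hs r er n.+1); rewrite size_mkseq.
  by rewrite nth_mkseq.
split.
  (* The [n]-th coordinate is at most [b n], so there are finitely many values: this is the purpose
     of bounding the branches. *)
  apply: (@sub_finite_set _ _ ([set 0] `|` (c n @` `I_(b n).+1))).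
    move=> _ [r _ <-]; case: ifPn => [/set_mem er|_]; last by left.
    right; exists (s r n) => //=; rewrite ltnS.
    have := leftmost_le (hs r er n.+1) (k := n).
    by rewrite size_mkseq ltnS leqnn nth_mkseq// => /(_ isT).
  by rewrite finite_setU; split; [exact: finite_set1|exact/finite_image/finite_II].
move=> x.
rewrite (_ : _ @^-1` _ = (if x == 0 then ~` extendable [::] else set0) `|`
  \bigcup_(t in [set: seq nat]) (if (size t == n.+1) && (c n (nth 0%N t n) == x)
    then leftmost t else set0)).
  apply: measurableU.
    by case: ifP => // _; exact/measurableC/measurable_extendable.
  apply: countable_bigcupT_measurable => // t.
  by case: ifP => // _; exact: measurable_leftmost.
apply/seteqP; split=> r.
  rewrite /=; case: ifPn => [/set_mem er cx|]; last first.
    by rewrite notin_setE => ner <-; left; rewrite eqxx.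
  right; exists (mkseq (s r) n.+1) => //.
  by rewrite size_mkseq nth_mkseq// cx !eqxx /=; exact: hs.
move=> [|[t _]].
  by case: eqP => // -> ner; rewrite /= memNset.
case: ifP => // /andP[/eqP tn /eqP ct] lt.
have er : extendable [::] r by case: lt.
by rewrite /= mem_set// (sE _ _ tn lt).
Qed.

End selection.

Section measurable_selection.
Context d (S : measurableType d) (R : realType) (X : innerSpaceType R).
Context (mu : {finite_measure set S -> \bar R}).
Hypothesis X_complete : forall x_ : nat -> X,
  (forall e : R, 0 < e -> exists N, forall n m, (N <= n)%N -> (N <= m)%N ->
     `|x_ n - x_ m| <= e) -> exists l : X, x_ n @[n --> \oo] --> l.
Variable D : nat -> X.
Hypothesis D_dense : forall x e, 0 < e -> exists k, `|x - D k| <= e.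

(** A coordinate codes a coordinate of the given scheme and an index in the dense sequence. Numbers
    that code no pair are read as [(0, 0)], which only repeats branches. *)
Let decode (k : nat) : nat * nat := odflt (0, 0)%N (unpickle k).

(* Interleaving a ball of radius 1/(j+1) around a point of the dense sequence
   at the j-th coordinate makes the fibres shrink to a point. *)
Lemma measurable_selection (E : set (S * borel X)%type) : measurable E ->
  ~ mu.-negligible (fst @` E) ->
  exists (B : set S) (y : S -> X), [/\ measurable B, (0 < mu B)%E,
    strongly_measurable y & forall r, B r -> E (r, y r)].
Proof.
move=> /measurable_analytic[Q0 EQ0] nE.
pose C n s := sch_fibre Q0 n (fun j => (decode (s j)).1) `&`
  \bigcap_(j in [set j | (j < n)%N]) closed_ball (D (decode (s j)).2) j.+1%:R^-1.
have dA : prefix_determined (fun n s => sch_base Q0 n (fun j => (decode (s j)).1)).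
  by move=> n s s' ss'; apply: sch_baseP => j jn; rewrite ss'.
have dC : prefix_determined C.
  move=> n s s' ss'; congr (_ `&` _).
    by apply: sch_fibreP => j jn; rewrite ss'.
  by apply: eq_bigcapr => j jn; rewrite ss'.
have mA n s : measurable (sch_base Q0 n (fun j => (decode (s j)).1)).
  exact: sch_measurable.
have cC n s : closed (C n s).
  apply: closedI; first exact: sch_closed.
  by apply: closed_bigI => j _; exact: closed_ball_closed.
pose Q := Scheme dA dC mA cC.
have QE : scheme_set Q = E.
  rewrite [RHS]EQ0; apply/seteqP; split=> [p [s h]|p [s h]].
    by exists (fun j => (decode (s j)).1) => n; have [? []] := h n.
  have /choice[k hk] : forall j : nat, exists k, `|p.2 - D k| <= j.+1%:R^-1.
    by move=> j; apply: D_dense; rewrite invr_gt0.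
  exists (fun j => pickle (s j, k j)) => n.
  have dec1 : (fun j => (decode (pickle (s j, k j))).1) = s.
    by apply/funext => j; rewrite /decode pickleK.
  have [hA hC] := h n; change (sch_base Q0 n (fun j => (decode (pickle (s j, k j))).1) p.1 /\
    C n (fun j => pickle (s j, k j)) p.2).
  rewrite /C dec1; split=> //; split=> // j /= jn.
  by rewrite /decode pickleK /= closed_ballE ?invr_gt0//= /closed_ball_ /= distrC.
have Qnear n s j y : (j < n)%N -> sch_fibre Q n s y ->
    `|y - (fun _ k => D (decode k).2) j (s j)| <= j.+1%:R^-1.
  move=> jn [_ /(_ j jn)]; rewrite closed_ballE ?invr_gt0//= /closed_ball_ /=.
  by rewrite distrC.
(* A set of outer measure at most [al] for every positive [al] is negligible, so some threshold
   fails; it becomes the lower bound for the measure of [B]. *)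
have [al al0 nal] : exists2 al, 0 < al & ~ outer_le mu al (fst @` E).
  apply: contrapT => h; apply: nE; apply: negligible_outer_le => al al0.
  by apply: contrapT => hn; apply: h; exists al.
rewrite -QE in nal.
have [b hb] := bounding_sequence nal.
have [y [my hy]] := @extendable_selection _ S R X Q (fun _ k => D (decode k).2) Qnear X_complete b.
exists (extendable Q b [::]), y; split=> //.
- exact: measurable_extendable.
- by apply: lt_le_trans (extendable_ge hb); rewrite lte_fin.
- by move=> r /hy; rewrite QE.
Qed.

End measurable_selection.

(** * The spaces L^2 *)

Section L2_theory.
Context d (S : measurableType d) (R : realType).
Context (mu : {measure set S -> \bar R}) (X : innerSpaceType R).
Implicit Types f g : S -> X.

Lemma L2_exists f : square_integrable mu f ->
  exists F : L2 mu X, {ae mu, forall x, F x = f x}.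
Proof.
move=> sf; have f_in : f \in @sqint _ S R mu X by rewrite inE.
by exists (\pi_(L2 mu X) (MkL2fun f_in))%qT; exact: L2_repr.
Qed.

Lemma L2_square_integrable (F : L2 mu X) : square_integrable mu F.
Proof. split; [exact: L2fun_strongly_measurable|exact: L2fun_sqint]. Qed.

Lemma strongly_measurable_cst (x : X) : strongly_measurable (fun _ : S => x).
Proof.
by exists (fun _ _ => x); split=> [n|y]; [exact: simple_cst|exact: cvg_cst].
Qed.

Lemma square_integrable_le (Y : innerSpaceType R) (f : S -> X) (g : S -> Y) :
  strongly_measurable f -> square_integrable mu g ->
  (forall x, `|f x| <= `|g x|) -> square_integrable mu f.
Proof.
move=> mf [mg ig] fg; split=> //; apply: le_lt_trans ig.
apply: ge0_le_integral => //.
- exact: measurable_normsq.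
- exact: measurable_normsq.
- by move=> x _; rewrite lee_fin lerXn2r// nnegrE.
Qed.

Lemma square_integrable_cst (x : X) : (mu setT < +oo)%E ->
  square_integrable mu (fun=> x).
Proof.
move=> mu_fin; split; first exact: strongly_measurable_cst.
by rewrite integral_cst// lte_mul_pinfty// lee_fin sqr_ge0.
Qed.

Lemma measurable_inner f g : strongly_measurable f -> strongly_measurable g ->
  measurable_fun setT (fun x => inner (f x) (g x)).
Proof.
move=> mf mg; under eq_fun do rewrite inner_polar.
apply: measurable_funM => //; apply: measurable_funB; first apply: measurable_funB.
- apply: measurable_funX; apply: strongly_measurable_norm.
  have := strongly_measurableDZ 1 mf mg.
  by under eq_fun do rewrite scale1r.
- by apply: measurable_funX; exact: strongly_measurable_norm.
- by apply: measurable_funX; exact: strongly_measurable_norm.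
Qed.

Lemma integrable_normsq f : square_integrable mu f ->
  mu.-integrable setT (fun x => (`|f x| ^+ 2)%:E).
Proof.
move=> [mf If]; apply/integrableP; split; first exact: measurable_normsq.
by under eq_integral do rewrite gee0_abs ?lee_fin ?sqr_ge0//.
Qed.

Lemma integrable_inner f g : square_integrable mu f -> square_integrable mu g ->
  mu.-integrable setT (EFin \o (fun x => inner (f x) (g x))).
Proof.
move=> sf sg; have [[mf _] [mg _]] := (sf, sg).
apply: (le_integrable measurableT _ _
  (integrableD measurableT (integrable_normsq sf) (integrable_normsq sg))).
  by apply/measurable_EFinP; exact: measurable_inner.
move=> x _ /=; rewrite lee_fin (le_trans (norm_inner_le _ _))//.
by rewrite ger0_norm// addr_ge0 ?sqr_ge0.
Qed.

Lemma Rintegral_ae_eq (h k : S -> R) : mu.-integrable setT (EFin \o h) ->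
  mu.-integrable setT (EFin \o k) -> {ae mu, forall x, h x = k x} ->
  (\int[mu]_x h x)%R = (\int[mu]_x k x)%R.
Proof.
move=> ih ik hk; rewrite /Rintegral; congr fine.
apply: ae_eq_integral => //; [exact: measurable_int ih|exact: measurable_int ik|].
by apply: filterS hk => x + _ => /= ->.
Qed.

Lemma L2_norm_sq (F : L2 mu X) : ((`|F| ^+ 2)%:E = \int[mu]_x (`|F x| ^+ 2)%:E)%E.
Proof.
rewrite -inner_norm L2_innerE /Rintegral.
have E : (\int[mu]_x (inner (F x) (F x))%:E = \int[mu]_x (`|F x| ^+ 2)%:E)%E.
  by apply: eq_integral => x _; rewrite inner_norm.
rewrite E fineK//; apply: integrable_fin_num => //.
exact/integrable_normsq/L2_square_integrable.
Qed.

Lemma L2_oppE (F : L2 mu X) : {ae mu, forall x, (- F : L2 mu X) x = - F x}.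
Proof.
by rewrite -scaleN1r; apply: ae_mono (L2_scaleE (-1) F) => x ->; rewrite scaleN1r.
Qed.

Lemma L2_subE (F G : L2 mu X) : {ae mu, forall x, (F - G : L2 mu X) x = F x - G x}.
Proof.
by apply: ae_mono2 (L2_addE F (- G)) (L2_oppE G) => x -> ->.
Qed.

Lemma L2_norm_ae (F : L2 mu X) f : strongly_measurable f ->
  {ae mu, forall x, F x = f x} ->
  ((`|F| ^+ 2)%:E = \int[mu]_x (`|f x| ^+ 2)%:E)%E.
Proof.
move=> mf Ff; rewrite L2_norm_sq; apply: ae_eq_integral => //.
- exact/measurable_normsq/L2fun_strongly_measurable.
- exact: measurable_normsq.
- by apply: ae_mono Ff => x -> _.
Qed.

Lemma L2_inner_ae (F G : L2 mu X) f g : square_integrable mu f ->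
  square_integrable mu g -> {ae mu, forall x, F x = f x} ->
  {ae mu, forall x, G x = g x} -> inner F G = (\int[mu]_x inner (f x) (g x))%R.
Proof.
move=> sf sg Ff Gg; rewrite L2_innerE; apply: Rintegral_ae_eq.
- by apply: integrable_inner; exact: L2_square_integrable.
- exact: integrable_inner.
- by apply: ae_mono2 Ff Gg => x -> ->.
Qed.

End L2_theory.

Section strongly_measurable_real.
Import HBSimple.
Context d (S : measurableType d) (R : realType).

Lemma measurable_strongly_measurable (h : S -> R) : measurable_fun setT h ->
  strongly_measurable (h : S -> R^o).
Proof.
move=> mh.
have [g gh] := @approximation_sfun _ _ _ (EFin \o h) setT measurableT
   ((measurable_EFinP _ _).2 mh).
exists (fun n x => g n x); split=> [n|x].
  split; first exact: fimfunP.
  by move=> y; exact: measurable_sfunP.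
have := gh x I.
move/fine_cvg.
exact.
Qed.

Lemma strongly_measurable_measurable (h : S -> R^o) : strongly_measurable h ->
  measurable_fun setT (h : S -> R).
Proof.
move=> mh; have := measurable_inner mh (strongly_measurable_cst S (1 : R^o)).
by apply: eq_measurable_fun => x _ /=; rewrite /inner /= mulr1.
Qed.

End strongly_measurable_real.

(** * Completeness of real L^2 over a finite measure *)

Section complete.
Context d (S : measurableType d) (R : realType).
Context (mu : {measure set S -> \bar R}) (mu_fin : (mu setT < +oo)%E).
Local Notation H := (L2 mu R^o).

Lemma L2_integrable (F : H) : mu.-integrable setT (EFin \o (F : S -> R)).
Proof.
have := integrable_inner (L2_square_integrable F) (square_integrable_cst (1 : R^o) mu_fin).
by congr integrable; apply/funext => x /=; rewrite /inner /= mulr1.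
Qed.

(** The bounds add up to [C], so the series of the absolute increments has a finite integral and
    converges almost everywhere; the series of the increments then converges, and it telescopes to
    [f n]. *)
Lemma ae_cvg_summable (f : nat -> S -> R) (C : R) : 0 <= C ->
  (forall k, measurable_fun setT (f k)) ->
  (forall k, (\int[mu]_x `|f k.+1 x - f k x|%:E <= (C / (2 ^ k.+1)%:R)%:E)%E) ->
  {ae mu, forall x, cvgn (fun n => f n x)}.
Proof.
move=> C0 mf If.
pose h k x := (`|f k.+1 x - f k x|%:E)%E.
have mh k : measurable_fun setT (h k).
  by apply/measurable_EFinP; apply: measurableT_comp => //; exact: measurable_funB.
have h0 k x : (0 <= h k x)%E by rewrite lee_fin.
have ih : mu.-integrable setT (fun x => (\sum_(k <oo) h k x)%E).
  apply/integrableP; split.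
    by apply: ge0_emeasurable_sum => // k x _ _; exact: h0.
  under eq_integral do rewrite gee0_abs ?nneseries_ge0//.
  rewrite integral_nneseries//.
  apply: (@le_lt_trans _ _ (\sum_(k <oo) (0 + (C / (2 ^ k.+1)%:R)%:E))%E).
    apply: lee_nneseries => k _; last by rewrite add0e; exact: If.
    by move=> _; apply: integral_ge0.
  apply: (@le_lt_trans _ _ (\sum_(0 <= k <oo | xpredT k) 0 + C%:E)%E).
    exact: epsilon_trick.
  by rewrite eseries0// add0e ltry.
apply: ae_mono (integrable_ae measurableT ih) => x /(_ I) hx.
have cs : cvgn (series (fun k => f k.+1 x - f k x : R^o)).
  apply: normed_cvg; apply: nondecreasing_is_cvgn.
    apply/nondecreasing_seqP => n.
    change (\sum_(0 <= k < n) `|f k.+1 x - f k x| <=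
      \sum_(0 <= k < n.+1) `|f k.+1 x - f k x|).
    by rewrite big_nat_recr//= lerDl.
  exists (fine (\sum_(k <oo) h k x)%E) => _ [n _ <-] /=.
  rewrite -lee_fin fineK// /series /= -sumEFin.
  exact: nneseries_lim_ge.
rewrite (_ : (fun n => f n x) = (fun n => f 0%N x + series (fun k => f k.+1 x - f k x) n)).
  by apply: is_cvgD => //; exact: is_cvg_cst.
apply/funext => n; rewrite /series /= telescope_sumr//.
by rewrite addrC subrK.
Qed.

Lemma limn_einf_le (u : (\bar R)^nat) (c : \bar R) :
  (\forall n \near \oo, (u n <= c)%E) -> (limn_einf u <= c)%E.
Proof.
move=> [N _ hN]; rewrite limn_einf_lim; apply: lime_le; first exact: is_cvg_einfs.
apply: nearW => n; apply: (@le_trans _ _ (u (maxn n N))).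
  by apply: ereal_inf_lbound; exists (maxn n N) => //=; exact: leq_maxl.
by apply: hN => /=; exact: leq_maxr.
Qed.

(** Riesz-Fischer along a rapidly Cauchy sequence: increments summable in L^1 give a limit almost
    everywhere, and Fatou's lemma makes it a limit in L^2. *)
Lemma L2_complete_fast (F : nat -> H) :
  (forall k l, (k <= l)%N -> `|F l - F k| <= ((2 ^ k.+1)%:R)^-1) ->
  exists L : H, F n @[n --> \oo] --> L.
Proof.
move=> hF.
have mF k : measurable_fun setT (F k : S -> R).
  exact/strongly_measurable_measurable/L2fun_strongly_measurable.
have nF k l : (k <= l)%N ->
    (\int[mu]_x ((F l x - F k x) ^+ 2)%:E <= ((2 ^ k.+1)%:R^-1 ^+ 2)%:E)%E.
  move=> kl.
  have -> : (\int[mu]_x ((F l x - F k x) ^+ 2)%:E = (`|F l - F k| ^+ 2)%:E)%E.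
    rewrite (L2_norm_ae (f := fun x => F l x - F k x : R^o)).
    - by apply: eq_integral => x _; rewrite real_normK// num_real.
    - by apply: measurable_strongly_measurable; exact: measurable_funB.
    - exact: L2_subE.
  by rewrite lee_fin lerXn2r ?nnegrE ?invr_ge0// hF.
have m0 : 0 <= fine (mu setT) by rewrite fine_ge0.
have [N [mN N0 hN]] : {ae mu, forall x, cvgn (fun n => F n x : R)}.
  apply: (@ae_cvg_summable (fun n => F n : S -> R) (1 + fine (mu setT))); [by rewrite addr_ge0|exact: mF|].
  (* The inequality [|t| <= D t^2 + 1/D] with [D = 2^(k+1)] converts the L^2 bound [1/D^2]: the
     integral is at most [D / D^2 + mu(S) / D], whence the constant [1 + mu(S)]. *)
  move=> k; pose D : R := (2 ^ k.+1)%:R.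
  have D0 : 0 < D by rewrite ltr0n expn_gt0.
  apply: (@le_trans _ _ (\int[mu]_x (D * (F k.+1 x - F k x) ^+ 2 + D^-1)%:E)%E).
    apply: ge0_le_integral => //.
    - by apply/measurable_EFinP; apply: measurableT_comp => //; exact: measurable_funB.
    - apply/measurable_EFinP; apply: measurable_funD => //.
      apply: measurable_funM => //; apply: measurable_funX; exact: measurable_funB.
    - move=> x _; rewrite lee_fin.
      set t := F k.+1 x - F k x.
      have t2 : t ^+ 2 = `|t| ^+ 2 by rewrite real_normK// num_real.
      have := sqr_ge0 (D * `|t| - 2^-1); rewrite t2 => h.
      rewrite -(ler_pM2l D0) mulrDr divff ?gt_eqF//.
      by move: h; rewrite sqrrB exprMn; lra.
  under eq_integral do rewrite EFinD EFinM.
  rewrite ge0_integralD//; last first.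
  - by move=> x _; rewrite lee_fin invr_ge0 ltW.
  - apply: measurable_funeM; apply/measurable_EFinP; apply: measurable_funX; exact: measurable_funB.
  - by move=> x _; rewrite -EFinM lee_fin mulr_ge0 ?sqr_ge0// ltW.
  rewrite ge0_integralZl_EFin//; last 2 first.
  - by move=> x _; rewrite lee_fin sqr_ge0.
  - by apply/measurable_EFinP; apply: measurable_funX; exact: measurable_funB.
  rewrite integral_cst// -(@fineK _ (mu setT)); last by rewrite ge0_fin_numE.
  apply: (@le_trans _ _ (D%:E * (D^-1 ^+ 2)%:E + (D^-1)%:E * (fine (mu setT))%:E)%E).
    by rewrite leeD2r// lee_pmul2l// ?lte_fin// nF.
  by rewrite -!EFinM -EFinD lee_fin expr2 mulrA divff ?gt_eqF// mul1r mulrDl mul1r [X in _ + X]mulrC.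
(* Zeroing on the exceptional null set makes the sequence converge everywhere, so that its limit is
   measurable. *)
pose G n x : R := F n x * \1_(~` N) x.
have mG n : measurable_fun setT (G n).
  by apply: measurable_funM => //; apply: measurable_indic; exact: measurableC.
pose g x : R := limn (fun n => G n x).
have Gg x : G n x @[n --> \oo] --> g x.
  rewrite /g /G indicE; have [xN|xN] := boolP (x \in ~` N).
    apply: is_cvgM; last exact: is_cvg_cst.
    by apply: contrapT => nx; move/set_mem: xN; apply; exact: hN.
  by under eq_fun do rewrite mulr0; exact: is_cvg_cst.
have mg : measurable_fun setT g by apply: (measurable_fun_cvg mG) => x _; exact: Gg.
have GF n : {ae mu, forall x, G n x = F n x}.
  exists N; split=> // x; apply: contra_notP => /= xN.
  by rewrite /G indicE mem_set// mulr1.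
have le k : (\int[mu]_x ((g x - G k x) ^+ 2)%:E <= ((2 ^ k.+1)%:R^-1 ^+ 2)%:E)%E.
  have mGG n : measurable_fun setT (fun x => ((G n x - G k x) ^+ 2)%:E).
    by apply/measurable_EFinP; apply: measurable_funX; exact: measurable_funB.
  have := @fatou _ _ _ mu setT measurableT (fun n x => ((G n x - G k x) ^+ 2)%:E) mGG
    (fun n x _ => ltac:(by rewrite lee_fin sqr_ge0)).
  under eq_integral => x _.
    have cvx : ((G n x - G k x) ^+ 2)%:E @[n --> \oo] --> ((g x - G k x) ^+ 2)%:E.
      apply: cvg_EFin; first exact: nearW.
      have cB : G n x - G k x @[n --> \oo] --> g x - G k x.
        by apply: cvgB => //; exact: cvg_cst.
      by rewrite expr2; under eq_fun do rewrite expr2; exact: cvgM.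
    rewrite (cvg_limn_einf_sup cvx).1; over.
  move/le_trans; apply; apply: limn_einf_le; exists k => // n /= kn.
  apply: le_trans (nF k n kn); rewrite le_eqVlt; apply/orP; left; apply/eqP.
  apply: ae_eq_integral => //.
    by apply/measurable_EFinP; apply: measurable_funX; exact: measurable_funB.
  by apply: ae_mono2 (GF n) (GF k) => x -> ->.
have sg : square_integrable mu (g : S -> R^o).
  have mGk := measurable_strongly_measurable (mG 0%N).
  have sG : square_integrable mu (G 0%N : S -> R^o).
    split=> //; rewrite -(L2_norm_ae (F := F 0%N) mGk) ?ltry//.
    by apply: ae_mono (GF 0%N) => x ->.
  have sD : square_integrable mu (fun x => g x - G 0%N x : R^o).
    split; first by apply: measurable_strongly_measurable; exact: measurable_funB.
    under eq_integral do rewrite real_normK ?num_real//.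
    by apply: le_lt_trans (le 0%N) _; rewrite ltry.
  have := square_integrableDZ 1 sD sG.
  by congr square_integrable; apply/funext => x; rewrite scale1r subrK.
have [L Lg] := L2_exists sg; exists L.
have nL k : `|L - F k| <= (2 ^ k.+1)%:R^-1.
  rewrite -ler_sqr ?nnegrE ?invr_ge0// -lee_fin.
  rewrite (L2_norm_ae (f := fun x => g x - G k x : R^o)).
  - by under eq_integral do rewrite real_normK ?num_real//; exact: le.
  - by apply: measurable_strongly_measurable; exact: measurable_funB.
  - by apply: filterS3 (L2_subE L (F k)) Lg (GF k) => x -> -> ->.
apply/cvgrPdist_le => e e0; exists (Num.trunc e^-1) => // k /= hk.
apply: (le_trans (nL k)); rewrite -[leRHS]invrK lef_pV2 ?posrE ?invr_gt0 ?ltr0n ?expn_gt0//.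
apply: (@le_trans _ _ (Num.trunc e^-1).+1%:R); first exact/ltW/truncnS_gt.
by rewrite ler_nat (leq_ltn_trans hk)// ltnW// ltn_expl.
Qed.

Lemma L2_complete (F : nat -> H) :
  (forall e : R, 0 < e -> exists N, forall n m, (N <= n)%N -> (N <= m)%N ->
     `|F n - F m| <= e) -> exists L : H, F n @[n --> \oo] --> L.
Proof.
move=> cF.
have /choice[N hN] : forall k : nat, exists N, forall n m, (N <= n)%N -> (N <= m)%N ->
    `|F n - F m| <= (2 ^ k.+1)%:R^-1.
  by move=> k; apply: cF; rewrite invr_gt0 ltr0n expn_gt0.
(* The maximum provides the rapid decay along the subsequence; the summand [k] makes [M]
   unbounded. *)
pose M k := (k + \max_(i < k.+1) N i)%N.
have NM i k : (i <= k)%N -> (N i <= M k)%N.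
  move=> ik; rewrite (leq_trans _ (leq_addl _ _))//.
  exact: (leq_bigmax (F := fun j : 'I_k.+1 => N j) (Ordinal (ik : (i < k.+1)%N))).
have [L FL] : exists L : H, F (M k) @[k --> \oo] --> L.
  apply: L2_complete_fast => k l kl; apply: hN; first exact: NM.
  exact: NM.
exists L; apply/cvgrPdist_le => e e0.
have e20 : 0 < e / 2 by rewrite divr_gt0.
have [n0 hn0] := cF _ e20.
have /cvgrPdist_le /(_ _ e20) [k0 _ hk0] := FL.
exists n0 => // n /= n0n.
pose k := maxn k0 n0.
have Mk : (n0 <= M k)%N by rewrite (leq_trans (leq_maxr k0 n0))// leq_addr.
rewrite [e]splitr -(subrKA (F (M k))) (le_trans (ler_normD _ _))// lerD//.
  by apply: hk0 => /=; exact: leq_maxl.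
exact: hn0.
Qed.

End complete.

(** * Density of total sets, and separability of L^2 of the domain *)

Section dense.
Context (R : realType) (X : innerSpaceType R).
Hypothesis X_complete : forall x_ : nat -> X,
  (forall e : R, 0 < e -> exists N, forall n m, (N <= n)%N -> (N <= m)%N ->
     `|x_ n - x_ m| <= e) -> exists l : X, x_ n @[n --> \oo] --> l.

Lemma innerBl (x y z : X) : inner (x - y) z = inner x z - inner y z.
Proof. by rewrite -scaleN1r innerDl innerZl mulN1r. Qed.

Lemma innerBr (x y z : X) : inner z (x - y) = inner z x - inner z y.
Proof. by rewrite innerC innerBl !(innerC z). Qed.

Lemma parallelogram (x y : X) :
  `|x - y| ^+ 2 + `|x + y| ^+ 2 = 2 * `|x| ^+ 2 + 2 * `|y| ^+ 2.
Proof.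
rewrite -!inner_norm innerBl !innerBr innerDl !innerDr (innerC y x); ring.
Qed.

Variable D : set X.
Hypotheses (D0 : D 0) (DD : forall x y, D x -> D y -> D (x + y)).
Hypothesis DZ : forall (q : rat) x, D x -> D (ratr q *: x).
Hypothesis D_total : forall x, (forall v, D v -> inner x v = 0) -> x = 0.

(* The minimizing sequence for the distance to [D] converges, and the residual
   is orthogonal to the total set [D]. *)
Lemma dense_of_total (x : X) (e : R) : 0 < e -> exists2 v, D v & `|x - v| <= e.
Proof.
move=> e0.
pose B := [set `|x - v| | v in D].
have B0 : has_inf B.
  split; first by exists `|x - 0|; exists 0.
  by exists 0 => _ [v _ <-].
pose delta := inf B.
have delta_le v : D v -> delta <= `|x - v|.
  by move=> Dv; apply: ge_inf; [by case: B0|exists v].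
have delta0 : 0 <= delta by apply: lb_le_inf; [by case: B0|move=> _ [v _ <-]].
have /choice[v hv] : forall n : nat, exists v, D v /\ `|x - v| < delta + n.+1%:R^-1.
  move=> n; have n0 : 0 < n.+1%:R^-1 :> R by rewrite invr_gt0.
  by have [_ [v Dv <-] lt] := inf_adherent n0 B0; exists v.
(* The midpoint of [v n] and [v m] is again in [D], so the parallelogram identity bounds the square
   by [4 (delta + a)^2 - 4 delta^2]; [a <= 1] absorbs [a^2]. *)
have hc n m (a : R) : 0 < a -> a <= 1 -> n.+1%:R^-1 <= a -> m.+1%:R^-1 <= a ->
    `|v n - v m| ^+ 2 <= 4 * a * (2 * delta + 1).
  move=> a0 a1 na ma.
  have := parallelogram (x - v m) (x - v n).
  have -> : x - v m - (x - v n) = v n - v m by rewrite opprB addrC subrKA.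
  have : (2 * delta) ^+ 2 <= `|x - v m + (x - v n)| ^+ 2.
    rewrite ler_sqr ?nnegrE ?mulr_ge0//.
    have -> : x - v m + (x - v n) = 2 *: (x - ratr (2^-1) *: (v m + v n)).
      rewrite scalerBr scalerA fmorphV rmorph_nat divff ?pnatr_eq0// scale1r.
      by rewrite scaler_nat mulr2n opprD addrACA.
    rewrite normrZ ger0_norm// ler_pM2l//; apply: delta_le; apply: DZ.
    by apply: DD; [have [] := hv m|have [] := hv n].
  have hsq k : k.+1%:R^-1 <= a -> `|x - v k| ^+ 2 <= (delta + a) ^+ 2.
    move=> ka; rewrite ler_sqr ?nnegrE ?addr_ge0//; last exact: ltW.
    have [_ /ltW h] := hv k; apply: (le_trans h); by rewrite lerD2l.
  have := hsq n na; have := hsq m ma; rewrite !sqrrD.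
  have : a ^+ 2 <= a by rewrite expr2 ler_piMl// ltW.
  rewrite (_ : (2 * delta) ^+ 2 = 4 * delta ^+ 2); last by ring.
  move: (`|v n - v m| ^+ 2) (`|x - v m| ^+ 2) (`|x - v n| ^+ 2) (`|_ + _| ^+ 2) => A B1 B2 P.
  by move=> *; lra.
have Vle (a : R) : 0 < a -> exists N, forall n, (N <= n)%N -> n.+1%:R^-1 <= a.
  move=> a0; exists (Num.trunc a^-1) => n Nn.
  rewrite -[leRHS]invrK lef_pV2 ?posrE ?invr_gt0//.
  apply: (@le_trans _ _ (Num.trunc a^-1).+1%:R); first exact/ltW/truncnS_gt.
  by rewrite ler_nat ltnS.
have [p vp] : exists p : X, v n @[n --> \oo] --> p.
  apply: X_complete => eps eps0.
  have d1 : 0 < 4 * (2 * delta + 1) by rewrite mulr_gt0// ltr_wpDl// mulr_ge0.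
  pose a := Num.min 1 (eps ^+ 2 / (4 * (2 * delta + 1))).
  have a0 : 0 < a by rewrite lt_min ltr01 divr_gt0// exprn_gt0.
  have [N hN] := Vle _ a0.
  exists N => n m Nn Nm; rewrite -ler_sqr ?nnegrE ?(ltW eps0)//.
  apply: (le_trans (hc n m a a0 _ (hN _ Nn) (hN _ Nm))).
    by rewrite ge_min lexx.
  rewrite mulrAC mulrC -ler_pdivlMr//.
  by rewrite ge_min lexx orbT.
have cvd w : `|x - (v n + w)| @[n --> \oo] --> `|x - (p + w)|.
  apply: cvg_norm; apply: cvgB; first exact: cvg_cst.
  by apply: cvgD => //; exact: cvg_cst.
have xp : `|x - p| <= delta.
  rewrite -[p]addr0; apply/ler_addgt0Pl => a a0.
  have [N hN] := Vle _ a0.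
  rewrite -(cvg_lim _ (cvd 0))//; apply: limr_le; first by apply/cvg_ex; eexists; exact: cvd.
  exists N => // n /= Nn; rewrite addr0; have [_ /ltW h] := hv n.
  by rewrite (le_trans h)// addrC lerD2r hN.
have px w : D w -> delta <= `|x - (p + w)|.
  move=> Dw; rewrite -(cvg_lim _ (cvd w))//; apply: limr_ge.
    by apply/cvg_ex; eexists; exact: cvd.
  by apply: nearW => n; apply: delta_le; apply: DD => //; have [] := hv n.
have orth w : D w -> inner (x - p) w = 0.
  move=> Dw.
  (* Only rational multiples are known to stay in [D]. Taking [q] to be [1/(n+1)] and [-1/(n+1)],
     then dividing by [1/(n+1)], leaves bounds that vanish in the limit. *)
  have key (q : rat) : 2 * (ratr q * inner (x - p) w) <= ratr q ^+ 2 * `|w| ^+ 2.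
    have : `|x - p| ^+ 2 <= `|x - (p + ratr q *: w)| ^+ 2.
      rewrite ler_sqr ?nnegrE//; apply: (le_trans xp); apply: px; exact: DZ.
    rewrite opprD addrA; move: (x - p) => z.
    rewrite -(inner_norm (z - _)) innerBl !innerBr !innerZl !innerZr.
    rewrite (innerC w) !inner_norm; lra.
  set s := inner _ _ in key *.
  have pos n : 2 * s <= n.+1%:R^-1 * `|w| ^+ 2 /\ - (n.+1%:R^-1 * `|w| ^+ 2) <= 2 * s.
    have n0 : 0 < n.+1%:R^-1 :> R by rewrite invr_gt0.
    have := key (n.+1%:R^-1); have := key (- n.+1%:R^-1).
    rewrite !(rmorphN, fmorphV, rmorph_nat).
    set z := n.+1%:R^-1 in n0 *; move=> k1 k2; split.
      by rewrite -(ler_pM2l n0); lra.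
    by rewrite -(ler_pM2l n0); lra.
  have lim w' : n.+1%:R^-1 * w' @[n --> \oo] --> (0 : R).
    by rewrite -[X in _ --> X](mul0r w'); apply: cvgMl; exact: cvg_harmonic.
  have s_le : 2 * s <= 0.
    have := lim (`|w| ^+ 2); move=> h; rewrite -(cvg_lim _ h)//; apply: limr_ge.
      by apply/cvg_ex; eexists; exact: h.
    by apply: nearW => n; have [] := pos n.
  have s_ge : 0 <= 2 * s.
    have h : - (n.+1%:R^-1 * `|w| ^+ 2) @[n --> \oo] --> (0 : R).
      by rewrite -[X in _ --> X]oppr0; apply: cvgN; exact: lim.
    rewrite -(cvg_lim _ h)//.
    apply: limr_le; first by apply/cvg_ex; eexists; exact: h.
    by apply: nearW => n; have [] := pos n.
  lra.
have /subr0_eq xE := D_total orth.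
move: vp; rewrite -xE => /cvgrPdist_le /(_ _ e0) [k _ hk].
by exists (v k); [have [] := hv k|exact: (hk k (leqnn k))].
Qed.

End dense.

Section separable.
Context (R : realType) (n : nat) (Omega : set 'rV[R]_n.+1).
Context (hO : bounded_lipschitz_domain Omega).
Local Notation H := (L2domain R hO).
Local Notation code := (n.+1.-tuple rat * nat)%type.

(** Lists turn the rational boxes into a countable family stable under intersection, by
    concatenation; the empty list gives the whole space. *)
Let rbox (s : seq code) : set (borel 'rV[R]_n.+1) :=
  [set x | forall q, q \in s -> obox (@rat_box R n.+1 q).1 (@rat_box R n.+1 q).2 x].

Let rbox_measurable s : measurable (rbox s).
Proof.
rewrite (_ : rbox s = \bigcap_(q in [set` s]) (obox (@rat_box R n.+1 q).1 (@rat_box R n.+1 q).2)).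
  apply: fin_bigcap_measurable => // q _; apply: sub_sigma_algebra.
  exact: open_obox.
by apply/seteqP; split=> x h q; exact: h.
Qed.

Let rbox_gen : @measurable _ (borel 'rV[R]_n.+1) = <<s range rbox >>.
Proof.
apply: borel_rat_box => [_ [s _ <-]|q]; first exact: rbox_measurable.
exists [:: q] => //; apply/seteqP; split=> x; last by move=> h q'; rewrite inE => /eqP ->.
by move/(_ q); rewrite inE eqxx; apply.
Qed.

Let rbox_setI : setI_closed (range rbox).
Proof.
move=> _ _ [s _ <-] [t _ <-]; exists (s ++ t) => //.
apply/seteqP; split=> x; last first.
  by move=> [hs ht] q; rewrite mem_cat => /orP[]; [exact: hs|exact: ht].
by move=> h; split=> q qs; apply: h; rewrite mem_cat qs ?orbT.
Qed.

Let rbox_nil : rbox [::] = setT. Proof. by apply/seteqP; split. Qed.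

Lemma L2domain_integrable_orth (h : H) :
  (forall s, (\int[lebesgue_on hO]_(x in rbox s) (h x)%:E = 0)%E) -> h = 0.
Proof.
move=> h0; apply/L2P.
have z0 : {ae lebesgue_on hO, forall x, (0 : H) x = 0}.
  by have := L2_scaleE 0 (0 : H); rewrite scale0r; apply: ae_mono => x ->; rewrite scale0r.
suff : {ae lebesgue_on hO, forall x, h x = 0}.
  by apply: ae_mono2 z0 => x -> ->.
apply: (@ae_eq0_pi_system _ (borel 'rV[R]_n.+1) _ (lebesgue_on hO) (lebesgue_on_finite hO)
  (range rbox) (fun=> setT)) => //.
- by move=> _; exists [::].
- by rewrite bigcup_const.
- exact: (L2_integrable (lebesgue_on_finite hO)).
- by move=> _ [s _ <-].
Qed.

Lemma indic_square_integrable (A : set (borel 'rV[R]_n.+1)) : measurable A ->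
  square_integrable (lebesgue_on hO) (\1_A : _ -> R^o).
Proof.
move=> mA; split; first by apply: measurable_strongly_measurable; exact: measurable_indic.
apply: (@le_lt_trans _ _ (\int[lebesgue_on hO]_x (cst 1 x))%E); last first.
  by rewrite integral_cst// mul1e; exact: lebesgue_on_finite.
apply: ge0_le_integral => //.
- apply: measurable_normsq.
  by apply: measurable_strongly_measurable; exact: measurable_indic.
- move=> x _; rewrite lee_fin indicE.
  by case: (_ \in _); rewrite ?normr1 ?expr1n// normr0 expr0n.
Qed.

(** Rational combinations of the indicators of the sets [rbox s] are countably many. They are total,
    since a function whose integrals over a generating pi-system vanish is zero. *)
Lemma L2domain_separable : exists D : nat -> H, forall x (e : R), 0 < e ->
  exists k, `|x - D k| <= e.
Proof.
have /choice[E hE] : forall s, exists F : H,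
    {ae lebesgue_on hO, forall x, F x = \1_(rbox s) x}.
  by move=> s; apply: (L2_exists (indic_square_integrable (rbox_measurable s))).
pose comb (l : seq (rat * seq code)) : H := \sum_(p <- l) ratr p.1 *: E p.2.
exists (fun k => if unpickle k is Some l then comb l else 0) => x e e0.
have D0 : range comb 0 by exists [::] => //; rewrite /comb big_nil.
have DD (y z : H) : range comb y -> range comb z -> range comb (y + z).
  by move=> [l _ <-] [l' _ <-]; exists (l ++ l') => //; rewrite /comb big_cat.
have DZ (q : rat) (y : H) : range comb y -> range comb (ratr q *: y).
  move=> [l _ <-]; exists [seq (q * p.1, p.2) | p <- l] => //.
  rewrite /comb big_map scaler_sumr; apply: eq_bigr => p _ /=.
  by rewrite rmorphM scalerA.
have Dtot (h : H) : (forall v, range comb v -> inner h v = 0) -> h = 0.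
  move=> hv; apply: L2domain_integrable_orth => s.
  have := hv (E s); rewrite (L2_inner_ae (L2_square_integrable h)
    (indic_square_integrable (rbox_measurable s)) _ (hE s)); last exact: aeW.
  have -> : (\int[lebesgue_on hO]_x inner (h x) (\1_(rbox s) x : R^o))%R =
    fine (\int[lebesgue_on hO]_(x in rbox s) (h x)%:E)%E.
    rewrite /Rintegral; congr fine; rewrite [RHS]integral_mkcond.
    apply: eq_integral => y _; rewrite patchE /inner /= indicE.
    by case: ifP => _; rewrite ?mulr1 ?mulr0.
  move=> h0; rewrite -[LHS]fineK ?h0//.
    by exists [:: (1, s)] => //; rewrite /comb big_seq1 /= rmorph1 scale1r.
  apply: integrable_fin_num; first exact: rbox_measurable.
  apply: (integrableS measurableT) => //.
  exact: (L2_integrable (lebesgue_on_finite hO)).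
have [_ [l _ <-] le] :=
  dense_of_total (@L2_complete _ _ _ _ (lebesgue_on_finite hO)) D0 DD DZ Dtot x e0.
by exists (pickle l); rewrite pickleK.
Qed.

End separable.

(** * Bochner integrals and time derivatives *)

Lemma cauchy_schwarz (R : realType) (X : innerSpaceType R) (x y : X) :
  `|inner x y| <= `|x| * `|y|.
Proof.
suff H (z : X) : inner z y <= `|z| * `|y|.
  rewrite ler_norml H andbT lerNl -[X in X <= _]mulN1r -innerZl scaleN1r.
  by rewrite (le_trans (H _))// normrN.
have [->|z0] := eqVneq z 0; first by rewrite -(scale0r 0) innerZl mul0r mulr_ge0.
have [->|y0] := eqVneq y 0; first by rewrite -(scale0r 0) innerZr mul0r mulr_ge0.
have zy0 : 0 < `|z| * `|y| by rewrite mulr_gt0// normr_gt0.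
have := sqr_ge0 `| `|y| *: z - `|z| *: y|.
rewrite -inner_norm innerBl !innerBr !innerZl !innerZr !inner_norm (innerC y z) => h.
rewrite -subr_ge0 -(pmulr_rge0 _ zy0).
move: h; set p := `|z|; set q := `|y|; set t := inner z y.
rewrite (_ : _ - _ - _ = 2 * (p * q * (p * q - t))); [lra|ring].
Qed.

Lemma inner0l (R : realType) (X : innerSpaceType R) (x : X) : inner 0 x = 0.
Proof. by rewrite -(scale0r 0) innerZl mul0r. Qed.

Lemma innerNl (R : realType) (X : innerSpaceType R) (x y : X) :
  inner (- x) y = - inner x y.
Proof. by rewrite -scaleN1r innerZl mulN1r. Qed.

Lemma integrableMl_real d (S : measurableType d) (R : realType)
    (mu : {measure set S -> \bar R}) (k : R) (h : S -> R) :
  mu.-integrable setT (EFin \o h) -> mu.-integrable setT (EFin \o (fun t => k * h t)).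
Proof. by move=> ih; exact: (integrableZl measurableT k ih). Qed.

Lemma eq_inner (R : realType) (X : innerSpaceType R) (x y : X) :
  (forall z, inner x z = inner y z) -> x = y.
Proof.
move=> h; apply/eqP; rewrite -subr_eq0 -normr_eq0 -sqrf_eq0 -inner_norm.
by rewrite innerBl h subrr.
Qed.

Lemma cvg_inner (R : realType) (X : innerSpaceType R) (I : Type)
    (F : set_system I) {FF : Filter F} (x_ : I -> X) (x z : X) :
  x_ i @[i --> F] --> x -> inner (x_ i) z @[i --> F] --> inner x z.
Proof.
move=> /cvgrPdist_le xc; apply/cvgrPdist_le => e e0.
have z1 : 0 < `|z| + 1 by rewrite ltr_wpDl.
have /xc : 0 < e / (`|z| + 1) by rewrite divr_gt0.
apply: filterS => n h; rewrite -innerBl (le_trans (cauchy_schwarz _ _))//.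
rewrite (le_trans (ler_wpM2r _ h))// mulrAC ler_pdivrMr// ler_wpM2l// ?ltW// ltrDl ltr01 //.
Qed.

Section bochner.
Context d (S : measurableType d) (R : realType).
Context (mu : {measure set S -> \bar R}) (mu_fin : (mu setT < +oo)%E).
Context (X : innerSpaceType R).
Implicit Types (f s : S -> X) (x : X).

Lemma simple_integral_inner s x : simple s ->
  mu.-integrable setT (EFin \o (fun t => inner (s t) x)) /\
  inner (simple_integral mu s) x = (\int[mu]_t inner (s t) x)%R.
Proof.
move=> [fs ms].
have ii (r : seq X) : mu.-integrable setT
      (EFin \o (fun t => \sum_(y <- r) inner y x * \1_(s @^-1` [set y]) t)) /\
    (\int[mu]_t (\sum_(y <- r) inner y x * \1_(s @^-1` [set y]) t))%R =
    \sum_(y <- r) inner y x * fine (mu (s @^-1` [set y])).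
  elim: r => [|y r [IH1 IH2]].
    under eq_fun do rewrite big_nil.
    split; first exact: integrable_cst.
    by rewrite big_nil Rintegral_cst// mul0r.
  have i1 : mu.-integrable setT (EFin \o (\1_(s @^-1` [set y]) : S -> R)).
    apply: (le_integrable measurableT _ _ (integrable_cst mu_fin 1)).
      by apply/measurable_EFinP; exact: measurable_indic.
    by move=> t _ /=; rewrite lee_fin indicE; case: (_ \in _); rewrite ?normr1 ?normr0.
  have i2 : mu.-integrable setT (EFin \o (fun t => inner y x * \1_(s @^-1` [set y]) t)).
    exact: integrableMl_real.
  under eq_fun do rewrite big_cons; split.
    exact: (integrableD measurableT i2 IH1).
  rewrite RintegralD// IH2 big_cons; congr (_ + _).
  rewrite RintegralZl//; congr (_ * _).
  by rewrite /Rintegral integral_indic// setIT.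
have /finite_seqP[r0 r0E] := fs; pose r := undup r0.
have rE : range s = [set` r].
  by rewrite r0E; apply/seteqP; split=> y /=; rewrite mem_undup.
have sr t : s t \in r by have : [set` r] (s t) by rewrite -rE; exists t.
have sE t : inner (s t) x = \sum_(y <- r) inner y x * \1_(s @^-1` [set y]) t.
  rewrite (bigD1_seq (s t)) ?undup_uniq//=.
  rewrite indicE mem_set// mulr1 big1 ?addr0// => y /eqP yt.
  by rewrite indicE memNset ?mulr0// => /= /esym.
have [i1 i2] := ii r.
under eq_fun do rewrite sE; split => //.
(* The defining sum runs over all of [X]; outside the range the preimages are empty and the terms
   vanish. *)
rewrite i2 /simple_integral -(@fsbig_widen _ _ _ _ (range s) setT)//; last first.
  move=> y [_ /= yr]; rewrite (_ : _ @^-1` _ = set0) ?measure0 ?scale0r//.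
  by apply/seteqP; split=> // t /= ty; apply: yr; exists t.
rewrite rE -fsbig_seq ?undup_uniq//.
elim: r {rE sr sE i1 i2} => [|y r IH]; first by rewrite !big_nil inner0l.
by rewrite !big_cons innerDl IH innerZl mulrC.
Qed.

Lemma measurable_norm_sub f s : strongly_measurable f -> strongly_measurable s ->
  measurable_fun setT (fun t => `|f t - s t|).
Proof.
move=> mf ms; apply: strongly_measurable_norm.
have := strongly_measurableDZ (-1) ms mf.
by congr strongly_measurable; apply/funext => t; rewrite scaleN1r addrC.
Qed.

Lemma simple_strongly_measurable s : simple s -> strongly_measurable s.
Proof. by move=> ss; exists (fun=> s); split=> // t; exact: cvg_cst. Qed.

Lemma bochner_inner f I x : is_bochner_integral mu f I ->
  mu.-integrable setT (EFin \o (fun t => inner (f t) x)) /\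
  inner I x = (\int[mu]_t inner (f t) x)%R.
Proof.
move=> [mf [s_ ss [cv1 cv2]]].
have ms k : strongly_measurable (s_ k) by apply: simple_strongly_measurable; case: (ss k).
have mx : strongly_measurable (fun _ : S => x) := strongly_measurable_cst S x.
have mfs k : measurable_fun setT (fun t => `|f t - s_ k t|) by exact: measurable_norm_sub.
have /fine_cvgP[fin cvf] := cv1.
pose a k := fine (\int[mu]_t `|f t - s_ k t|%:E)%E.
have mfsx k : measurable_fun setT (fun t => inner (f t - s_ k t) x).
  under eq_fun do rewrite innerBl.
  by apply: measurable_funB; exact: measurable_inner.
have iN k : (\int[mu]_t `|f t - s_ k t|%:E)%E \is a fin_num ->
    mu.-integrable setT (EFin \o (fun t => `|x| * `|f t - s_ k t|)).
  move=> fk; apply: integrableMl_real; apply/integrableP; split.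
    exact/measurable_EFinP.
  under eq_integral do rewrite /= normr_id.
  by rewrite ltey_eq fk.
have ib k : (\int[mu]_t `|f t - s_ k t|%:E)%E \is a fin_num ->
    mu.-integrable setT (EFin \o (fun t => inner (f t - s_ k t) x)).
  move=> fk; apply: (le_integrable measurableT _ _ (iN k fk)).
    exact/measurable_EFinP.
  move=> t _ /=; rewrite lee_fin (le_trans (cauchy_schwarz _ _))//.
  by rewrite mulrC normrM !normr_id.
have iB k : (\int[mu]_t `|f t - s_ k t|%:E)%E \is a fin_num ->
    mu.-integrable setT (EFin \o (fun t => inner (f t) x)).
  move=> fk; have [is_ _] := simple_integral_inner x (ss k).1.
  have := integrableD measurableT (ib k fk) is_.
  by apply: eq_integrable => // t _ /=; rewrite -EFinD innerBl subrK.
have i_f : mu.-integrable setT (EFin \o (fun t => inner (f t) x)).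
  by have [k0 _ hk] := fin; apply: (iB k0); exact: (hk k0 (leqnn k0)).
split=> //.
have c1 : inner (simple_integral mu (s_ k)) x @[k --> \oo] --> inner I x.
  exact: cvg_inner.
apply: (cvg_unique _ c1) => //.
apply/cvgrPdist_le => e e0.
have x1 : 0 < `|x| + 1 by rewrite ltr_wpDl.
move/cvgrPdist_le : cvf => /(_ (e / (`|x| + 1))); rewrite divr_gt0// => /(_ isT) cvf.
apply: filterS2 fin cvf => k fk; rewrite /= sub0r normrN => ak.
have [is_ ->] := simple_integral_inner x (ss k).1.
rewrite -RintegralB//.
rewrite (le_trans (le_normr_Rintegral _ _))//.
  by have := ib k fk; under eq_fun do rewrite innerBl.
have -> : e = (`|x| + 1) * (e / (`|x| + 1)) by rewrite mulrC divfK// gt_eqF.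
apply: (@le_trans _ _ (`|x| * a k)).
  rewrite /a -[X in _ <= _ * X]/(\int[mu]_t `|f t - s_ k t|)%R -RintegralZl//; last first.
    apply/integrableP; split; first exact/measurable_EFinP.
    under eq_integral do rewrite /= normr_id.
    by rewrite ltey_eq fk.
  apply: le_Rintegral => //; last first.
  - by move=> t _; rewrite -innerBl mulrC; exact: cauchy_schwarz.
  - exact: iN.
  - have := integrable_norm (ib k fk); by under [X in integrable _ _ X]eq_fun do rewrite /= innerBl.
apply: ler_pM => //; first by rewrite fine_ge0// integral_ge0.
  by rewrite lerDl.
by apply: le_trans ak; rewrite ler_norm.
Qed.

End bochner.

Section time_derivative_unique.
Context (R : realType) (T : R) (X : innerSpaceType R).

(** Testing against a fixed vector reduces to [ae_eq0_time], with an exceptional set that depends on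
    the vector. Separability of [X] cannot be assumed: [X] is also [M], over an arbitrary finite
    measure space. *)
Lemma weak_derivative_unique (v g g' : L2 (lebesgue_time T) X) :
  is_weak_derivative v g -> is_weak_derivative v g' -> g = g'.
Proof.
move=> hg hg'; apply/L2P.
have fT := lebesgue_time_finite T.
have sq1 (x : X) : square_integrable (lebesgue_time T) (fun _ : measurableTypeR R => x).
  exact: square_integrable_cst.
have igx (h : L2 (lebesgue_time T) X) x := integrable_inner (L2_square_integrable h) (sq1 x).
have orth x : {ae lebesgue_time T, forall t, inner (g t - g' t) x = 0}.
  apply: ae_eq0_time.
    have := integrableB measurableT (igx g x) (igx g' x).
    by apply: eq_integrable => // t _ /=; rewrite innerBl.
  move=> phi tphi; have [I [h1 h2]] := hg phi tphi; have [I' [h1' h2']] := hg' phi tphi.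
  have II : inner I x = inner I' x.
    have [_ e1] := bochner_inner fT x h1; have [_ e1'] := bochner_inner fT x h1'.
    by apply: oppr_inj; rewrite -!innerNl e1 e1'.
  have [i2 e2] := bochner_inner fT x h2; have [i2' e2'] := bochner_inner fT x h2'.
  rewrite (_ : (fun t => _) = (fun t => inner (phi t *: g t) x - inner (phi t *: g' t) x)).
    by rewrite RintegralB// -e2 -e2' II subrr.
  by apply/funext => t; rewrite innerBl !innerZl mulrBl mulrC [X in _ - X]mulrC.
have [s [ss sg]] : strongly_measurable (fun t => g t - g' t).
  have := strongly_measurableDZ (-1) (L2fun_strongly_measurable (repr g'))
    (L2fun_strongly_measurable (repr g)).
  by congr strongly_measurable; apply/funext => t; rewrite scaleN1r addrC.
(* The values of [g - g'] are limits of vectors from the countably many values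
   of its simple approximations, so testing against these suffices. *)
have : {ae lebesgue_time T, forall t, forall n, inner (g t - g' t) (s n t) = 0}.
  apply: ae_foralln => n.
  have [/finite_seqP[r rE] _] := ss n.
  have : {ae lebesgue_time T, forall t, forall k : nat, inner (g t - g' t) (nth 0 r k) = 0}.
    by apply: ae_foralln => k; exact: orth.
  apply: ae_mono => t ht.
  have st : s n t \in r by have : [set` r] (s n t) by rewrite -rE; exists t.
  by rewrite -(nth_index 0 st); exact: ht.
apply: ae_mono => t ht.
have : inner (s n t) (g t - g' t) @[n --> \oo] --> inner (g t - g' t) (g t - g' t).
  by apply: cvg_inner; exact: sg.
under eq_fun do rewrite innerC ht.
move=> c0.
have : inner (g t - g' t) (g t - g' t) = 0.
  by apply: (cvg_unique _ c0) => //; exact: cvg_cst.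
rewrite inner_norm => /eqP; rewrite sqrf_eq0 normr_eq0 subr_eq0.
by move/eqP.
Qed.

Lemma time_derivative_unique (u : R -> X) (g g' : L2 (lebesgue_time T) X) :
  is_time_derivative u g -> is_time_derivative u g' -> g = g'.
Proof.
move=> [v uv hv] [v' uv' hv'].
have vv : v = v' by apply/L2P; apply: ae_mono2 uv uv' => t <-.
by rewrite vv in hv; exact: weak_derivative_unique hv hv'.
Qed.

Lemma time_derivativeP (u : R -> X) : H1time T u ->
  is_time_derivative u (time_derivative T u).
Proof. by move=> [_ ex]; exact: (xgetPex 0 ex). Qed.

End time_derivative_unique.

(** * The weighted product space *)

Section pairs.
Context (R : realType) (k : R) (k0 : 0 < k) (X Y : innerSpaceType R).
Local Notation P := (wprod k0 X Y).

Lemma wprod_inner (U V : P) : inner U V = k * inner U.1 V.1 + inner U.2 V.2.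
Proof. by []. Qed.

Lemma wprod_norm_sq (U : P) : `|U| ^+ 2 = k * `|U.1| ^+ 2 + `|U.2| ^+ 2.
Proof. by rewrite -inner_norm wprod_inner !inner_norm. Qed.

(** The constant is crude: both weights, [k] and 1, are at most [(1 + k)^2]. It serves to pass from
    components to pairs in limits and integrals. *)
Lemma wprod_norm_le (U : P) : `|U| <= (1 + k) * (`|U.1| + `|U.2|).
Proof.
have k1 : 0 <= 1 + k by rewrite addr_ge0// ltW.
suff : `|U| ^+ 2 <= ((1 + k) * (`|U.1| + `|U.2|)) ^+ 2.
  have pU : `|U| \is Num.nneg by rewrite nnegrE.
  have pB : (1 + k) * (`|U.1| + `|U.2|) \is Num.nneg by rewrite nnegrE mulr_ge0// addr_ge0.
  by move=> h; rewrite -(@ler_sqr _ _ _ pU pB).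
rewrite wprod_norm_sq.
have := normr_ge0 U.1; have := normr_ge0 U.2.
move: `|U.1| `|U.2| => a b b0 a0.
have kk : k <= (1 + k) ^+ 2 by rewrite sqrrD expr1n; have := sqr_ge0 k; have := k0; lra.
have k2 : 1 <= (1 + k) ^+ 2 by rewrite expr_ge1// lerDl ltW.
rewrite exprMn; apply: (@le_trans _ _ ((1 + k) ^+ 2 * a ^+ 2 + (1 + k) ^+ 2 * b ^+ 2)).
  by rewrite lerD ?ler_wpM2r ?sqr_ge0// ler_peMl ?sqr_ge0.
rewrite -mulrDr ler_wpM2l ?sqr_ge0// sqrrD lerD2r lerDl.
by rewrite mulrn_wge0// mulr_ge0.
Qed.

Lemma cvg_wprod (a : nat -> X) (b : nat -> Y) x y :
  a n @[n --> \oo] --> x -> b n @[n --> \oo] --> y ->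
  ((a n, b n) : P) @[n --> \oo] --> ((x, y) : P).
Proof.
move=> /cvgrPdist_le ax /cvgrPdist_le by_; apply/cvgrPdist_le => e e0.
have d0 : 0 < 2 * (1 + k) by rewrite mulr_gt0// addr_gt0.
have /ax h1 : 0 < e / (2 * (1 + k)) by rewrite divr_gt0.
have /by_ h2 : 0 < e / (2 * (1 + k)) by rewrite divr_gt0.
apply: filterS2 h1 h2 => n h1 h2.
apply: (le_trans (wprod_norm_le _)) => /=.
apply: (@le_trans _ _ ((1 + k) * (e / (2 * (1 + k)) + e / (2 * (1 + k))))).
  by rewrite ler_wpM2l ?lerD// addr_ge0// ltW.
rewrite le_eqVlt; apply/orP; left; apply/eqP; field.
by rewrite gt_eqF// addr_gt0.
Qed.

Section measurable.
Context d (S : measurableType d) (mu : {measure set S -> \bar R}).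

Lemma simple_wprod (s : S -> X) (t : S -> Y) : simple s -> simple t ->
  simple (fun z => (s z, t z) : P).
Proof.
move=> [fs ms] [ft mt]; split.
  apply: (sub_finite_set _ (finite_image2 (fun u v => (u, v) : P) fs ft)).
  by move=> _ [x _ <-]; exists (s x); [exists x|exists (t x); [exists x|]].
move=> [x y]; rewrite (_ : _ @^-1` _ = s @^-1` [set x] `&` t @^-1` [set y]).
  exact: measurableI.
by apply/seteqP; split=> [z [<- <-]|z [/= <- <-]].
Qed.

Lemma strongly_measurable_wprod (f : S -> X) (g : S -> Y) :
  strongly_measurable f -> strongly_measurable g ->
  strongly_measurable (fun z => (f z, g z) : P).
Proof.
move=> [s [ss sf]] [t [st tg]]; exists (fun n z => (s n z, t n z)); split=> [n|z].
  exact: simple_wprod.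
exact: cvg_wprod.
Qed.

Lemma square_integrable_wprod (f : S -> X) (g : S -> Y) :
  square_integrable mu f -> square_integrable mu g ->
  square_integrable mu (fun z => (f z, g z) : P).
Proof.
move=> [mf If] [mg Ig]; split; first exact: strongly_measurable_wprod.
under eq_integral do rewrite wprod_norm_sq/= EFinD EFinM.
have m1 := measurable_normsq mf; have m2 := measurable_normsq mg.
rewrite ge0_integralD//; last 2 first.
- by move=> x _; rewrite -EFinM lee_fin mulr_ge0 ?sqr_ge0// ltW.
- exact: measurable_funeM.
rewrite ge0_integralZl_EFin//; last first.
- exact: ltW.
by rewrite lte_add_pinfty// lte_mul_pinfty// lee_fin ltW.
Qed.

Lemma strongly_measurable_scale (Z : innerSpaceType R) (h : S -> R) (f : S -> Z) :
  measurable_fun setT h -> strongly_measurable f ->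
  strongly_measurable (fun x => h x *: f x).
Proof.
move=> /measurable_strongly_measurable [s [ss sh]] [t [st tf]].
exists (fun n x => s n x *: t n x); split=> [n|x]; last by apply: cvgZ; [exact: sh|exact: tf].
have [[fs ms] [ft mt]] := (ss n, st n); split.
  apply: (sub_finite_set _ (finite_image2 (fun (u : R) v => u *: v) fs ft)).
  by move=> _ [x _ <-]; exists (s n x); [exists x|exists (t n x); [exists x|]].
move=> y; rewrite (_ : _ @^-1` _ = \bigcup_(u in range (s n)) \bigcup_(v in range (t n))
    (if u *: v == y then s n @^-1` [set u] `&` t n @^-1` [set v] else set0)).
  apply: fin_bigcup_measurable => // u _; apply: fin_bigcup_measurable => // v _.
  by case: ifP => // _; exact: measurableI.
apply/seteqP; split=> [x /= xy|x [u _ [v _]]].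
  exists (s n x); first by exists x.
  by exists (t n x); [exists x|rewrite xy eqxx].
by case: eqP => // <- [/= -> ->].
Qed.

Lemma bochner_ae (Z : innerSpaceType R) (f g : S -> Z) (I : Z) :
  strongly_measurable g -> {ae mu, forall x, f x = g x} ->
  is_bochner_integral mu f I -> is_bochner_integral mu g I.
Proof.
move=> mg fg [mf [s ss [cv1 cv2]]]; split=> //; exists s => //; split=> //.
have ms n : strongly_measurable (s n) by apply: simple_strongly_measurable; case: (ss n).
suff -> : (fun n => \int[mu]_x `|g x - s n x|%:E)%E = (fun n => \int[mu]_x `|f x - s n x|%:E)%E by [].
apply/funext => n; apply: ae_eq_integral => //.
- by apply/measurable_EFinP; exact: measurable_norm_sub.
- by apply/measurable_EFinP; exact: measurable_norm_sub.
- by apply: ae_mono fg => x -> _.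
Qed.

Hypothesis mu_fin : (mu setT < +oo)%E.

Lemma bochner_wprod (f : S -> X) (g : S -> Y) I J :
  is_bochner_integral mu f I -> is_bochner_integral mu g J ->
  is_bochner_integral mu (fun z => (f z, g z) : P) ((I, J) : P).
Proof.
move=> [mf [s ss [s1 s2]]] [mg [t st [t1 t2]]].
split; first exact: strongly_measurable_wprod.
have ms n : strongly_measurable (s n) by apply: simple_strongly_measurable; case: (ss n).
have mt n : strongly_measurable (t n) by apply: simple_strongly_measurable; case: (st n).
have sst n : simple (fun z => (s n z, t n z) : P) by apply: simple_wprod; [case: (ss n)|case: (st n)].
have k1 : 0 <= 1 + k by rewrite addr_ge0// ltW.
have le (a : S -> X) (b : S -> Y) : strongly_measurable a -> strongly_measurable b ->
    (\int[mu]_z `|(a z, b z) : P|%:E <=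
     (1 + k)%:E * (\int[mu]_z `|a z|%:E + \int[mu]_z `|b z|%:E))%E.
  move=> ma mb.
  have na : measurable_fun setT (fun z => `|a z|%:E).
    by apply/measurable_EFinP; exact: strongly_measurable_norm.
  have nb : measurable_fun setT (fun z => `|b z|%:E).
    by apply/measurable_EFinP; exact: strongly_measurable_norm.
  rewrite -ge0_integralD// -ge0_integralZl_EFin//; last 2 first.
  - by move=> x _; rewrite adde_ge0.
  - exact: emeasurable_funD.
  apply: ge0_le_integral => //.
  - apply/measurable_EFinP; apply: strongly_measurable_norm.
    exact: strongly_measurable_wprod.
  - by apply: measurable_funeM; exact: emeasurable_funD.
  - by move=> x _; rewrite -EFinD -EFinM lee_fin; exact: wprod_norm_le.
exists (fun n z => (s n z, t n z)) => [n|].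
  split=> //; apply: le_lt_trans (le _ _ (ms n) (mt n)) _.
  by rewrite lte_mul_pinfty// ?lee_fin// lte_add_pinfty//; [case: (ss n)|case: (st n)].
split.
  have sub (Z : innerSpaceType R) (a b : S -> Z) : strongly_measurable a ->
      strongly_measurable b -> strongly_measurable (fun z => a z - b z).
    move=> ma mb; have := strongly_measurableDZ (-1) mb ma.
    by congr strongly_measurable; apply/funext => z; rewrite scaleN1r addrC.
  apply: (@squeeze_cvge _ _ _ _ (fun=> 0%E) _ (fun n => (1 + k)%:E *
      (\int[mu]_z `|f z - s n z|%:E + \int[mu]_z `|g z - t n z|%:E))%E).
  - apply: nearW => n; apply/andP; split; first by apply: integral_ge0.
    exact: (le _ _ (sub _ _ _ mf (ms n)) (sub _ _ _ mg (mt n))).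
  - exact: cvg_cst.
  - rewrite -[X in _ --> X](mule0 (1 + k)%:E) -[X in _ --> (_ * X)%E](adde0 0%E).
    by apply: cvgeZl => //; apply: cvgeD.
(* The values of a pair do not match those of its components one by one, so the finite sums are
   compared by testing against an arbitrary vector. *)
have E n : simple_integral mu (fun z => (s n z, t n z) : P) =
    (simple_integral mu (s n), simple_integral mu (t n)).
  apply: eq_inner => Z; have [_ ->] := simple_integral_inner mu_fin Z (sst n).
  have [i1 e1] := simple_integral_inner mu_fin Z.1 (ss n).1.
  have [i2 e2] := simple_integral_inner mu_fin Z.2 (st n).1.
  rewrite wprod_inner/= e1 e2 -RintegralZl// -RintegralD//.
  exact: integrableMl_real.
by under eq_fun do rewrite E; exact: cvg_wprod.
Qed.

End measurable.
End pairs.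

Section time_derivative_pair.
Context (R : realType) (T : R) (k : R) (k0 : 0 < k) (X Y : innerSpaceType R).
Local Notation P := (wprod k0 X Y).

Lemma test_fun_measurable (phi : R -> R) D : test_fun D phi ->
  measurable_fun setT (phi : measurableTypeR R -> R) /\
  measurable_fun setT (derive1 phi : measurableTypeR R -> R).
Proof.
move=> [sm _]; split.
  by apply: continuous_measurable_fun; exact: smooth_continuous.
rewrite (_ : derive1 phi = 'D_1 phi); last by apply/funext => t; rewrite derive1E.
by apply: continuous_measurable_fun; apply: smooth_continuous; exact: smooth_derive.
Qed.

(** The pair of the two chosen derivatives has a class [G], which is a weak derivative of the pair
    because Bochner integrals are taken componentwise; uniqueness identifies [G] with the third
    choice. *)
Lemma time_derivative_pair (u : R -> X) (w : R -> Y) : H1time T u -> H1time T w ->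
  {ae lebesgue_time T, forall t, time_derivative T (fun t => (u t, w t) : P) t =
    (time_derivative T u t, time_derivative T w t) :> P}.
Proof.
move=> /time_derivativeP du /time_derivativeP dw.
have fT := lebesgue_time_finite T.
move: (time_derivative T u) (time_derivative T w) du dw => g h [v uv hg] [z wz hh].
have sq (a : L2 (lebesgue_time T) X) (b : L2 (lebesgue_time T) Y) :=
  square_integrable_wprod k0 (L2_square_integrable a) (L2_square_integrable b).
have [V hV] := L2_exists (sq v z); have [G hG] := L2_exists (sq g h).
have dU : is_time_derivative (fun t => (u t, w t) : P) G.
  exists V.
    have : {ae lebesgue_time T, forall t, (u t, w t) = (v t, z t) :> P}.
      by apply: ae_mono2 uv wz => t -> ->.
    by apply: ae_mono2 hV => t -> ->.
  move=> phi tphi; have [mphi mdphi] := test_fun_measurable tphi.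
  have [I [i1 i2]] := hg phi tphi; have [J [j1 j2]] := hh phi tphi.
  have b1 : is_bochner_integral (lebesgue_time T)
      (fun t => (derive1 phi t *: v t, derive1 phi t *: z t) : P) (- ((I, J) : P)).
    exact: (bochner_wprod k0 fT i1 j1).
  have b2 : is_bochner_integral (lebesgue_time T)
      (fun t => (phi t *: g t, phi t *: h t) : P) ((I, J) : P).
    exact: (bochner_wprod k0 fT i2 j2).
  exists ((I, J) : P); split.
    apply: bochner_ae b1.
    - by apply: strongly_measurable_scale => //; exact: L2fun_strongly_measurable.
    - by apply: ae_mono hV => t ->.
  apply: bochner_ae b2.
  - by apply: strongly_measurable_scale => //; exact: L2fun_strongly_measurable.
  - by apply: ae_mono hG => t ->.
have -> : time_derivative T (fun t => (u t, w t) : P) = G.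
  apply: (time_derivative_unique _ dU).
  exact: (xgetPex 0 (ex_intro _ G dU)).
exact: hG.
Qed.

End time_derivative_pair.

(** * H^1_0 and the Dirichlet form *)

Section test_functions_theory.
Context (R : realType) (V : normedModType R) (D : set V).
Implicit Types f g : V -> R.

Lemma test_funDZ (a : R) f g : test_fun D f -> test_fun D g ->
  test_fun D (fun x => a * f x + g x).
Proof.
move=> [sf [C cC [CD f0]]] [sg [C' cC' [CD' g0]]]; split.
  by apply: smoothD => //; apply: smoothM => //; exact: smooth_cst.
exists (C `|` C'); first exact: compactU.
split=> [x [/CD|/CD']//|x /not_orP[/f0 -> /g0 ->]].
by rewrite mulr0 addr0.
Qed.

Lemma derive_smoothDZ (a : R) f g x v : smooth f -> smooth g ->
  'D_v (fun x => a * f x + g x) x = a * 'D_v f x + 'D_v g x.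
Proof.
move=> sf sg.
have df : derivable f x v by apply: diff_derivable; exact: smooth_differentiable.
have dg : derivable g x v by apply: diff_derivable; exact: smooth_differentiable.
transitivity ('D_v (a *: f + g) x) => //.
by rewrite deriveD//; [rewrite deriveZ|exact: derivableZ].
Qed.

Lemma test_fun_derive v f : test_fun D f -> test_fun D ('D_v f).
Proof.
move=> [sf [C cC [CD f0]]]; split; first exact: smooth_derive.
exists C => //; split=> // x Cx.
have nC : nbhs x (~` C).
  apply: open_nbhs_nbhs; split=> //; apply: closed_openC.
  by apply: compact_closed => //; exact: norm_hausdorff.
have -> : 'D_v f x = 'D_v (fun _ : V => 0 : R) x.
  by apply: near_eq_derive; apply: filterS nC => y; exact: f0.
exact: derive_cst.
Qed.

Lemma test_fun_bounded f : test_fun D f -> exists2 C, 0 <= C & forall x, `|f x| <= C.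
Proof.
move=> [sf [K cK [_ f0]]].
have cf : continuous f := smooth_continuous sf.
have /compact_bounded[M [_ hM]] : compact (f @` K).
  by apply: continuous_compact => //; exact: continuous_subspaceT.
exists (`|M| + 1) => [|x]; first by rewrite addr_ge0.
have [Kx|/f0 ->] := pselect (K x); last by rewrite normr0 addr_ge0.
by apply: (hM (`|M| + 1)); [rewrite ltr_pwDr// ler_norm|exists x].
Qed.

End test_functions_theory.

Section sobolev.
Context (R : realType) (n : nat) (Omega : set 'rV[R]_n.+1).
Context (hO : bounded_lipschitz_domain Omega).
Local Notation H := (L2domain R hO).
Local Notation m := (lebesgue_on hO).

Lemma test_fun_sqint (phi : 'rV[R]_n.+1 -> R) : test_fun Omega phi ->
  square_integrable m (phi : borel 'rV[R]_n.+1 -> R^o).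
Proof.
move=> tphi; have [C C0 hC] := test_fun_bounded tphi.
have mphi : measurable_fun setT (phi : borel 'rV[R]_n.+1 -> R).
  by apply: continuous_borel_measurable; apply: smooth_continuous; case: tphi.
apply: (square_integrable_le (measurable_strongly_measurable mphi)
  (square_integrable_cst (C : R^o) (lebesgue_on_finite hO))) => x.
by rewrite [leRHS]ger0_norm.
Qed.

Lemma integrable_test (u : H) phi : test_fun Omega phi ->
  m.-integrable setT (EFin \o (fun x => u x * phi x)).
Proof.
by move=> tphi; exact: (integrable_inner (L2_square_integrable u) (test_fun_sqint tphi)).
Qed.

Lemma eq_L2_tests (u v : H) : (forall phi, test_fun Omega phi ->
  (\int[m]_x (u x * phi x))%R = (\int[m]_x (v x * phi x))%R) -> u = v.
Proof.
move=> uv; apply/L2P.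
have fin := lebesgue_on_finite hO.
suff : {ae m, forall x, u x - v x = 0}.
  by apply: ae_mono => x /eqP; rewrite subr_eq0 => /eqP.
apply: (@ae_eq0_domain R n Omega hO (fun x => u x - v x)).
  exact: (integrableB measurableT (L2_integrable fin u) (L2_integrable fin v)).
move=> phi tphi.
under eq_Rintegral do rewrite mulrBl.
by rewrite RintegralB// ?uv ?subrr//; exact: integrable_test.
Qed.

Lemma weak_gradient_unique (u : H) g g' :
  weak_gradient u g -> weak_gradient u g' -> g = g'.
Proof.
move=> hg hg'; apply/funext => i; apply: eq_L2_tests => phi tphi.
by apply: oppr_inj; rewrite -hg// -hg'.
Qed.

Lemma RintegralDZ_test (a : R) (u v : H) phi : test_fun Omega phi ->
  (\int[m]_x ((a *: u + v : H) x * phi x))%R =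
  a * (\int[m]_x (u x * phi x))%R + (\int[m]_x (v x * phi x))%R.
Proof.
move=> tphi; have iu := integrable_test u tphi; have iv := integrable_test v tphi.
rewrite -RintegralZl// -RintegralD//; last exact: integrableMl_real.
apply: Rintegral_ae_eq.
- exact: integrable_test.
- exact: (integrableD measurableT (integrableMl_real a iu) iv).
- apply: ae_mono2 (L2_addE (a *: u) v) (L2_scaleE a u) => x -> ->.
  by rewrite mulrDl mulrA.
Qed.

Lemma weak_gradientDZ (a : R) (u v : H) g h : weak_gradient u g ->
  weak_gradient v h -> weak_gradient (a *: u + v) (fun i => a *: g i + h i).
Proof.
move=> hg hh phi tphi i.
rewrite !RintegralDZ_test// ?hg ?hh//; first by rewrite opprD mulrN.
exact: test_fun_derive.
Qed.

(** Rests on [(a p + q)^2 <= 2 a^2 p^2 + 2 q^2]. Integrals replace norms because test functions are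
    plain functions, not classes. *)
Lemma L2_cvg_int_DZ (a : R) (u v : H) (f g : nat -> 'rV[R]_n.+1 -> R) :
  (forall k, square_integrable m (f k : borel 'rV[R]_n.+1 -> R^o)) ->
  (forall k, square_integrable m (g k : borel 'rV[R]_n.+1 -> R^o)) ->
  (\int[m]_x ((u x - f k x) ^+ 2)%:E @[k --> \oo] --> 0)%E ->
  (\int[m]_x ((v x - g k x) ^+ 2)%:E @[k --> \oo] --> 0)%E ->
  (\int[m]_x (((a *: u + v : H) x - (a * f k x + g k x)) ^+ 2)%:E
    @[k --> \oo] --> 0)%E.
Proof.
move=> sf sg cu cv.
have mL (w : H) : measurable_fun setT (w : borel 'rV[R]_n.+1 -> R).
  exact/strongly_measurable_measurable/L2fun_strongly_measurable.
have mf k : measurable_fun setT (f k : borel 'rV[R]_n.+1 -> R).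
  by apply: strongly_measurable_measurable; case: (sf k).
have mg k : measurable_fun setT (g k : borel 'rV[R]_n.+1 -> R).
  by apply: strongly_measurable_measurable; case: (sg k).
have m1 k : measurable_fun setT (fun x => ((u x - f k x) ^+ 2)%:E).
  by apply/measurable_EFinP; apply: measurable_funX; exact: measurable_funB.
have m2 k : measurable_fun setT (fun x => ((v x - g k x) ^+ 2)%:E).
  by apply/measurable_EFinP; apply: measurable_funX; exact: measurable_funB.
have a0 : 0 <= 2 * a ^+ 2 by rewrite mulr_ge0 ?sqr_ge0.
apply: (@squeeze_cvge _ _ _ _ (fun=> 0%E) _ (fun k =>
   (2 * a ^+ 2)%:E * (\int[m]_x ((u x - f k x) ^+ 2)%:E) +
   2%:E * (\int[m]_x ((v x - g k x) ^+ 2)%:E))%E); last 2 first.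
- exact: cvg_cst.
- rewrite -[X in _ --> X]adde0 -[X in _ --> (X + _)%E](mule0 (2 * a ^+ 2)%:E).
  rewrite -[X in _ --> (_ + X)%E](mule0 2%:E).
  by apply: cvgeD; [rewrite !mule0|apply: cvgeZl|apply: cvgeZl].
apply: nearW => k; apply/andP; split.
  by apply: integral_ge0 => x _; rewrite lee_fin sqr_ge0.
rewrite -ge0_integralZl_EFin//; last by move=> x _; rewrite lee_fin sqr_ge0.
rewrite -ge0_integralZl_EFin//; last by move=> x _; rewrite lee_fin sqr_ge0.
rewrite -ge0_integralD//; last 4 first.
- by move=> x _; rewrite -EFinM lee_fin mulr_ge0 ?sqr_ge0.
- exact: measurable_funeM.
- by move=> x _; rewrite -EFinM lee_fin mulr_ge0 ?sqr_ge0.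
- exact: measurable_funeM.
have -> : (\int[m]_x (((a *: u + v : H) x - (a * f k x + g k x)) ^+ 2)%:E =
    \int[m]_x ((a * u x + v x - (a * f k x + g k x)) ^+ 2)%:E)%E.
  apply: ae_eq_integral => //.
  - apply/measurable_EFinP; apply: measurable_funX; apply: measurable_funB => //.
    by apply: measurable_funD => //; exact: measurable_funM.
  - apply/measurable_EFinP; apply: measurable_funX; apply: measurable_funB => //.
      by apply: measurable_funD => //; exact: measurable_funM.
    by apply: measurable_funD => //; exact: measurable_funM.
  - by apply: ae_mono2 (L2_addE (a *: u) v) (L2_scaleE a u) => x -> -> _.
apply: ge0_le_integral => //.
- by move=> x _; rewrite lee_fin sqr_ge0.
- apply/measurable_EFinP; apply: measurable_funX; apply: measurable_funB => //.
    by apply: measurable_funD => //; exact: measurable_funM.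
  by apply: measurable_funD => //; exact: measurable_funM.
- by apply: emeasurable_funD; exact: measurable_funeM.
- move=> x _; rewrite -!EFinM -EFinD lee_fin.
  have := sqr_ge0 (a * (u x - f k x) - (v x - g k x)).
  move: (u x) (v x) (f k x) (g k x) => p q r s; nra.
Qed.

Lemma H10_DZ (a : R) (u v : H) : H10 u -> H10 v -> H10 (a *: u + v).
Proof.
move=> [g wg [phi tphi [cphi cgphi]]] [h wh [psi tpsi [cpsi chpsi]]].
exists (fun i => a *: g i + h i); first exact: weak_gradientDZ.
exists (fun k x => a * phi k x + psi k x); first by move=> k; exact: test_funDZ.
have dphi k i := test_fun_derive (delta_mx ord0 i) (tphi k).
have dpsi k i := test_fun_derive (delta_mx ord0 i) (tpsi k).
split.
  by apply: L2_cvg_int_DZ => // k; exact: test_fun_sqint.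
move=> i.
have -> : (fun k => \int[m]_x (((a *: g i + h i : H) x -
      partial i (fun x => a * phi k x + psi k x)%R x) ^+ 2)%:E)%E =
   (fun k => \int[m]_x (((a *: g i + h i : H) x -
      (a * partial i (phi k) x + partial i (psi k) x)%R) ^+ 2)%:E)%E.
  apply/funext => k; apply: eq_integral => x _; congr ((_ - _) ^+ 2)%:E.
  by apply: derive_smoothDZ; [case: (tphi k)|case: (tpsi k)].
apply: L2_cvg_int_DZ (cgphi i) (chpsi i) => k.
  exact: test_fun_sqint (dphi k i).
exact: test_fun_sqint (dpsi k i).
Qed.

Lemma H10_weak_gradient (u : H) : H10 u -> weak_gradient u (grad u).
Proof. by move=> [g wg _]; exact: (xgetPex (fun=> 0) (ex_intro _ g wg)). Qed.

(** [grad] is a choice, so linearity comes from uniqueness, on functions known to have a weak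
    gradient. *)
Lemma gradDZ (a : R) (u v : H) : H10 u -> H10 v ->
  grad (a *: u + v) = (fun i => a *: grad u i + grad v i).
Proof.
move=> hu hv; apply: weak_gradient_unique.
  exact/H10_weak_gradient/H10_DZ.
by apply: weak_gradientDZ; exact: H10_weak_gradient.
Qed.

Lemma grad_innerC (u v : H) : grad_inner u v = grad_inner v u.
Proof. by apply: eq_bigr => i _; exact: innerC. Qed.

Lemma grad_innerDZ (a : R) (u v w : H) : H10 u -> H10 v ->
  grad_inner (a *: u + v) w = a * grad_inner u w + grad_inner v w.
Proof.
move=> hu hv; rewrite /grad_inner gradDZ// mulr_sumr -big_split; apply: eq_bigr => i _.
by rewrite innerDl innerZl.
Qed.

Lemma grad_inner_ge0 (u : H) : 0 <= grad_inner u u.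
Proof. by apply: sumr_ge0 => i _; rewrite inner_norm sqr_ge0. Qed.

Lemma grad_inner_sqDZ (a : R) (u v : H) : H10 u -> H10 v ->
  grad_inner (a *: u + v) (a *: u + v) =
  a ^+ 2 * grad_inner u u + 2 * a * grad_inner u v + grad_inner v v.
Proof.
move=> hu hv; rewrite (grad_innerDZ a (a *: u + v) hu hv).
have e2 : grad_inner u (a *: u + v) = a * grad_inner u u + grad_inner u v.
  by rewrite grad_innerC (grad_innerDZ a u hu hv) (grad_innerC v).
have e3 : grad_inner v (a *: u + v) = a * grad_inner u v + grad_inner v v.
  exact: etrans (grad_innerC v (a *: u + v)) (grad_innerDZ a v hu hv).
rewrite e2 e3; move: (grad_inner u u) (grad_inner u v) (grad_inner v v) => A B C; ring.
Qed.

End sobolev.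

(** * The measure c dmu *)

Section weighted.
Context d (S : measurableType d) (R : realType).
Context (mu : {measure set S -> \bar R}) (c : S -> R).
Context (mc : measurable_fun setT c) (c0 : forall r, 0 < c r).
Local Notation cmu := (weighted_measure mu mc c0).

Let mcE A : measurable_fun A (EFin \o c).
Proof. by apply/measurable_EFinP; exact: measurable_funTS. Qed.

Lemma weighted_measure_eq0 A : measurable A -> cmu A = 0%E <-> mu A = 0%E.
Proof.
move=> mA; split=> [cA|A0]; last exact: null_set_integral.
have : (\int[mu]_(x in A) `|(EFin \o c) x| = 0)%E.
  by rewrite -[RHS]cA; apply: eq_integral => x _ /=; rewrite gtr0_norm.
move=> /(ae_eq_integral_abs mu mA (@mcE A))[N [mN N0 AN]].
apply: (subset_measure0 mA mN _ N0) => x Ax; apply: AN => /= /(_ Ax).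
by case=> cx; move: (c0 x); rewrite cx ltxx.
Qed.

Lemma weighted_ae (P : S -> Prop) :
  {ae cmu, forall r, P r} <-> {ae mu, forall r, P r}.
Proof.
by split=> -[N [mN N0 PN]]; exists N; split=> //; exact/weighted_measure_eq0.
Qed.

Import HBNNSimple.

Let integral_indic_weighted A : measurable A ->
  (\int[cmu]_x (\1_A x)%:E = \int[mu]_x ((c x)%:E * (\1_A x)%:E))%E.
Proof.
move=> mA; rewrite integral_indic// setIT -[LHS]/(\int[mu]_(x in A) (c x)%:E)%E integral_mkcond.
apply: eq_integral => x _; rewrite patchE indicE.
by case: ifP; rewrite ?mule1 ?mule0.
Qed.

Let integral_nnsfun_weighted (h : {nnsfun S >-> R}) :
  (\int[cmu]_x (h x)%:E = \int[mu]_x ((c x)%:E * (h x)%:E))%E.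
Proof.
under [LHS]eq_integral do rewrite fimfunE -fsumEFin//.
rewrite [LHS]ge0_integral_fsum//; last 2 first.
  - by move=> r; exact/measurable_EFinP/measurableT_comp.
  - by move=> n x _; rewrite EFinM nnfun_muleindic_ge0.
under [RHS]eq_integral.
  move=> x xD; rewrite fimfunE -fsumEFin// ge0_mule_fsumr; last first.
    by move=> r; rewrite EFinM nnfun_muleindic_ge0.
  over.
rewrite [RHS]ge0_integral_fsum//; last 2 first.
  - move=> r; apply: emeasurable_funM => //.
    by apply/measurable_EFinP; do 2 apply/measurableT_comp => //.
  - by move=> n x _; apply: mule_ge0; [rewrite lee_fin ltW|exact: (nnfun_muleindic_ge0 h n x)].
apply: eq_fsbigr => r _; rewrite integralZl_indic_nnsfun//= integral_indic_weighted//.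
under [RHS]eq_integral do rewrite EFinM muleCA.
have [r0|r0] := leP 0 r.
  rewrite ge0_integralZl_EFin//.
    by move=> x _; rewrite mule_ge0// lee_fin ltW.
  by apply: emeasurable_funM => //; apply/measurable_EFinP; exact: measurable_indic.
rewrite preimage_nnfun0// indic0.
by rewrite !integral0_eq ?mule0// => x _; rewrite !mule0.
Qed.

(** The usual ladder: indicators, simple functions, then monotone convergence on both sides. *)
Lemma ge0_integral_weighted (g : S -> \bar R) : measurable_fun setT g ->
  (forall x, 0 <= g x)%E ->
  (\int[cmu]_x g x = \int[mu]_x ((c x)%:E * g x))%E.
Proof.
move=> mg g0; pose g_ := nnsfun_approx measurableT mg.
transitivity (limn (fun n => \int[cmu]_x (g_ n x)%:E)%E).
  rewrite -monotone_convergence//=.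
  - apply: eq_integral => x _; apply/esym/cvg_lim => //=.
    by apply: cvg_nnsfun_approx.
  - by move=> n; exact/measurable_EFinP.
  - by move=> n x _; rewrite lee_fin.
  - by move=> x _ p q pq; rewrite lee_fin//; exact/lefP/nd_nnsfun_approx.
rewrite (_ : (\int[mu]_x _)%E = limn (fun n => \int[mu]_x ((c x)%:E * (g_ n x)%:E))%E).
  by congr (limn _); apply/funext => n; exact: integral_nnsfun_weighted.
rewrite -monotone_convergence//=.
- apply: eq_integral => x _; apply/esym/cvg_lim => //=.
  by apply: cvgeZl => //; exact: cvg_nnsfun_approx.
- by move=> n; apply: emeasurable_funM => //; exact/measurable_EFinP.
- by move=> n x _; rewrite -EFinM lee_fin mulr_ge0// ltW.
- move=> x _ p q pq; rewrite lee_pmul2l ?lte_fin// lee_fin.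
  exact/lefP/nd_nnsfun_approx.
Qed.

Lemma Rintegral_weighted (g : S -> R) : measurable_fun setT g ->
  (\int[cmu]_x g x)%R = (\int[mu]_x (c x * g x))%R.
Proof.
move=> mg; have mgE : measurable_fun setT (EFin \o g) by exact/measurable_EFinP.
rewrite /Rintegral [in LHS]integralE [in RHS]integralE; congr (fine (_ - _)).
- rewrite ge0_integral_weighted//; last exact: measurable_funepos.
  apply: eq_integral => x _; rewrite !funeposE /= EFinM.
  by rewrite maxe_pMr ?mule0// lee_fin ltW.
- rewrite ge0_integral_weighted//; last exact: measurable_funeneg.
  apply: eq_integral => x _; rewrite !funenegE /= -mulrN EFinM.
  by rewrite maxe_pMr ?mule0// lee_fin ltW.
Qed.

End weighted.

Section sign_of_inner.
Context d (S : measurableType d) (R : realType).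
Context (mu : {measure set S -> \bar R}) (X : innerSpaceType R).
Implicit Types F G : L2 mu X.

Lemma L2_measurable_inner F G : measurable_fun setT (fun x => inner (F x) (G x)).
Proof. by apply: measurable_inner; exact: L2fun_strongly_measurable. Qed.

Let inner_abs F G : {ae mu, forall x, 0 <= inner (F x) (G x)} ->
  inner F G = fine (\int[mu]_x `|(inner (F x) (G x))%:E|)%E.
Proof.
move=> FG; have mFG := L2_measurable_inner F G.
rewrite L2_innerE /Rintegral; congr fine; apply: ae_eq_integral => //.
- exact/measurable_EFinP.
- by apply: measurableT_comp => //; exact/measurable_EFinP.
- by apply: ae_mono FG => x h _; rewrite gee0_abs ?lee_fin.
Qed.

Lemma L2_inner_ge0 F G : {ae mu, forall x, 0 <= inner (F x) (G x)} -> 0 <= inner F G.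
Proof. by move=> /inner_abs ->; rewrite fine_ge0// integral_ge0. Qed.

Lemma L2_inner_le0_ae_eq0 F G : {ae mu, forall x, 0 <= inner (F x) (G x)} ->
  inner F G <= 0 -> {ae mu, forall x, inner (F x) (G x) = 0}.
Proof.
move=> FG FG0; have mFG := L2_measurable_inner F G.
have iFG := integrable_inner (L2_square_integrable F) (L2_square_integrable G).
have I0 : (\int[mu]_x `|(inner (F x) (G x))%:E| = 0)%E.
  have -> : (\int[mu]_x `|(inner (F x) (G x))%:E| = (inner F G)%:E)%E.
    rewrite inner_abs// fineK//.
    by apply: (integrable_fin_num measurableT); exact: integrable_abse iFG.
  by congr EFin; apply/eqP; rewrite eq_le FG0 L2_inner_ge0.
have mE : measurable_fun setT (EFin \o (fun x => inner (F x) (G x))) by exact/measurable_EFinP.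
have /(ae_eq_integral_abs mu measurableT mE) := I0.
by apply: ae_mono => x /(_ I) [].
Qed.

(** For simple [f] the preimages are finite unions of rectangles, by continuity of [inner v];
    pointwise limits do the rest. *)
Lemma measurable_inner_borel (f : S -> X) : strongly_measurable f ->
  measurable_fun setT (fun p : (S * borel X)%type => inner (f p.1) (p.2 : X)).
Proof.
move=> [s [ss sf]].
apply: (measurable_fun_cvg (h := fun n (p : (S * borel X)%type) => inner (s n p.1) (p.2 : X))).
  move=> n _ A mA; rewrite setTI; have [fs ms] := ss n.
  rewrite (_ : _ @^-1` A = \bigcup_(v in range (s n))
      ((s n @^-1` [set v]) `*` [set y : borel X | A (inner v (y : X))])).
    apply: fin_bigcup_measurable => // v _; apply: measurableX => //.
    rewrite -[X in measurable X]setTI.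
    under eq_set do rewrite innerC.
    apply: (continuous_borel_measurable (f := inner^~ v)) => // y.
    exact: (@cvg_inner _ _ _ _ _ id).
  apply/seteqP; split=> [[r y] /= Ary|[r y] [v _ [/= <-]]//].
  by exists (s n r); first by exists r.
by move=> p _; apply: cvg_inner; exact: sf.
Qed.

End sign_of_inner.

(** * The energy *)

Section energy_theory.
Context (R : realType) n (Omega : set 'rV[R]_n.+1).
Context (hO : bounded_lipschitz_domain Omega).
Context d (S : measurableType d) (mu : {finite_measure set S -> \bar R}) (c : S -> R).
Context (mc : measurable_fun setT c) (c0 : forall r, 0 < c r).
Hypothesis Sc_fin : (\int[mu]_r (c r)%:E < +oo)%E.
Context (kappa : R) (kappa0 : 0 < kappa).
Context (K : S -> set (L2domain R hO)).
Hypothesis K_measurable : measurable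
  ([set p | K p.1 p.2] : set (S * borel (L2domain R hO))%type).

Local Notation H := (L2domain R hO).
Local Notation cmu := (weighted_measure mu mc c0).
Local Notation M := (L2 cmu H).
Local Notation HM := (wprod kappa0 H M).

Let cmu_fin : (cmu setT < +oo)%E. Proof. exact: Sc_fin. Qed.

Definition feasible (U : HM) :=
  H10 U.1 /\ {ae mu, forall r, K r (U.1 - U.2 r)}.

Lemma Psi_feasible (U : HM) : feasible U ->
  Psi K U = (2^-1 * grad_inner U.1 U.1)%:E.
Proof. by rewrite /Psi; case: asboolP. Qed.

Lemma Psi_infeasible (U : HM) : ~ feasible U -> Psi K U = +oo%E.
Proof. by rewrite /Psi; case: asboolP. Qed.

(** Uses that [c] has a finite integral. Through [inner_cst] the integral term of the equation
    becomes an inner product in [M]. *)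
Lemma L2_cst (phi : H) : exists Phi : M, {ae cmu, forall r, Phi r = phi}.
Proof. exact/L2_exists/square_integrable_cst. Qed.

Lemma inner_cst (W : M) (phi : H) (Phi : M) : {ae cmu, forall r, Phi r = phi} ->
  inner W Phi = (\int[mu]_r (c r * inner (W r) phi))%R.
Proof.
move=> Phi_phi.
rewrite (L2_inner_ae (L2_square_integrable W) (square_integrable_cst phi cmu_fin) _ Phi_phi);
  last exact: aeW.
rewrite Rintegral_weighted; first by [].
exact: (measurable_inner (L2fun_strongly_measurable _) (strongly_measurable_cst S phi)).
Qed.

Lemma subdifferential_of_variational (u g du : H) (w dw : M) : H10 u ->
  (forall phi, H10 phi -> kappa * inner du phi +
    (\int[mu]_r (c r * inner (dw r) phi))%R + grad_inner u phi = inner g phi) ->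
  {ae mu, forall r, K r (u - w r) /\ normal_cone (K r) (u - w r) (dw r)} ->
  subdifferential (Psi K) ((u, w) : HM) (kappa^-1 *: g - du, - dw).
Proof.
move=> hu eqn cone Y.
have fU : feasible (u, w) by split=> //; apply: ae_mono cone => r [].
have [fY|/Psi_infeasible ->] := pselect (feasible Y); last by rewrite leey.
rewrite !Psi_feasible// -EFinD lee_fin wprod_inner.
have key (v : H) (z : M) : feasible (v, z) ->
    2^-1 * grad_inner u u + (kappa * inner (kappa^-1 *: g - du) (v - u) +
      inner (- dw) (z - w)) <= 2^-1 * grad_inner v v.
  move=> [/= hv Kv].
  have hphi : H10 (v - u) by rewrite addrC -scaleN1r; exact: H10_DZ.
  have [Phi PhiE] := L2_cst (v - u).
  have := eqn _ hphi; rewrite -(inner_cst dw PhiE).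
  rewrite (innerBl _ du) innerZl innerNl mulrBr mulVKf ?gt_eqF// => <-.
  (* For almost every [r], [z - w - Phi] is [u - w r] minus [v - z r], so this is the normal cone
     inequality integrated over [r]. *)
  have cone_le : inner dw Phi <= inner dw (z - w).
    rewrite -subr_ge0 -innerBr; apply: L2_inner_ge0.
    have /(weighted_ae mu mc c0) sgn : {ae mu, forall r,
        inner (dw r) ((v - z r) - (u - w r)) <= 0}.
      by apply: ae_mono2 cone Kv => r [_ h] /h.
    have /(ae_mono2 _ sgn) : {ae cmu, forall r, (z - w - Phi : M) r =
        - ((v - z r) - (u - w r))}.
      apply: filterS3 PhiE (L2_subE (z - w) Phi) (L2_subE z w) => r -> -> ->.
      by rewrite !opprB [RHS]addrC addrACA [RHS]addrACA (addrC (- v)).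
    by apply=> r h ->; rewrite innerC innerNl innerC oppr_ge0.
  (* Expanding around [u], the surplus is half of the squared gradient norm of [v - u]. *)
  have -> : grad_inner v v = grad_inner (1 *: (v - u) + u) (1 *: (v - u) + u).
    by rewrite scale1r subrK.
  rewrite grad_inner_sqDZ// (grad_innerC u).
  move: (grad_inner_ge0 (v - u)) cone_le.
  move: (grad_inner _ _) (grad_inner _ _) (grad_inner _ _) => A B C.
  move: (inner _ _) (inner _ _) (inner _ _) => D E F; lra.
by case: Y fY => v z; exact: key.
Qed.

(** At [h = A / (B + 1)] the inequality becomes [A^2 (B + 1) <= A^2 B]; the added 1 avoids dividing
    by 0. *)
Let linear_le_quadratic (A B : R) : 0 <= B -> (forall h, h * A <= h ^+ 2 * B) -> A = 0.
Proof.
move=> B0 /(_ (A / (B + 1))); have B1 : 0 < B + 1 by rewrite ltr_wpDl.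
have -> : A / (B + 1) * A = A ^+ 2 * (B + 1) / (B + 1) ^+ 2 by field; rewrite gt_eqF.
have -> : (A / (B + 1)) ^+ 2 * B = A ^+ 2 * B / (B + 1) ^+ 2 by field; rewrite gt_eqF.
rewrite ler_pM2r ?invr_gt0 ?exprn_gt0// => A2.
by apply/eqP; rewrite -sqrf_eq0 eq_le sqr_ge0 andbT; lra.
Qed.

Lemma variational_of_subdifferential (u g du : H) (w dw : M) : feasible (u, w) ->
  subdifferential (Psi K) ((u, w) : HM) (kappa^-1 *: g - du, - dw) ->
  forall phi, H10 phi -> kappa * inner du phi +
    (\int[mu]_r (c r * inner (dw r) phi))%R + grad_inner u phi = inner g phi.
Proof.
move=> fU sub phi hphi; have [/= hu Ku] := fU.
have [Phi PhiE] := L2_cst phi; rewrite -(inner_cst dw PhiE).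
pose L := inner g phi - kappa * inner du phi - inner dw Phi.
suff : L - grad_inner u phi = 0.
  rewrite /L; move: (grad_inner _ _) (inner _ _) (inner _ _) (inner _ _) => A B C D.
  by move=> /eqP; rewrite subr_eq0 => /eqP <-; ring.
have P0 : 0 <= 2^-1 * grad_inner phi phi by rewrite mulr_ge0// grad_inner_ge0.
(* The energy is quadratic along the line, so the subgradient inequality at [Y] reads [h A <= h^2 B]
   with [A = L - grad_inner u phi] and [B] half of [grad_inner phi phi]. *)
apply: (linear_le_quadratic P0) => h.
pose Y : HM := (h *: phi + u, h *: Phi + w).
have fY : feasible Y.
  split=> /=; first exact: H10_DZ.
  have /(weighted_ae mu mc c0) : {ae cmu, forall r, (h *: Phi + w : M) r = h *: phi + w r}.
    apply: filterS3 PhiE (L2_addE (h *: Phi) w) (L2_scaleE h Phi) => r e -> ->.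
    by rewrite e.
  apply: ae_mono2 Ku => r Kr ->; rewrite (_ : _ - _ = u - w r)//.
  by rewrite opprD addrACA subrr add0r.
have := sub Y; rewrite !Psi_feasible// -EFinD lee_fin wprod_inner /=.
rewrite !addrK innerBl innerZl innerNl !innerZr.
rewrite mulrBr (mulVKf (lt0r_neq0 kappa0)) (grad_inner_sqDZ h hphi hu) (grad_innerC phi u).
rewrite /L; move: (grad_inner _ _) (grad_inner _ _) (grad_inner _ _) => A B C.
move: (inner _ _) (inner _ _) (inner _ _) => D E F; lra.
Qed.

(** Moving from [w] to [w - V] with [u] fixed leaves the energy unchanged and shifts [u - w] by [V];
    only the term in [dw] survives. *)
Lemma inner_le0_of_subdifferential (u g du : H) (w dw V : M) : feasible (u, w) ->
  subdifferential (Psi K) ((u, w) : HM) (kappa^-1 *: g - du, - dw) ->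
  {ae mu, forall r, K r (u - w r + V r)} -> inner dw V <= 0.
Proof.
move=> fU sub KV; have [/= hu _] := fU.
pose Y : HM := (u, w - V).
have fY : feasible Y.
  split=> //=; have /(weighted_ae mu mc c0) := L2_subE w V.
  by apply: ae_mono2 KV => r + ->; rewrite opprB addrA addrAC.
have := sub Y; rewrite !Psi_feasible// -EFinD lee_fin wprod_inner /=.
rewrite subrr [inner _ 0]innerC inner0l mulr0 add0r addrAC subrr add0r.
rewrite innerNl innerC innerNl opprK innerC.
by move: (grad_inner _ _) (inner _ _) => A B; lra.
Qed.

(** Each violating [y] satisfies the bound for large [m], so it costs only a countable union, and it
    will make a selection square integrable. *)
Lemma measurable_cone_violation (u : H) (w dw : M) (m : nat) :
  measurable ([set p | [/\ K p.1 p.2, 0 < inner (dw p.1) (p.2 - (u - w p.1)) &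
    `|p.2| <= m%:R]] : set (S * borel H)%type).
Proof.
rewrite (_ : mkset _ = [set p | K p.1 p.2] `&`
    ([set p | 0 < inner (dw p.1) (p.2 - (u - w p.1))] `&` [set p | `|p.2| <= m%:R])); last first.
  by apply/seteqP; split=> p [? []].
apply: measurableI => //; apply: measurableI.
  have mi : measurable_fun setT (fun p : (S * borel H)%type =>
      inner (dw p.1) ((p.2 : H) - (u - w p.1))).
    under eq_fun do rewrite innerBr innerBr.
    apply: measurable_funB.
      exact: (measurable_inner_borel (L2fun_strongly_measurable (repr dw))).
    apply: measurable_funB.
      apply: (measurableT_comp (f := fun r => inner (dw r) u)) => //.
      exact: (measurable_inner (L2fun_strongly_measurable _) (strongly_measurable_cst S u)).
    apply: (measurableT_comp (f := fun r => inner (dw r) (w r))) => //.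
    exact: L2_measurable_inner.
  rewrite -[X in measurable X]setTI.
  have := mi measurableT `]0, +oo[%classic (measurable_itv _).
  by congr measurable; apply/seteqP; split=> p /=; rewrite in_itv /= andbT.
have mn : measurable_fun setT (fun p : (S * borel H)%type => `|p.2 : H|).
  apply: (measurableT_comp (f := fun y : borel H => `|y : H|)) => //.
  by apply: (@continuous_borel_measurable _ H) => y; exact: norm_continuous.
rewrite -[X in measurable X]setTI.
have := mn measurableT `]-oo, m%:R]%classic (measurable_itv _).
by congr measurable; apply/seteqP; split=> p /=; rewrite in_itv.
Qed.

Lemma cone_of_subdifferential (u g du : H) (w dw : M) : feasible (u, w) ->
  subdifferential (Psi K) ((u, w) : HM) (kappa^-1 *: g - du, - dw) ->
  {ae mu, forall r, normal_cone (K r) (u - w r) (dw r)}.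
Proof.
move=> fU sub; have [_ /= Ku] := fU.
pose E m : set (S * borel H)%type := [set p | [/\ K p.1 p.2,
  0 < inner (dw p.1) (p.2 - (u - w p.1)) & `|p.2| <= m%:R]].
suff E0 m : mu.-negligible (fst @` E m).
  have : {ae mu, forall r, forall m, ~ (fst @` E m) r}.
    by apply: ae_foralln => m; apply: negligibleS (E0 m) => r /= /contrapT.
  apply: ae_mono => r Er y Ky; rewrite leNgt; apply/negP => y0.
  apply: (Er (Num.trunc `|y|).+1); exists (r, y) => //; split=> //=.
  exact/ltW/truncnS_gt.
apply: contrapT => nE.
have [D D_dense] := L2domain_separable hO.
have [B [y [mB B0 my BE]]] := measurable_selection
  (L2_complete (lebesgue_on_finite hO)) D_dense (measurable_cone_violation u w dw m) nE.
pose q r := u - w r.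
have sqq : square_integrable cmu q.
  have := square_integrableDZ (-1) (L2_square_integrable w) (square_integrable_cst u cmu_fin).
  by congr square_integrable; apply/funext => r; rewrite scaleN1r addrC.
have m1 : measurable_fun setT (\1_B : S -> R) by exact: measurable_indic.
have sq1 : square_integrable cmu (fun r => \1_B r *: q r).
  apply: (square_integrable_le _ sqq); first exact: (strongly_measurable_scale m1 (proj1 sqq)).
  by move=> r; rewrite normrZ indicE; case: (_ \in _); rewrite ?normr1 ?normr0 ?mul1r ?mul0r.
have sq2 : square_integrable cmu (fun r => \1_B r *: y r).
  apply: (square_integrable_le _ (square_integrable_cst (m%:R : R^o) cmu_fin)).
    exact: (strongly_measurable_scale m1 my).
  move=> r; rewrite normrZ indicE; have [/set_mem Br|] := boolP (r \in B).
    by rewrite normr1 mul1r normr_nat; have [_ _] := BE r Br.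
  by rewrite normr0 mul0r.
(* [V] is the class of [1_B (y - q)]. Splitting it separates [q], square integrable by itself, from
   [y], bounded by [m] on [B]. *)
have [V VE] := L2_exists (square_integrableDZ (-1) sq1 sq2).
have V1 r : B r -> -1 *: (\1_B r *: q r) + \1_B r *: y r = y r - q r.
  by move=> Br; rewrite indicE mem_set// !scale1r scaleN1r addrC.
have V0 r : ~ B r -> -1 *: (\1_B r *: q r) + \1_B r *: y r = 0.
  by move=> Br; rewrite indicE memNset// !scale0r scaler0 addr0.
have dwV_le0 : inner dw V <= 0.
  apply: (inner_le0_of_subdifferential fU sub).
  have /(weighted_ae mu mc c0) := VE.
  apply: ae_mono2 Ku => r Kr ->; have [Br|Br] := pselect (B r).
    by rewrite V1// addrC subrK; have [] := BE r Br.
  by rewrite V0// addr0.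
(* The integrand is nonnegative, and positive on [B] by the choice of [y]; a nonpositive integral
   forces [B] to be null. *)
have /L2_inner_le0_ae_eq0 : {ae cmu, forall r, 0 <= inner (dw r) (V r)}.
  apply: ae_mono VE => r ->; have [Br|Br] := pselect (B r).
    by rewrite V1//; have [_ /ltW] := BE r Br.
  by rewrite V0// innerC inner0l.
move=> /(_ dwV_le0) dwV0.
have : {ae cmu, forall r, ~ B r}.
  apply: ae_mono2 dwV0 VE => r dV0 Vr Br.
  by have [_ /= + _] := BE r Br; rewrite -(V1 r Br) -Vr dV0 ltxx.
move=> /(weighted_ae mu mc c0) [N [mN N0 BN]].
have : mu B = 0%E.
  by apply: (subset_measure0 mB mN _ N0) => r Br; apply: BN => /(_ Br).
by move=> B00; rewrite B00 ltxx in B0.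
Qed.

End energy_theory.

Theorem theorem3p9 (R : realType) (n : nat) (Omega : set 'rV[R]_n.+1)
    (hO : bounded_lipschitz_domain Omega) (T : R) (T0 : 0 < T)
    (d : measure_display) (S : measurableType d)
    (mu : {finite_measure set S -> \bar R}) (mu_complete : measure_is_complete mu)
    (a : R) (a0 : 0 <= a)
    (c : S -> R) (mc : measurable_fun setT c) (c0 : forall r, 0 < c r)
    (Sc_fin : (\int[mu]_r (c r)%:E < +oo)%E)
    (K : S -> set (L2domain R hO))
    (K_closed : forall r, closed (K r))
    (K_convex : forall r, convex_set (K r))
    (K_0 : forall r, K r 0)
    (K_measurable : measurable
      ([set p | K p.1 p.2] : set (S * borel (L2domain R hO))%type))
    (f : L2 (lebesgue_time T) (L2domain R hO))
    (u0 : L2domain R hO) (w0 : L2 (weighted_measure mu mc c0) (L2domain R hO))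
    (u0_V : H10 u0) (u0w0 : {ae mu, forall r, K r (u0 - w0 r)})
    (u : R -> L2domain R hO)
    (w : R -> L2 (weighted_measure mu mc c0) (L2domain R hO))
    (u_H1 : H1time T u) (u_L2V : L2V T u) (w_H1 : H1time T w) :
  let kappa := 1 + a in
  let HM := wprod (kappa_gt0 a0) (L2domain R hO)
    (L2 (weighted_measure mu mc c0) (L2domain R hO)) in
  let U : R -> HM := fun t => (u t, w t) in
  let F : R -> HM := fun t => (kappa^-1 *: f t, 0) in
  let dtu : R -> L2domain R hO := time_derivative T u in
  let dtw : R -> L2 (weighted_measure mu mc c0) (L2domain R hO) :=
    time_derivative T w in
  let dtU : R -> HM := time_derivative T U in
  (u 0 = u0 /\ w 0 = w0 /\
   {ae lebesgue_time T, forall t,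
     (forall phi : L2domain R hO, H10 phi ->
        kappa * inner (dtu t) phi
        + (\int[mu]_r (c r * inner (dtw t r) phi))%R
        + grad_inner (u t) phi = inner (f t) phi) /\
     {ae mu, forall r, K r (u t - w t r) /\
        normal_cone (K r) (u t - w t r) (dtw t r)}})
  <->
  ({ae lebesgue_time T, forall t,
     [set dtU t + xi | xi in subdifferential (Psi K) (U t)] (F t)} /\
   U 0 = (u0, w0)).
Proof.
move=> kappa HM U F dtu dtw dtU.
have dU := time_derivative_pair (kappa_gt0 a0) u_H1 w_H1.
(* (i) does not assert that [u t] lies in [H10]; this is taken from [L2V]. *)
have uV : {ae lebesgue_time T, forall t, H10 (u t)}.
  by case: u_L2V => v uv [hv _ _]; apply: ae_mono uv => t ->.
have subE t : dtU t = (dtu t, dtw t) -> F t - dtU t = (kappa^-1 *: f t - dtu t, - dtw t).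
  by move=> ->; congr pair; exact: sub0r.
split=> [[u00 [w00 h]]|[h U0]].
  split; last by rewrite /U u00 w00.
  have hh : {ae lebesgue_time T, forall t, subdifferential (Psi K : HM -> \bar R) (U t)
      (kappa^-1 *: f t - dtu t, - dtw t)}.
    apply: ae_mono2 h uV => t [eqn cone] hu.
    exact: subdifferential_of_variational.
  apply: ae_mono2 hh dU => t sub dUt.
  exists (F t - dtU t); first by rewrite subE.
  exact: subrKC.
split; first by have := congr1 fst U0.
split; first by have := congr1 snd U0.
pose feas := @feasible R n Omega hO d S mu c mc c0 kappa (kappa_gt0 a0) K.
have feas0 : feas (u0, w0) by [].
apply: ae_mono2 h dU => t [xi sub xiE] dUt.
have {xiE} xiE : xi = (kappa^-1 *: f t - dtu t, - dtw t).
  by rewrite -subE// -xiE addrAC subrr add0r.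
rewrite {}xiE in sub.
(* A subgradient exists only where [Psi] is finite: the inequality at the initial datum, whose
   energy is finite, excludes the value [+oo] at [U t]. This yields the constraint in (i). *)
have fU : feas (U t).
  apply: contrapT => /Psi_infeasible UE; have := sub (u0, w0).
  by rewrite UE (Psi_feasible feas0).
split=> [phi hphi|].
  exact: (variational_of_subdifferential Sc_fin fU sub hphi).
have cone := cone_of_subdifferential Sc_fin K_measurable fU sub.
by case: fU => _ /=; apply: ae_mono2 cone.
Qed.
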